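(* Let $\alpha,\beta\in(0,1)$ have degrees $(n_1,n_2)=(3,5)$, i.e. $\beta$ has degree $\frac53$ over $\alpha$: $$\frac53\,\frac{{}_2F_1\left(\frac12,\frac12;1;1-\alpha\right)}{{}_2F_1\left(\frac12,\frac12;1;\alpha\right)}=\frac{{}_2F_1\left(\frac12,\frac12;1;1-\beta\right)}{{}_2F_1\left(\frac12,\frac12;1;\beta\right)},$$ and let $$m=\frac{z_3}{z_5},\qquad z_3={}_2F_1\left(\tfrac12,\tfrac12;1;\alpha\right),\quad z_5={}_2F_1\left(\tfrac12,\tfrac12;1;\beta\right),$$ be the multiplier. Then: (i) $$\begin{aligned} m-\frac{5}{3m}=\;&\frac23\left((\alpha\beta)^{1/8}-\{(1-\alpha)(1-\beta)\}^{1/8}\right)\Big[1-3\left((\alpha\beta)^{1/8}+\{(1-\alpha)(1-\beta)\}^{1/8}\right)\\ &+3\left((\alpha\beta)^{1/4}+\{(1-\alpha)(1-\beta)\}^{1/4}\right)+2\left(\alpha\beta(1-\alpha)(1-\beta)\right)^{1/8}\left(3-(\alpha\beta)^{1/8}-\{(1-\alpha)(1-\beta)\}^{1/8}\right)\Big]. \end{aligned}$$ (ii) $$\begin{aligned} m-\frac{5}{3m}=\;&\frac23\left((\alpha\beta)^{1/4}-\{(1-\alpha)(1-\beta)\}^{1/4}\right)\Big[4\sqrt{\tfrac12\left(1+\sqrt{\alpha\beta}+\sqrt{(1-\alpha)(1-\beta)}\right)}\\ &-4+\left((\alpha\beta)^{1/4}+\{(1-\alpha)(1-\beta)\}^{1/4}\right)\Big].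 \end{aligned}$$ (iii) In terms of Ramanujan's theta functions $\varphi,\psi$, for $|q|<1$, $$\begin{aligned} \frac{\varphi^2(q^3)}{\varphi^2(q^5)}-\frac53\,\frac{\varphi^2(q^5)}{\varphi^2(q^3)}=\;&\frac23\left(\frac{4q^2\psi(q^6)\psi(q^{10})}{\varphi(q^3)\varphi(q^5)}-\frac{\varphi(-q^3)\varphi(-q^5)}{\varphi(q^3)\varphi(q^5)}\right)\Big[4\left(\frac{\varphi(q^6)\varphi(q^{10})}{\varphi(q^3)\varphi(q^5)}+\frac{4q^4\psi(q^{12})\psi(q^{20})}{\varphi(q^3)\varphi(q^5)}\right)\\ &-4+\left(\frac{4q^2\psi(q^6)\psi(q^{10})}{\varphi(q^3)\varphi(q^5)}+\frac{\varphi(-q^3)\varphi(-q^5)}{\varphi(q^3)\varphi(q^5)}\right)\Big]. \end{aligned}$$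
   Context: ${}_2F_1(a,b;c;x)$ is the Gauss hypergeometric function. For $\alpha,\beta\in(0,1)$ and a positive rational $n$, one says $\beta$ has degree $n$ over $\alpha$ if $n\,\frac{{}_2F_1(\frac12,\frac12;1;1-\alpha)}{{}_2F_1(\frac12,\frac12;1;\alpha)}=\frac{{}_2F_1(\frac12,\frac12;1;1-\beta)}{{}_2F_1(\frac12,\frac12;1;\beta)}$. All fractional powers and square roots are the positive real ones. Ramanujan's theta functions are, for $|q|<1$, $\varphi(q)=\sum_{n=-\infty}^{\infty}q^{n^2}=(-q;q^2)_\infty^2(q^2;q^2)_\infty$ and $\psi(q)=f(q,q^3)$, where $f(a,b)=\sum_{n=-\infty}^{\infty}a^{n(n+1)/2}b^{n(n-1)/2}$ for $|ab|<1$; equivalently $\psi(q)=\sum_{n=0}^{\infty}q^{n(n+1)/2}$. Here $(a;q)_\infty=\prod_{k\ge0}(1-aq^k)$. For $\alpha,\beta$ of degrees $(3,5)$, the common base $q\in(0,1)$ is determined by $q^3=\exp\left(-\pi\,\frac{{}_2F_1(\frac12,\frac12;1;1-\alpha)}{{}_2F_1(\frac12,\frac12;1;\alpha)}\right)$, equivalently $q^5=\exp\left(-\pi\,\frac{{}_2F_1(\frac12,\frac12;1;1-\beta)}{{}_2F_1(\frac12,\frac12;1;\beta)}\right)$; with this $q$ one has $z_3=\varphi^2(q^3)$, $z_5=\varphi^2(q^5)$, so $m=\varphi^2(q^3)/\varphi^2(q^5)$. *)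

(* Defs.v *)
From Stdlib Require Export Reals ZArith.
From Coquelicot Require Export Coquelicot.

Local Open Scope R_scope.

Fixpoint rising_factorial (a : R) (n : nat) : R :=
  match n with
  | O => 1
  | S k => rising_factorial a k * (a + INR k)
  end.

Definition hypergeom_2F1 (a b c x : R) : R :=
  PSeries (fun n => rising_factorial a n * rising_factorial b n
                    / (rising_factorial c n * INR (fact n))) x.

(** The [z] of Ramanujan's theory at modulus [x], i.e. [2 K / PI] where [K] is
    the complete elliptic integral of the first kind and [x] is [k^2]. *)
Definition ell_z (x : R) : R := hypergeom_2F1 (1/2) (1/2) 1 x.

(** [has_degree n beta alpha]: "beta has degree n over alpha". *)
Definition has_degree (n beta alpha : R) : Prop :=
  n * (ell_z (1 - alpha) / ell_z alpha) = ell_z (1 - beta) / ell_z beta.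

Local Open Scope C_scope.

(** Coquelicot's [Series] is real-valued, so complex series are summed
    componentwise.  A bilateral series is the sum over [n >= 0] plus the sum
    over [n <= -1]. *)
Definition CSeries (a : nat -> C) : C :=
  (Series (fun n => Re (a n)), Series (fun n => Im (a n))).

Definition CSeries_Z (a : Z -> C) : C :=
  CSeries (fun n => a (Z.of_nat n)) + CSeries (fun n => a (- Z.of_nat (S n))%Z).

(** All exponents below are nonnegative integers for every [n : Z], so neither
    [Z.div] nor [Z.to_nat] loses information; moreover [Cpow 0 0 = 1], so the
    values at [q = 0] are the usual ones. *)
Definition theta_f (a b : C) : C :=
  CSeries_Z (fun n => a ^ Z.to_nat (n * (n + 1) / 2)
                      * b ^ Z.to_nat (n * (n - 1) / 2)).

Definition theta_phi (q : C) : C := CSeries_Z (fun n => q ^ Z.to_nat (n * n)).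

Definition theta_psi (q : C) : C := theta_f q (q ^ 3).

(* Main.v *)
Require Import Defs.
From Stdlib Require Import Reals Lra Lia ZArith List FinFun Classical ClassicalEpsilon.
From Coquelicot Require Import Coquelicot.
Import ListNotations.
Local Open Scope R_scope.

(** Write a = alpha and b = beta, and let q be the common base, so that
    a and b are the values at q^3 and q^5 of the function
    1 - phi(-q)^4 / phi(q)^4 and z_3 = phi(q^3)^2, z_5 = phi(q^5)^2.  Put
    u = (a b)^(1/8), v = ((1-a)(1-b))^(1/8), p = u + v and r = u v.  All three
    parts of the theorem say that

      m - 5/(3m) = (v - u)/3 * (p^3 - 5 p^2 + 5 p - 3).

    _The modular equation._  The classical product formulas
    phi(q)^2 = phi(q^2)^2 + 4 q psi(q^4)^2 and psi(q)^2 = phi(q) psi(q^2) turn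
    u, v and w = sqrt((1 + u^4 + v^4)/2) into polynomials in theta values, divided
    by phi(q^3) phi(q^5).  An identity between the theta series of the binary form
    3 X^2 + 5 Y^2 (lemma [schroter15]) then reads w = u + v - u v.  Squaring it,
    (p - 1) ((p - 1)(p + 1)^2 - 4 p r) = 0, and p - 1 is a nonzero power series,
    so (p - 1)(p + 1)^2 = 4 p r (lemma [relation35]).  These theta identities
    are rearrangements of double series with positive terms for 0 < q < 1,
    and extend to the complex disc as identities of power series.

    _The multiplier._  Along the curve, q da/dq = 3 a (1-a) z_3^2 and
    q db/dq = 5 b (1-b) z_5^2.  Differentiating the modular equation gives a
    linear relation between 3 z_3^2 and 5 z_5^2, that is m^2 as a rational
    function of a, b, u and v ([relation_derivative]).  As a b and a + b are
    polynomials in u and v, the square of m - 5/(3m) is a rational function of u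
    and v, and on the curve it is the square of the right-hand side
    ([elimination], [squares_agree]).  Both sides are power series in q up to a
    common denominator, so they agree up to sign, and the values at q = 0 decide
    the sign ([multiplier_identity]).

    _The hypergeometric function._  The link between F = 2F1(1/2,1/2;1;.) and
    theta functions is Landen's transformation [landen], an instance of
    uniqueness of the analytic solution of the hypergeometric equation.
    Iterating q -> q^2 it gives F(a) = phi(q)^2, and it shows that
    F(1-a)/F(a) doubles when q is squared.  The Wronskian of F(x) and F(1-x)
    makes this ratio equal to a constant times -log a up to a bounded error,
    which together with the doubling forces it to be a constant times -log q
    ([period_ratio_modulus]); so a hypothesis on degrees is a statement about
    powers of q, and the derivative of a along q comes for free. *)

(** * Real power series on the complex unit disc *)

(** The sequence with value [d n] at index [e n] and [z] off the range of [e]: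
    it turns a lacunary series, or a series in q^k, into a power series. *)
Definition spread {T : Type} (z : T) (e : nat -> nat) (d : nat -> T) (m : nat) : T :=
  match excluded_middle_informative (exists n, e n = m) with
  | left H => d (proj1_sig (constructive_indefinite_description _ H))
  | right _ => z
  end.

Definition strictly_increasing (e : nat -> nat) : Prop := forall n, (e n < e (S n))%nat.

Lemma strictly_increasing_lt e : strictly_increasing e -> forall m n, (m < n)%nat -> (e m < e n)%nat.
Proof.
  intros He m n; induction 1 as [|n _ IH]; [apply He|].
  specialize (He n); lia.
Qed.

Lemma strictly_increasing_ge e : strictly_increasing e -> forall n, (n <= e n)%nat.
Proof.
  intros He; induction n as [|n IH]; [lia|]. specialize (He n); lia.
Qed.

Lemma strictly_increasing_inj e : strictly_increasing e -> forall m n, e m = e n -> m = n.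
Proof.
  intros He m n E.
  destruct (Nat.lt_trichotomy m n) as [H|[H|H]]; trivial;
    apply (strictly_increasing_lt e He) in H; lia.
Qed.

Lemma spread_hit {T} (z : T) e d n : strictly_increasing e -> spread z e d (e n) = d n.
Proof.
  intros He; unfold spread.
  destruct excluded_middle_informative as [H|H].
  - destruct constructive_indefinite_description as [k Hk]; simpl.
    now rewrite (strictly_increasing_inj e He _ _ Hk).
  - destruct H; now exists n.
Qed.

Lemma spread_miss {T} (z : T) e d m : (forall n, e n <> m) -> spread z e d m = z.
Proof.
  intros H; unfold spread.
  destruct excluded_middle_informative as [[n Hn]|]; trivial.
  now destruct (H n).
Qed.

Lemma spread_map {T U} (g : T -> U) z e d m :
  spread (g z) e (fun n => g (d n)) m = g (spread z e d m).
Proof. unfold spread; now destruct excluded_middle_informative. Qed.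

(** Sums over [k < N]; the half-open range makes [psum_spread] exact, whereas
    [sum_n] would need a shift of the bound. *)
Fixpoint psum (d : nat -> R) (N : nat) : R :=
  match N with O => 0 | S n => psum d n + d n end.

Lemma psum_sum_n d N : sum_n d N = psum d (S N).
Proof.
  induction N as [|N IH].
  - rewrite sum_O; simpl; lra.
  - rewrite sum_Sn, IH; reflexivity.
Qed.

Lemma psum_gap d a b :
  (a <= b)%nat -> (forall m, (a <= m < b)%nat -> d m = 0) -> psum d b = psum d a.
Proof.
  induction 1 as [|b Hb IH]; intros H; trivial.
  simpl; rewrite IH, H by (intros; try apply H; lia); lra.
Qed.

Lemma psum_spread e d N : strictly_increasing e -> psum (spread 0 e d) (e N) = psum d N.
Proof.
  intros He; induction N as [|N IH].
  - rewrite (psum_gap _ 0 (e O)); [reflexivity|lia|].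
    intros m Hm; apply spread_miss; intros n E.
    destruct n as [|n]; [lia|]. pose proof (strictly_increasing_lt e He 0 (S n)); lia.
  - rewrite (psum_gap _ (S (e N))); [|apply He|].
    + simpl; rewrite IH, spread_hit; trivial.
    + intros m Hm; apply spread_miss; intros n E; subst m.
      destruct (Nat.le_gt_cases n N) as [H|H].
      * destruct (Nat.eq_dec n N) as [->|]; [lia|].
        pose proof (strictly_increasing_lt e He n N); lia.
      * destruct (Nat.eq_dec n (S N)) as [->|]; [lia|].
        pose proof (strictly_increasing_lt e He (S N) n); lia.
Qed.

Lemma psum_mono d m n : (forall k, 0 <= d k) -> (m <= n)%nat -> psum d m <= psum d n.
Proof.
  intros Hd; induction 1 as [|n _ IH]; [lra|]. simpl. specialize (Hd n); lra.
Qed.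

Lemma is_series_psum d l : is_series d l <-> is_lim_seq (psum d) l.
Proof.
  split; intros H.
  - apply is_lim_seq_incr_1.
    apply is_lim_seq_ext with (sum_n d); [apply psum_sum_n|exact H].
  - apply is_lim_seq_incr_1 in H.
    apply (is_lim_seq_ext _ (sum_n d)) in H; [exact H|].
    intros; now rewrite psum_sum_n.
Qed.

Lemma psum_le_Series d N : (forall k, 0 <= d k) -> ex_series d -> psum d N <= Series d.
Proof.
  intros Hd Hs. apply Series_correct, is_series_psum in Hs.
  apply (is_lim_seq_incr_compare _ _ Hs).
  intros n; simpl; specialize (Hd n); lra.
Qed.

Lemma ex_series_bounded d M :
  (forall k, 0 <= d k) -> (forall N, psum d N <= M) -> ex_series d.
Proof.
  intros Hd HM.
  destruct (ex_finite_lim_seq_incr (psum d) M) as [l Hl]; trivial.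
  - intros n; simpl; specialize (Hd n); lra.
  - exists l; now apply is_series_psum.
Qed.

Lemma ex_series_spread_abs e d :
  strictly_increasing e -> ex_series (fun n => Rabs (d n)) ->
  ex_series (fun n => Rabs (spread 0 e d n)).
Proof.
  intros He Hd. apply ex_series_bounded with (Series (fun n => Rabs (d n))).
  - intros; apply Rabs_pos.
  - intros N.
    apply Rle_trans with (psum (fun n => Rabs (spread 0 e d n)) (e N)).
    + apply psum_mono; [intros; apply Rabs_pos|now apply strictly_increasing_ge].
    + replace (psum (fun n => Rabs (spread 0 e d n)) (e N))
        with (psum (spread 0 e (fun n => Rabs (d n))) (e N)).
      * rewrite psum_spread; trivial.
        apply psum_le_Series; trivial; intros; apply Rabs_pos.
      * generalize (e N) as M; induction M as [|M IH]; trivial. simpl; rewrite IH.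
        now rewrite <- (spread_map Rabs), Rabs_R0.
Qed.

(** The partial sums of the two series agree along the subsequence [e N], and
    absolute convergence makes the sparse series converge. *)
Lemma Series_spread e d :
  strictly_increasing e -> ex_series (fun n => Rabs (d n)) ->
  Series (spread 0 e d) = Series d.
Proof.
  intros He Hd.
  pose proof (ex_series_Rabs _ (ex_series_spread_abs e d He Hd)) as H1.
  apply ex_series_Rabs in Hd.
  apply Series_correct, is_series_psum in H1.
  symmetry; apply is_series_unique, is_series_psum.
  apply is_lim_seq_ext with (fun n => psum (spread 0 e d) (e n)).
  - intros; now apply psum_spread.
  - apply is_lim_seq_subseq; trivial.
    intros P [N HN]; exists N; intros n Hn; apply HN.
    pose proof (strictly_increasing_ge e He n); lia.
Qed.

Definition abs_summable (a : nat -> C) : Prop := ex_series (fun n => Cmod (a n)).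

Lemma Im_le_Cmod z : Rabs (Im z) <= Cmod z.
Proof.
  destruct z as [x y]; simpl. pose proof (Rmax_Cmod (x,y)); simpl in *.
  eapply Rle_trans; [apply Rmax_r|eassumption].
Qed.

Lemma Re_le_Cmod z : Rabs (Re z) <= Cmod z.
Proof.
  destruct z as [x y]; simpl. pose proof (Rmax_Cmod (x,y)); simpl in *.
  eapply Rle_trans; [apply Rmax_l|eassumption].
Qed.

Lemma ex_series_Rabs_le (a b : nat -> R) :
  (forall n, Rabs (a n) <= b n) -> ex_series b -> ex_series (fun n => Rabs (a n)).
Proof.
  intros H Hb. apply (ex_series_le (V := R_CompleteNormedModule) _ b); trivial.
  intros n; unfold norm; simpl; unfold abs; simpl. now rewrite Rabs_Rabsolu.
Qed.

Lemma abs_summable_Re a : abs_summable a -> ex_series (fun n => Rabs (Re (a n))).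
Proof. apply ex_series_Rabs_le; intros; apply Re_le_Cmod. Qed.

Lemma abs_summable_Im a : abs_summable a -> ex_series (fun n => Rabs (Im (a n))).
Proof. apply ex_series_Rabs_le; intros; apply Im_le_Cmod. Qed.

Lemma CSeries_ext a b : (forall n, a n = b n) -> CSeries a = CSeries b.
Proof.
  intros H; unfold CSeries; f_equal; apply Series_ext; intros; now rewrite H.
Qed.

Lemma CSeries_plus a b : abs_summable a -> abs_summable b ->
  CSeries (fun n => (a n + b n)%C) = (CSeries a + CSeries b)%C.
Proof.
  intros Ha Hb; unfold CSeries, Cplus; simpl.
  f_equal; rewrite <- Series_plus; try reflexivity;
    apply ex_series_Rabs; auto using abs_summable_Re, abs_summable_Im.
Qed.

Lemma abs_summable_spread e a :
  strictly_increasing e -> abs_summable a -> abs_summable (spread (RtoC 0) e a).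
Proof.
  intros He Ha. unfold abs_summable in *.
  apply ex_series_ext with (fun n => Rabs (spread 0 e (fun n => Cmod (a n)) n)).
  - intros n. pose proof (spread_map Cmod (RtoC 0) e a n) as H.
    rewrite Cmod_0 in H; rewrite H. now apply Rabs_pos_eq, Cmod_ge_0.
  - apply ex_series_spread_abs; trivial.
    revert Ha; apply ex_series_ext; intros; symmetry; apply Rabs_pos_eq, Cmod_ge_0.
Qed.

Lemma CSeries_spread e a : strictly_increasing e -> abs_summable a ->
  CSeries (spread (RtoC 0) e a) = CSeries a.
Proof.
  intros He Ha; unfold CSeries; f_equal.
  - rewrite <- (Series_spread e (fun n => Re (a n))) by auto using abs_summable_Re.
    apply Series_ext; intros; apply (eq_sym (spread_map Re (RtoC 0) e a n)).
  - rewrite <- (Series_spread e (fun n => Im (a n))) by auto using abs_summable_Im.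
    apply Series_ext; intros; apply (eq_sym (spread_map Im (RtoC 0) e a n)).
Qed.

Definition cpow_series (c : nat -> R) (q : C) : nat -> C := fun n => (RtoC (c n) * q ^ n)%C.

(** Only real coefficients occur for theta functions, and they let a complex
    identity be read off from its values on the real axis. *)
Definition expands_as (c : nat -> R) (f : C -> C) : Prop :=
  forall q, Cmod q < 1 ->
    abs_summable (cpow_series c q) /\ f q = CSeries (cpow_series c q).

Definition analytic (f : C -> C) : Prop := exists c, expands_as c f.

Lemma Cmod_cpow_series c q n : Cmod (cpow_series c q n) = Rabs (c n) * Cmod q ^ n.
Proof. unfold cpow_series; now rewrite Cmod_mult, Cmod_R, Cmod_pow. Qed.

Lemma analytic_ext f g :
  (forall q, Cmod q < 1 -> f q = g q) -> analytic f -> analytic g.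
Proof.
  intros E [c H]; exists c; intros q Hq; rewrite <- E by trivial; now apply H.
Qed.

Lemma analytic_plus f g :
  analytic f -> analytic g -> analytic (fun q => f q + g q)%C.
Proof.
  intros [c Hc] [d Hd]; exists (fun n => c n + d n); intros q Hq.
  destruct (Hc q Hq) as [C1 C2], (Hd q Hq) as [D1 D2].
  assert (E : forall n, cpow_series (fun n => c n + d n) q n
                        = (cpow_series c q n + cpow_series d q n)%C).
  { intros; unfold cpow_series; rewrite RtoC_plus; ring. }
  split.
  - unfold abs_summable.
    pose proof (ex_series_plus _ _ C1 D1) as H; simpl in H.
    apply ex_series_ext with (fun n => Rabs (Cmod (cpow_series (fun n => c n + d n) q n))).
    { intros; apply Rabs_pos_eq, Cmod_ge_0. }
    revert H; apply ex_series_Rabs_le; intros n.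
    rewrite Rabs_pos_eq by apply Cmod_ge_0. rewrite E; apply Cmod_triangle.
  - rewrite (CSeries_ext _ _ E), CSeries_plus, C2, D2; trivial.
Qed.

Lemma ex_series_finite (a : nat -> R) N : (forall n, (N <= n)%nat -> a n = 0) -> ex_series a.
Proof.
  intros H. exists (psum a N). apply is_series_psum.
  apply (is_lim_seq_incr_n _ N).
  apply is_lim_seq_ext with (fun _ => psum a N); [|apply is_lim_seq_const].
  intros n; symmetry; apply psum_gap; [lia|]; intros m Hm; apply H; lia.
Qed.

Lemma Series_finite (a : nat -> R) N : (forall n, (N <= n)%nat -> a n = 0) -> Series a = psum a N.
Proof.
  intros H; apply is_series_unique, is_series_psum.
  apply (is_lim_seq_incr_n _ N).
  apply is_lim_seq_ext with (fun _ => psum a N); [|apply is_lim_seq_const].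
  intros n; symmetry; apply psum_gap; [lia|]; intros m Hm; apply H; lia.
Qed.

Lemma analytic_affine (a b : R) : analytic (fun q => a + b * q)%C.
Proof.
  exists (fun n => match n with 0%nat => a | 1%nat => b | _ => 0 end); intros q _.
  assert (E : forall n, (2 <= n)%nat -> cpow_series
      (fun n => match n with 0%nat => a | 1%nat => b | _ => 0 end) q n = RtoC 0).
  { intros [|[|n]] Hn; try lia; unfold cpow_series; ring. }
  split.
  - apply ex_series_finite with 2%nat; intros n Hn; rewrite E by trivial; apply Cmod_0.
  - unfold CSeries.
    rewrite !(Series_finite _ 2) by (intros; rewrite E by trivial; reflexivity).
    unfold cpow_series; destruct q as [x y];
    apply injective_projections; simpl; ring.
Qed.

Lemma analytic_const (a : R) : analytic (fun _ => RtoC a).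
Proof. apply analytic_ext with (fun q => a + 0%R * q)%C; [intros; ring|apply analytic_affine]. Qed.

Lemma analytic_id : analytic (fun q => q).
Proof. apply analytic_ext with (fun q => 0%R + 1%R * q)%C; [intros; ring|apply analytic_affine]. Qed.

Lemma Series_cauchy (a b : nat -> R) :
  ex_series (fun n => Rabs (a n)) -> ex_series (fun n => Rabs (b n)) ->
  is_series (fun n => sum_f_R0 (fun k => a k * b (n - k)%nat) n) (Series a * Series b).
Proof.
  intros Ha Hb; apply is_series_mult; trivial; apply Series_correct, ex_series_Rabs; trivial.
Qed.

Lemma sum_f_R0_comb (f g h : nat -> R) (s : R) N :
  (forall k, (k <= N)%nat -> h k = f k + s * g k) ->
  sum_f_R0 h N = sum_f_R0 f N + s * sum_f_R0 g N.
Proof.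
  intros H. rewrite scal_sum, <- plus_sum.
  apply sum_eq; intros i Hi; rewrite H by trivial; ring.
Qed.

(** Mertens' theorem, applied to the real and imaginary parts. *)
Lemma analytic_mult f g :
  analytic f -> analytic g -> analytic (fun q => f q * g q)%C.
Proof.
  intros [c Hc] [d Hd]; exists (PS_mult c d); intros q Hq.
  destruct (Hc q Hq) as [C1 C2], (Hd q Hq) as [D1 D2].
  assert (Hpow : forall n k, (k <= n)%nat -> (q ^ k * q ^ (n - k) = q ^ n)%C).
  { intros n k Hk; rewrite <- Cpow_add_r; f_equal; lia. }
  split.
  - assert (A : forall a, abs_summable a -> ex_series (fun n => Rabs (Cmod (a n)))).
    { intros a; apply ex_series_ext; intros; symmetry; apply Rabs_pos_eq, Cmod_ge_0. }
    pose proof (ex_intro _ _ (Series_cauchy _ _ (A _ C1) (A _ D1))) as H.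
    apply ex_series_ext with (fun n => Rabs (Cmod (cpow_series (PS_mult c d) q n))).
    { intros; apply Rabs_pos_eq, Cmod_ge_0. }
    revert H; apply ex_series_Rabs_le; intros n.
    rewrite Rabs_pos_eq by apply Cmod_ge_0.
    rewrite Cmod_cpow_series; unfold PS_mult.
    rewrite Rmult_comm.
    apply Rle_trans with (Cmod q ^ n * sum_f_R0 (fun k => Rabs (c k * d (n - k)%nat)) n).
    + apply Rmult_le_compat_l; [apply pow_le, Cmod_ge_0|apply Rsum_abs].
    + right; rewrite scal_sum; apply sum_eq; intros k Hk.
      rewrite !Cmod_cpow_series, Rabs_mult.
      replace n with (k + (n - k))%nat at 2 by lia. rewrite pow_add; ring.
  - rewrite C2, D2. unfold CSeries at 1 2; unfold Cmult; simpl.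
    pose proof (abs_summable_Re _ C1) as CR. pose proof (abs_summable_Im _ C1) as CI.
    pose proof (abs_summable_Re _ D1) as DR. pose proof (abs_summable_Im _ D1) as DI.
    unfold CSeries; f_equal.
    + pose proof (is_series_minus _ _ _ _ (Series_cauchy _ _ CR DR) (Series_cauchy _ _ CI DI)) as H.
      apply is_series_unique in H.
      refine (eq_trans (eq_sym H) _); clear H.
      apply Series_ext; intros n; symmetry; unfold cpow_series at 1; rewrite re_scal_l.
      unfold PS_mult; rewrite Rmult_comm, scal_sum.
      rewrite (sum_f_R0_comb (fun k => Re (cpow_series c q k) * Re (cpow_series d q (n - k)))
        (fun k => Im (cpow_series c q k) * Im (cpow_series d q (n - k))) _ (-1)).
      * unfold plus, opp; simpl; ring.
      * intros k Hk; rewrite <- (Hpow n k Hk).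
        unfold cpow_series; destruct (q ^ k)%C, (q ^ (n - k))%C; simpl; ring.
    + pose proof (is_series_plus _ _ _ _ (Series_cauchy _ _ CR DI) (Series_cauchy _ _ CI DR)) as H.
      apply is_series_unique in H.
      refine (eq_trans (eq_sym H) _); clear H.
      apply Series_ext; intros n; symmetry; unfold cpow_series at 1; rewrite im_scal_l.
      unfold PS_mult; rewrite Rmult_comm, scal_sum.
      rewrite (sum_f_R0_comb (fun k => Re (cpow_series c q k) * Im (cpow_series d q (n - k)))
        (fun k => Im (cpow_series c q k) * Re (cpow_series d q (n - k))) _ 1).
      * unfold plus; simpl; ring.
      * intros k Hk; rewrite <- (Hpow n k Hk).
        unfold cpow_series; destruct (q ^ k)%C, (q ^ (n - k))%C; simpl; ring.
Qed.

Lemma analytic_scal (a : R) f : analytic f -> analytic (fun q => a * f q)%C.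
Proof. intros H; apply (analytic_mult (fun _ => RtoC a)); trivial; apply analytic_const. Qed.

Lemma Cmult_m1_l (z : C) : ((-1)%R * z = - z)%C.
Proof. apply injective_projections; simpl; ring. Qed.

Lemma analytic_minus f g :
  analytic f -> analytic g -> analytic (fun q => f q - g q)%C.
Proof.
  intros Hf Hg. apply analytic_ext with (fun q => f q + (-1)%R * g q)%C.
  - intros; rewrite Cmult_m1_l; ring.
  - apply analytic_plus; trivial; now apply analytic_scal.
Qed.

Lemma analytic_pow f n : analytic f -> analytic (fun q => f q ^ n)%C.
Proof.
  intros Hf; induction n as [|n IH]; [apply (analytic_const 1)|].
  apply (analytic_mult f (fun q => f q ^ n)%C); trivial.
Qed.

Lemma pow_lt_1 r k : 0 <= r < 1 -> (0 < k)%nat -> r ^ k < 1.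
Proof.
  intros Hr Hk; destruct k as [|k]; [lia|]; clear Hk.
  assert (H : 0 <= r ^ k <= 1) by (split; [apply pow_le|rewrite <- (pow1 k); apply pow_incr]; lra).
  simpl; nra.
Qed.

Lemma Cmod_signed_pow (s : R) (q : C) k :
  Rabs s = 1 -> Cmod q < 1 -> (0 < k)%nat -> Cmod (s * q ^ k) < 1.
Proof.
  intros Hs Hq Hk. rewrite Cmod_mult, Cmod_R, Hs, Cmod_pow, Rmult_1_l.
  apply pow_lt_1; trivial; split; trivial; apply Cmod_ge_0.
Qed.

(** [s] is 1 or -1; the coefficients of the composite are spread along the
    multiples of [k]. *)
Lemma analytic_comp f (s : R) k :
  Rabs s = 1 -> (0 < k)%nat -> analytic f -> analytic (fun q => f (s * q ^ k)%C).
Proof.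
  intros Hs Hk [c Hc].
  set (e := fun n => (k * n)%nat).
  assert (He : strictly_increasing e) by (intros n; unfold e; lia).
  exists (spread 0 e (fun n => c n * s ^ n)); intros q Hq.
  destruct (Hc _ (Cmod_signed_pow s q k Hs Hq Hk)) as [C1 C2].
  assert (E : forall n, cpow_series (spread 0 e (fun n => c n * s ^ n)) q n
                        = spread (RtoC 0) e (cpow_series c (s * q ^ k)%C) n).
  { intros n; unfold cpow_series at 1.
    destruct (classic (exists m, e m = n)) as [[m <-]|Hn].
    - rewrite !spread_hit by trivial; unfold cpow_series, e.
      rewrite RtoC_mult, RtoC_pow, Cpow_mult_l, Cpow_mult_r; ring.
    - rewrite !spread_miss by (intros m Em; apply Hn; now exists m); ring. }
  split.
  - unfold abs_summable. apply ex_series_ext with (fun n => Cmod (spread (RtoC 0) e (cpow_series c (s * q ^ k)%C) n)).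
    + intros n; now rewrite E.
    + now apply abs_summable_spread.
  - now rewrite C2, (CSeries_ext _ _ E), CSeries_spread.
Qed.

Lemma analytic_comp_pow f k : (0 < k)%nat -> analytic f -> analytic (fun q => f (q ^ k)%C).
Proof.
  intros Hk Hf. apply analytic_ext with (fun q => f (1%R * q ^ k)%C).
  - intros; now rewrite Cmult_1_l.
  - apply analytic_comp; trivial; apply Rabs_R1.
Qed.

Lemma analytic_comp_opp f k : (0 < k)%nat -> analytic f -> analytic (fun q => f (- q ^ k)%C).
Proof.
  intros Hk Hf. apply analytic_ext with (fun q => f ((-1)%R * q ^ k)%C).
  - intros; f_equal; apply Cmult_m1_l.
  - apply analytic_comp; trivial. rewrite Rabs_left; lra.
Qed.

(** Absolute convergence at a radius between [Rabs x] and 1 bounds the terms. *)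
Lemma expands_as_CV_radius c f x : expands_as c f -> Rabs x < 1 -> Rbar_lt (Rabs x) (CV_radius c).
Proof.
  intros Hc Hx.
  set (r := (Rabs x + 1) / 2).
  assert (Hr : 0 <= r < 1) by (unfold r; pose proof (Rabs_pos x); lra).
  apply Rbar_lt_le_trans with r; [simpl; unfold r; lra|].
  destruct (CV_radius_bounded c) as [H _]; apply H.
  destruct (Hc (RtoC r)) as [H1 _]; [rewrite Cmod_R, Rabs_pos_eq; lra|].
  exists (Series (fun n => Cmod (cpow_series c r n))); intros n.
  apply Rle_trans with (psum (fun n => Cmod (cpow_series c r n)) (S n)).
  - simpl. rewrite Cmod_cpow_series, Cmod_R, Rabs_mult, <- RPow_abs.
    assert (H0 : forall N, 0 <= psum (fun n => Cmod (cpow_series c r n)) N).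
    { intros N; induction N as [|N IH]; simpl; [lra|]. pose proof (Cmod_ge_0 (cpow_series c r N)); lra. }
    specialize (H0 n); lra.
  - apply psum_le_Series; trivial; intros; apply Cmod_ge_0.
Qed.

Lemma expands_as_real c f (x : R) : expands_as c f -> Rabs x < 1 -> f (RtoC x) = RtoC (PSeries c x).
Proof.
  intros Hc Hx. destruct (Hc (RtoC x)) as [_ ->]; [now rewrite Cmod_R|].
  rewrite (CSeries_ext _ (fun n => RtoC (c n * x ^ n))).
  - apply injective_projections; simpl; trivial. now rewrite (Series_finite _ 0).
  - intros n; unfold cpow_series; now rewrite RtoC_mult, RtoC_pow.
Qed.

Definition on_reals (f : C -> C) (x : R) : R := Re (f (RtoC x)).

Lemma on_reals_correct f x : analytic f -> Rabs x < 1 -> f (RtoC x) = RtoC (on_reals f x).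
Proof.
  intros [c Hc] Hx; unfold on_reals; now rewrite (expands_as_real c f x Hc Hx).
Qed.

Lemma locally_unit_disc x : Rabs x < 1 -> locally x (fun y => Rabs y < 1).
Proof.
  intros Hx. assert (H : 0 < 1 - Rabs x) by lra.
  exists (mkposreal _ H).
  assert (K : forall y, Rabs (y - x) < 1 - Rabs x -> Rabs y < 1); [|exact K].
  intros y Hy. pose proof (Rabs_triang (y - x) x) as T.
  replace (y - x + x) with y in T by ring. lra.
Qed.

Lemma ex_derive_on_reals f x : analytic f -> Rabs x < 1 -> ex_derive (on_reals f) x.
Proof.
  intros [c Hc] Hx.
  apply ex_derive_ext_loc with (PSeries c).
  - apply filter_imp with (2 := locally_unit_disc x Hx); intros y Hy.
    unfold on_reals; now rewrite (expands_as_real c f y Hc).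
  - eexists; apply is_derive_PSeries, (expands_as_CV_radius c f); trivial.
Qed.

Lemma continuous_on_reals f x : analytic f -> Rabs x < 1 -> continuous (on_reals f) x.
Proof. intros Hf Hx; apply (ex_derive_continuous (on_reals f) x); now apply ex_derive_on_reals. Qed.

Lemma continuous_neq0 (f : R -> R) : continuous f 0 -> f 0 <> 0 ->
  exists eps, 0 < eps <= 1 /\ forall x, 0 < x < eps -> f x <> 0.
Proof.
  intros Hc H0.
  destruct (Hc (fun y => y <> 0)) as [d Hd].
  { exists (mkposreal _ (Rabs_pos_lt _ H0)); intros y Hy.
    change (Rabs (y - f 0) < Rabs (f 0)) in Hy. intros ->.
    rewrite Rminus_0_l, Rabs_Ropp in Hy; lra. }
  exists (Rmin d 1). pose proof (Rmin_l d 1). pose proof (Rmin_r d 1). pose proof (cond_pos d).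
  split; [split; [apply Rmin_pos; lra|lra]|].
  intros x Hx; apply Hd. change (Rabs (x - 0) < d). rewrite Rminus_0_r, Rabs_pos_eq; lra.
Qed.

Lemma continuous_zero_right (f : R -> R) eps :
  0 < eps -> continuous f 0 -> (forall x, 0 < x < eps -> f x = 0) -> f 0 = 0.
Proof.
  intros He Hc Hz. apply NNPP; intros H0.
  destruct (continuous_neq0 f Hc H0) as (d & Hd & Hne).
  pose proof (Rmin_l d eps). pose proof (Rmin_r d eps).
  assert (0 < Rmin d eps) by (apply Rmin_pos; lra).
  apply (Hne (Rmin d eps / 2)); [lra|]. apply Hz; lra.
Qed.

(** The constant term vanishes by continuity at 0; divide by [x] and repeat. *)
Lemma PSeries_zero_right c eps :
  0 < eps -> Rbar_lt 0 (CV_radius c) ->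
  (forall x, 0 < x < eps -> PSeries c x = 0) -> forall n, c n = 0.
Proof.
  intros He Hr Hz n; revert c Hr Hz; induction n as [|n IH]; intros c Hr Hz.
  all: assert (C0 : c O = 0) by
    (rewrite <- (PSeries_0 c); apply (continuous_zero_right (PSeries c) eps); trivial;
     apply continuity_pt_filterlim, PSeries_continuity; now rewrite Rabs_R0).
  - exact C0.
  - change (c (S n)) with (PS_decr_1 c n).
    apply IH; [now rewrite CV_radius_decr_1|].
    intros x Hx. specialize (Hz x Hx).
    rewrite PSeries_decr_1_aux in Hz by trivial.
    apply Rmult_integral in Hz as [Hz|Hz]; lra.
Qed.

Lemma analytic_eq0 f eps :
  analytic f -> 0 < eps -> (forall x, 0 < x < eps -> f (RtoC x) = 0%R) ->
  forall q, Cmod q < 1 -> f q = 0%R.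
Proof.
  intros [c Hc] He Hz q Hq.
  assert (C0 : forall n, c n = 0).
  { apply PSeries_zero_right with (Rmin eps 1).
    - apply Rmin_pos; lra.
    - rewrite <- Rabs_R0; apply (expands_as_CV_radius c f); trivial; rewrite Rabs_R0; lra.
    - intros x Hx. pose proof (Rmin_l eps 1); pose proof (Rmin_r eps 1).
      assert (Hx1 : Rabs x < 1) by (rewrite Rabs_pos_eq; lra).
      pose proof (expands_as_real c f x Hc Hx1) as E. rewrite Hz in E by lra.
      now apply RtoC_inj in E. }
  destruct (Hc q Hq) as [_ ->]. unfold CSeries.
  rewrite !(Series_finite _ 0);
    try (intros; unfold cpow_series; rewrite C0, Cmult_0_l; reflexivity).
  reflexivity.
Qed.

(** The identity theorem in the form in which it carries every theta identity
    from small positive [q] to the whole disc. *)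
Lemma analytic_eq f g eps :
  analytic f -> analytic g -> 0 < eps ->
  (forall x, 0 < x < eps -> f (RtoC x) = g (RtoC x)) ->
  forall q, Cmod q < 1 -> f q = g q.
Proof.
  intros Hf Hg He Hz q Hq.
  assert (E : (f q - g q)%C = 0%R).
  { apply (analytic_eq0 (fun q => f q - g q)%C eps); trivial.
    - now apply analytic_minus.
    - intros x Hx; rewrite Hz by trivial; ring. }
  replace (f q) with (f q - g q + g q)%C by ring. rewrite E; ring.
Qed.

(** * Unordered sums of nonnegative families *)

Fixpoint lsum {T : Type} (f : T -> R) (l : list T) : R :=
  match l with [] => 0 | a :: l => f a + lsum f l end.

(** Unconditional summation: no enumeration of the index type is chosen, so
    changes of variables on pairs of integers are changes of index. *)
Definition has_sum {T : Type} (f : T -> R) (s : R) : Prop :=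
  (forall a, 0 <= f a) /\
  is_lub (fun r => exists l, NoDup l /\ r = lsum f l) s.

Lemma lsum_app {T} (f : T -> R) l1 l2 : lsum f (l1 ++ l2) = lsum f l1 + lsum f l2.
Proof. induction l1 as [|a l IH]; simpl; [|rewrite IH]; lra. Qed.

Lemma lsum_map {T U} (f : U -> R) (h : T -> U) l : lsum f (map h l) = lsum (fun a => f (h a)) l.
Proof. induction l as [|a l IH]; simpl; [|rewrite IH]; trivial. Qed.

Lemma lsum_ge0 {T} (f : T -> R) l : (forall a, 0 <= f a) -> 0 <= lsum f l.
Proof. intros Hf; induction l as [|a l IH]; simpl; [lra|]. specialize (Hf a); lra. Qed.

(** Each element of [l] is found in [l'] and removed from it. *)
Lemma lsum_incl {T} (f : T -> R) l l' :
  (forall a, 0 <= f a) -> NoDup l -> incl l l' -> lsum f l <= lsum f l'.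
Proof.
  intros Hf Hl; revert l'; induction Hl as [|a l Ha Hl IH]; intros l' Hi.
  - now apply lsum_ge0.
  - destruct (in_split a l') as (l1 & l2 & ->); [apply Hi; now left|].
    rewrite lsum_app; simpl.
    assert (H : lsum f l <= lsum f (l1 ++ l2)).
    { apply IH; intros b Hb. assert (Hb' : In b (l1 ++ a :: l2)) by (apply Hi; now right).
      rewrite in_app_iff in *; destruct Hb' as [|[<-|]]; tauto. }
    rewrite lsum_app in H; lra.
Qed.

Lemma has_sum_ub {T} (f : T -> R) s l : has_sum f s -> NoDup l -> lsum f l <= s.
Proof. intros [_ [H _]] Hl; apply H; now exists l. Qed.

Lemma has_sum_le {T} (f : T -> R) s M :
  has_sum f s -> (forall l, NoDup l -> lsum f l <= M) -> s <= M.
Proof. intros [_ [_ H]] HM; apply H; intros r (l & Hl & ->); now apply HM. Qed.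

Lemma has_sum_intro {T} (f : T -> R) s :
  (forall a, 0 <= f a) -> (forall l, NoDup l -> lsum f l <= s) ->
  (forall M, (forall l, NoDup l -> lsum f l <= M) -> s <= M) -> has_sum f s.
Proof.
  intros Hf H1 H2; split; trivial; split.
  - intros r (l & Hl & ->); now apply H1.
  - intros M HM; apply H2; intros l Hl; apply HM; now exists l.
Qed.

Lemma has_sum_ge0 {T} (f : T -> R) s : has_sum f s -> 0 <= s.
Proof. intros H; apply (has_sum_ub f s [] H); constructor. Qed.

Lemma has_sum_unique {T} (f : T -> R) s t : has_sum f s -> has_sum f t -> s = t.
Proof.
  intros Hs Ht; apply Rle_antisym.
  - apply (has_sum_le f _ _ Hs); intros; now apply (has_sum_ub f).
  - apply (has_sum_le f _ _ Ht); intros; now apply (has_sum_ub f).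
Qed.

Lemma lsum_ext {T} (f g : T -> R) l : (forall a, f a = g a) -> lsum f l = lsum g l.
Proof. intros E; induction l as [|a l IH]; simpl; [|rewrite E, IH]; trivial. Qed.

Lemma has_sum_ext {T} (f g : T -> R) s : (forall a, f a = g a) -> has_sum f s -> has_sum g s.
Proof.
  intros E H; apply has_sum_intro.
  - intros a; rewrite <- E; apply H.
  - intros l Hl; rewrite <- (lsum_ext f g) by trivial; now apply has_sum_ub.
  - intros M HM; apply (has_sum_le f _ _ H); intros l Hl.
    rewrite (lsum_ext f g) by trivial; now apply HM.
Qed.

Lemma lsum_scal {T} (f : T -> R) c l : lsum (fun a => c * f a) l = c * lsum f l.
Proof. induction l as [|a l IH]; simpl; [|rewrite IH]; ring. Qed.

Lemma NoDup_map_inj {A B} (h : A -> B) l : Injective h -> NoDup l -> NoDup (map h l).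
Proof. intros Hh Hl; apply Injective_map_NoDup; trivial. Qed.

(** Sums of subfamilies exist by completeness; this supplies the pieces into
    which a double series is cut without computing them. *)
Lemma has_sum_sub {A B} (h : A -> B) (f : B -> R) s :
  Injective h -> has_sum f s -> exists t, has_sum (fun a => f (h a)) t.
Proof.
  intros Hh Hf.
  destruct (completeness (fun r => exists l, NoDup l /\ r = lsum (fun a => f (h a)) l)) as [t Ht].
  - exists s; intros r (l & Hl & ->).
    rewrite <- (lsum_map f h); apply has_sum_ub; trivial; now apply NoDup_map_inj.
  - exists 0, []; split; [constructor|reflexivity].
  - exists t; split; trivial; intros; apply Hf.
Qed.

(** The tool for all lattice identities: two injections that together cover the
    support of [f] split its sum into two sums over simpler index types. *)
Lemma has_sum_union {A A' B} (h : A -> B) (h' : A' -> B) (f : B -> R) s s' :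
  Injective h -> Injective h' -> (forall a a', h a <> h' a') ->
  (forall b, 0 <= f b) ->
  (forall b, f b <> 0 -> (exists a, h a = b) \/ (exists a', h' a' = b)) ->
  has_sum (fun a => f (h a)) s -> has_sum (fun a => f (h' a)) s' ->
  has_sum f (s + s').
Proof.
  intros Hh Hh' Hd Hf Hc Hs Hs'; apply has_sum_intro; trivial.
  - intros l Hl.
    assert (H : exists m m', NoDup m /\ NoDup m' /\ incl (map h m) l /\ incl (map h' m') l
              /\ lsum f l = lsum (fun a => f (h a)) m + lsum (fun a => f (h' a)) m').
    { induction Hl as [|b l Hb Hl IH].
      - exists [], []; repeat split; try constructor; try apply incl_refl; simpl; lra.
      - destruct IH as (m & m' & N & N' & I & I' & E).
        assert (I2 := incl_tl b I). assert (I2' := incl_tl b I').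
        destruct (classic (f b = 0)) as [F0|F0].
        { exists m, m'; repeat split; trivial; simpl; lra. }
        destruct (Hc b F0) as [[a <-]|[a <-]].
        + exists (a :: m), m'; repeat split; trivial.
          * constructor; trivial; intros Ha; apply Hb, I, in_map, Ha.
          * simpl; apply incl_cons; trivial; now left.
          * simpl; lra.
        + exists m, (a :: m'); repeat split; trivial.
          * constructor; trivial; intros Ha; apply Hb, I', in_map, Ha.
          * simpl; apply incl_cons; trivial; now left.
          * simpl; lra. }
    destruct H as (m & m' & N & N' & _ & _ & ->).
    apply Rplus_le_compat; now apply has_sum_ub.
  - intros M HM.
    assert (H : forall m m', NoDup m -> NoDup m' ->
      lsum (fun a => f (h a)) m + lsum (fun a => f (h' a)) m' <= M).
    { intros m m' N N'. rewrite <- (lsum_map f h), <- (lsum_map f h'), <- lsum_app. apply HM.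
      apply NoDup_app; try (now apply NoDup_map_inj).
      intros b Hb Hb'. apply in_map_iff in Hb as (a & <- & _).
      apply in_map_iff in Hb' as (a' & E & _). now apply (Hd a a'). }
    assert (H1 : forall m', NoDup m' -> s + lsum (fun a => f (h' a)) m' <= M).
    { intros m' N'. cut (s <= M - lsum (fun a => f (h' a)) m'); [lra|].
      apply (has_sum_le _ _ _ Hs); intros m N; specialize (H m m' N N'); lra. }
    cut (s' <= M - s); [lra|].
    apply (has_sum_le _ _ _ Hs'); intros m' N'; specialize (H1 m' N'); lra.
Qed.

Lemma has_sum_scal {T} (f : T -> R) c s : 0 <= c -> has_sum f s -> has_sum (fun a => c * f a) (c * s).
Proof.
  intros Hc Hs; apply has_sum_intro.
  - intros a; apply Rmult_le_pos; trivial; apply Hs.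
  - intros l Hl; rewrite lsum_scal; apply Rmult_le_compat_l; trivial; now apply has_sum_ub.
  - intros M HM. destruct (Req_dec c 0) as [->|C0].
    + rewrite Rmult_0_l; apply (HM []); constructor.
    + assert (C1 : 0 < c) by lra.
      assert (H : s <= M / c); [|apply Rmult_le_compat_l with (r := c) in H; trivial;
        replace (c * (M / c)) with M in H by (field; lra); exact H].
      apply (has_sum_le f _ _ Hs); intros l Hl. apply Rle_div_r; trivial.
      rewrite Rmult_comm, <- lsum_scal; now apply HM.
Qed.

Lemma lsum_prod {A B} (f : A -> R) (g : B -> R) l m :
  lsum (fun p => f (fst p) * g (snd p)) (list_prod l m) = lsum f l * lsum g m.
Proof.
  induction l as [|a l IH]; simpl; [ring|].
  rewrite lsum_app, IH, lsum_map; simpl. rewrite lsum_scal; ring.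
Qed.

Lemma NoDup_list_prod {A B} (l : list A) (m : list B) :
  NoDup l -> NoDup m -> NoDup (list_prod l m).
Proof.
  intros Hl Hm; induction Hl as [|a l Ha Hl IH]; simpl; [constructor|].
  apply NoDup_app; trivial.
  - apply Injective_map_NoDup; trivial; intros b b' E; now injection E.
  - intros [x y] H1 H2. apply in_map_iff in H1 as (b & E & _); injection E as <- _.
    apply in_prod_iff in H2 as [H2 _]; contradiction.
Qed.

(** A finite set of pairs lies in the product of its two projections. *)
Lemma has_sum_prod {A B} (f : A -> R) (g : B -> R) s t :
  has_sum f s -> has_sum g t ->
  has_sum (fun p : A * B => f (fst p) * g (snd p)) (s * t).
Proof.
  intros Hs Ht.
  assert (F0 := proj1 Hs). assert (G0 := proj1 Ht).
  assert (P0 : forall p : A * B, 0 <= f (fst p) * g (snd p)) by (intros; now apply Rmult_le_pos).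
  pose proof (has_sum_ge0 _ _ Hs). pose proof (has_sum_ge0 _ _ Ht).
  apply has_sum_intro; trivial.
  - intros l Hl.
    set (dA := fun a a' : A => excluded_middle_informative (a = a')).
    set (dB := fun a a' : B => excluded_middle_informative (a = a')).
    set (l1 := nodup dA (map fst l)). set (l2 := nodup dB (map snd l)).
    apply Rle_trans with (lsum (fun p => f (fst p) * g (snd p)) (list_prod l1 l2)).
    + apply lsum_incl; trivial. intros [a b] Hab; apply in_prod; apply nodup_In;
      apply in_map_iff; exists (a, b); now split.
    + rewrite lsum_prod. apply Rmult_le_compat; try (now apply lsum_ge0);
      apply has_sum_ub; trivial; apply NoDup_nodup.
  - intros M HM.
    assert (H1 : forall l m, NoDup l -> NoDup m -> lsum f l * lsum g m <= M).
    { intros l m Hl Hm; rewrite <- lsum_prod. apply HM. now apply NoDup_list_prod. }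
    assert (H2 : forall m, NoDup m -> s * lsum g m <= M).
    { intros m Hm. rewrite Rmult_comm.
      apply (has_sum_le _ _ M (has_sum_scal f (lsum g m) s (lsum_ge0 g m G0) Hs)).
      intros l Hl; rewrite lsum_scal, Rmult_comm; now apply H1. }
    apply (has_sum_le _ _ M (has_sum_scal g s t H Ht)).
    intros m Hm; rewrite lsum_scal; now apply H2.
Qed.

Lemma has_sum_Series (d : nat -> R) :
  (forall n, 0 <= d n) -> ex_series d -> has_sum d (Series d).
Proof.
  intros Hd Hs.
  assert (E : forall N, lsum d (seq 0 N) = psum d N).
  { induction N as [|N IH]; trivial. rewrite seq_S, lsum_app, IH; simpl; lra. }
  apply has_sum_intro; trivial.
  - intros l Hl.
    assert (H : exists N, incl l (seq 0 N)).
    { clear Hl; induction l as [|a l [N IH]]; [now exists O|].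
      exists (Nat.max N (S a)); intros b [<-|Hb]; [apply in_seq; lia|].
      apply IH, in_seq in Hb; apply in_seq; lia. }
    destruct H as [N HN]. apply Rle_trans with (psum d N).
    + rewrite <- E; now apply lsum_incl.
    + now apply psum_le_Series.
  - intros M HM. apply Series_correct, is_series_psum in Hs.
    apply (is_lim_seq_le (psum d) (fun _ => M) (Series d) M); trivial.
    + intros n; rewrite <- E; apply HM, seq_NoDup.
    + apply is_lim_seq_const.
Qed.

(** * Theta series over the integers *)

Definition thetaZ (e : Z -> Z) (q : C) : C := CSeries_Z (fun n => (q ^ Z.to_nat (e n))%C).

(** The exponents increase away from 0 on either side, so that each half of
    the bilateral series is a lacunary power series. *)
Definition two_sided_increasing (e : Z -> Z) : Prop :=
  (forall n, (0 <= e n)%Z) /\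
  (forall n, (0 <= n)%Z -> (e n < e (n + 1))%Z) /\
  (forall n, (n < 0)%Z -> (e n < e (n - 1))%Z).

Lemma two_sided_pos e : two_sided_increasing e ->
  strictly_increasing (fun n => Z.to_nat (e (Z.of_nat n))).
Proof.
  intros (H0 & H & _) n; apply Z2Nat.inj_lt; trivial.
  replace (Z.of_nat (S n)) with (Z.of_nat n + 1)%Z by lia; apply H; lia.
Qed.

Lemma two_sided_neg e : two_sided_increasing e ->
  strictly_increasing (fun n => Z.to_nat (e (- Z.of_nat (S n))%Z)).
Proof.
  intros (H0 & _ & H) n; apply Z2Nat.inj_lt; trivial.
  replace (- Z.of_nat (S (S n)))%Z with (- Z.of_nat (S n) - 1)%Z by lia; apply H; lia.
Qed.

Lemma pow_decreasing r m n : 0 <= r <= 1 -> (m <= n)%nat -> r ^ n <= r ^ m.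
Proof.
  intros Hr; induction 1 as [|n _ IH]; [lra|]. simpl.
  pose proof (pow_le r n (proj1 Hr)); nra.
Qed.

Lemma lacunary_summable e q : strictly_increasing e -> Cmod q < 1 ->
  abs_summable (fun n => (q ^ e n)%C).
Proof.
  intros He Hq. pose proof (Cmod_ge_0 q).
  unfold abs_summable. apply ex_series_ext with (fun n => Rabs (Cmod (q ^ e n)%C)).
  { intros; apply Rabs_pos_eq, Cmod_ge_0. }
  apply ex_series_Rabs_le with (fun n => Cmod q ^ n).
  - intros n; rewrite Rabs_pos_eq, Cmod_pow by apply Cmod_ge_0.
    apply pow_decreasing; [lra|]. now apply strictly_increasing_ge.
  - apply ex_series_geom; rewrite Rabs_pos_eq; lra.
Qed.

Lemma analytic_lacunary e : strictly_increasing e -> analytic (fun q => CSeries (fun n => (q ^ e n)%C)).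
Proof.
  intros He; exists (spread 0 e (fun _ => 1)); intros q Hq.
  assert (E : forall n, cpow_series (spread 0 e (fun _ => 1)) q n
                        = spread (RtoC 0) e (fun n => (q ^ e n)%C) n).
  { intros n; unfold cpow_series.
    destruct (classic (exists m, e m = n)) as [[m <-]|Hn].
    - rewrite !spread_hit by trivial; ring.
    - rewrite !spread_miss by (intros m Em; apply Hn; now exists m); ring. }
  split.
  - unfold abs_summable. apply ex_series_ext with (fun n => Cmod (spread (RtoC 0) e (fun n => (q ^ e n)%C) n)).
    + intros n; now rewrite E.
    + now apply abs_summable_spread, lacunary_summable.
  - rewrite (CSeries_ext _ _ E), CSeries_spread; trivial. now apply lacunary_summable.
Qed.

Lemma analytic_thetaZ e : two_sided_increasing e -> analytic (thetaZ e).
Proof.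
  intros He; apply (analytic_plus (fun q => CSeries (fun n => (q ^ Z.to_nat (e (Z.of_nat n)))%C))
    (fun q => CSeries (fun n => (q ^ Z.to_nat (e (- Z.of_nat (S n))%Z))%C))); apply analytic_lacunary.
  - now apply two_sided_pos.
  - now apply two_sided_neg.
Qed.

Lemma powerRZ_to_nat x z : (0 <= z)%Z -> x ^ Z.to_nat z = powerRZ x z.
Proof. intros Hz; rewrite <- (Z2Nat.id z) at 2 by trivial; apply pow_powerRZ. Qed.

Lemma Re_lacunary e x : Re (CSeries (fun n => (RtoC x ^ e n)%C)) = Series (fun n => x ^ e n).
Proof. unfold CSeries; simpl; apply Series_ext; intros n; now rewrite <- RtoC_pow. Qed.

Lemma has_sum_lacunary e x : strictly_increasing e -> 0 < x < 1 ->
  has_sum (fun n => x ^ e n) (Series (fun n => x ^ e n)).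
Proof.
  intros He Hx; apply has_sum_Series; [intros; apply pow_le; lra|].
  assert (Hq : Cmod x < 1) by (rewrite Cmod_R, Rabs_pos_eq; lra).
  generalize (lacunary_summable e x He Hq); apply ex_series_ext.
  intros n; rewrite Cmod_pow, Cmod_R, Rabs_pos_eq; lra.
Qed.

Lemma has_sum_thetaZ e x : two_sided_increasing e -> 0 < x < 1 ->
  has_sum (fun n => powerRZ x (e n)) (on_reals (thetaZ e) x).
Proof.
  intros He Hx. assert (H0 := proj1 He).
  unfold on_reals, thetaZ, CSeries_Z; rewrite re_plus.
  rewrite (Re_lacunary (fun n => Z.to_nat (e (Z.of_nat n)))),
    (Re_lacunary (fun n => Z.to_nat (e (- Z.of_nat (S n))%Z))).
  apply (has_sum_union Z.of_nat (fun n => (- Z.of_nat (S n))%Z)).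
  - intros m n; lia.
  - intros m n; lia.
  - intros m n; lia.
  - intros n; apply powerRZ_le; lra.
  - intros n _; destruct (Z_le_gt_dec 0 n).
    + left; exists (Z.to_nat n); lia.
    + right; exists (Z.to_nat (- n - 1)); lia.
  - apply has_sum_ext with (fun n => x ^ Z.to_nat (e (Z.of_nat n))).
    + intros n; now apply powerRZ_to_nat.
    + apply has_sum_lacunary with (e := fun n => Z.to_nat (e (Z.of_nat n))); trivial. now apply two_sided_pos.
  - apply has_sum_ext with (fun n => x ^ Z.to_nat (e (- Z.of_nat (S n))%Z)).
    + intros n; now apply powerRZ_to_nat.
    + apply has_sum_lacunary with (e := fun n => Z.to_nat (e (- Z.of_nat (S n))%Z)); trivial. now apply two_sided_neg.
Qed.

Lemma powerRZ_pow x k z : (0 <= z)%Z -> powerRZ (x ^ k) z = powerRZ x (Z.of_nat k * z).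
Proof.
  intros Hz; rewrite <- !powerRZ_to_nat, <- pow_mult by lia; f_equal.
  rewrite Z2Nat.inj_mul, Nat2Z.id; lia.
Qed.

Lemma pow_unit_interval x k : 0 < x < 1 -> (0 < k)%nat -> 0 < x ^ k < 1.
Proof. intros Hx Hk; split; [apply pow_lt; lra|apply pow_lt_1; trivial; lra]. Qed.

Lemma has_sum_thetaZ_pow e k x : two_sided_increasing e -> (0 < k)%nat -> 0 < x < 1 ->
  has_sum (fun n => powerRZ x (Z.of_nat k * e n)) (on_reals (thetaZ e) (x ^ k)).
Proof.
  intros He Hk Hx. apply has_sum_ext with (fun n => powerRZ (x ^ k) (e n)).
  - intros n; apply powerRZ_pow, He.
  - now apply has_sum_thetaZ, pow_unit_interval.
Qed.

Definition e_phi (n : Z) : Z := (n * n)%Z.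
(** Exponents of the series psi(q) = sum of q^(2 n^2 - n) over all integers n. *)
Definition e_psi (n : Z) : Z := (2 * (n * n) - n)%Z.
(** Splitting that series by the parity of n gives
    psi(q) = sum q^(8 k^2 - 2 k) + q sum q^(8 k^2 + 6 k), the parts of psi that
    are even and odd in q. *)
Definition e_psi_even (n : Z) : Z := (8 * (n * n) - 2 * n)%Z.
Definition e_psi_odd (n : Z) : Z := (8 * (n * n) + 6 * n)%Z.

Lemma e_phi_ok : two_sided_increasing e_phi.
Proof.
  unfold e_phi; repeat split; intros n; try lia.
  assert (n <= -1 \/ n = 0 \/ 1 <= n)%Z by lia; nia.
Qed.
Lemma e_psi_ok : two_sided_increasing e_psi.
Proof.
  unfold e_psi; repeat split; intros n; try lia.
  assert (n <= -1 \/ n = 0 \/ 1 <= n)%Z by lia; nia.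
Qed.
Lemma e_psi_even_ok : two_sided_increasing e_psi_even.
Proof.
  unfold e_psi_even; repeat split; intros n; try lia.
  assert (n <= -1 \/ n = 0 \/ 1 <= n)%Z by lia; nia.
Qed.
Lemma e_psi_odd_ok : two_sided_increasing e_psi_odd.
Proof.
  unfold e_psi_odd; repeat split; intros n; try lia.
  assert (n <= -1 \/ n = 0 \/ 1 <= n)%Z by lia; nia.
Qed.

Lemma CSeries_Z_ext a b : (forall n, a n = b n) -> CSeries_Z a = CSeries_Z b.
Proof. intros E; unfold CSeries_Z; f_equal; apply CSeries_ext; intros; apply E. Qed.

Lemma theta_psi_thetaZ q : theta_psi q = thetaZ e_psi q.
Proof.
  apply CSeries_Z_ext; intros n.
  rewrite <- Cpow_mult_r, <- Cpow_add_r; f_equal; unfold e_psi.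
  assert (H : exists t, (n * (n + 1) = t * 2)%Z).
  { destruct (Z.Even_or_Odd n) as [[j ->]|[j ->]]; eexists.
    - instantiate (1 := (j * (2 * j + 1))%Z); ring.
    - instantiate (1 := ((2 * j + 1) * (j + 1))%Z); ring. }
  destruct H as [t Ht].
  replace (n * (n - 1))%Z with ((t - n) * 2)%Z by lia.
  rewrite Ht, !Z.div_mul by lia.
  replace 3%nat with (Z.to_nat 3) by reflexivity.
  rewrite <- Z2Nat.inj_mul, <- Z2Nat.inj_add by nia. f_equal; lia.
Qed.

Definition rphi (x : R) : R := on_reals (thetaZ e_phi) x.
Definition rpsi (x : R) : R := on_reals (thetaZ e_psi) x.

(** n (n+1) takes each of its values twice, at n and -1-n, and the exponents of
    psi(q^2) are these values taken once: odd n = 2j-1 and even n = -2j both give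
    2 (2 j^2 - j). *)
Lemma has_sum_psi_pronic k x : (0 < k)%nat -> 0 < x < 1 ->
  has_sum (fun n => powerRZ x (Z.of_nat k * (n * (n + 1)))) (2 * rpsi (x ^ (2 * k))).
Proof.
  intros Hk Hx.
  assert (H : has_sum (fun n => powerRZ x (Z.of_nat (2 * k) * e_psi n)) (rpsi (x ^ (2 * k)))).
  { apply has_sum_thetaZ_pow; trivial; [apply e_psi_ok|lia]. }
  replace (2 * rpsi (x ^ (2 * k))) with (rpsi (x ^ (2 * k)) + rpsi (x ^ (2 * k))) by ring.
  apply (has_sum_union (fun j => 2 * j - 1)%Z (fun j => - (2 * j))%Z).
  - intros a b; lia.
  - intros a b; lia.
  - intros a b; lia.
  - intros; apply powerRZ_le; lra.
  - intros n _; destruct (Z.Even_or_Odd n) as [[j ->]|[j ->]].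
    + right; exists (- j)%Z; lia.
    + left; exists (j + 1)%Z; lia.
  - revert H; apply has_sum_ext; intros n; f_equal; unfold e_psi; lia.
  - revert H; apply has_sum_ext; intros n; f_equal; unfold e_psi; lia.
Qed.

(** * Lattice identities on (0,1) *)

Ltac pow_ge0 := intros; apply powerRZ_le; lra.

Lemma rphi_sum k x : (0 < k)%nat -> 0 < x < 1 ->
  has_sum (fun n => powerRZ x (Z.of_nat k * (n * n))) (rphi (x ^ k)).
Proof. intros; apply (has_sum_thetaZ_pow e_phi); trivial; apply e_phi_ok. Qed.

Lemma rpsi_sum k x : (0 < k)%nat -> 0 < x < 1 ->
  has_sum (fun n => powerRZ x (Z.of_nat k * (2 * (n * n) - n))) (rpsi (x ^ k)).
Proof. intros; apply (has_sum_thetaZ_pow e_psi); trivial; apply e_psi_ok. Qed.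

Lemma has_sum_shift {T} (e e' : T -> Z) x s j :
  0 < x -> has_sum (fun a => powerRZ x (e a)) s ->
  (forall a, e' a = (Z.of_nat j + e a)%Z) -> has_sum (fun a => powerRZ x (e' a)) (x ^ j * s).
Proof.
  intros Hx H E. apply has_sum_ext with (fun a => x ^ j * powerRZ x (e a)).
  - intros a. rewrite E, powerRZ_add, <- pow_powerRZ by lra; ring.
  - apply has_sum_scal; trivial; apply pow_le; lra.
Qed.

Lemma has_sum_powerRZ_prod {A B} (e : A -> Z) (e' : B -> Z) (g : A * B -> Z) x s t :
  0 < x -> has_sum (fun a => powerRZ x (e a)) s -> has_sum (fun b => powerRZ x (e' b)) t ->
  (forall a b, g (a, b) = e a + e' b)%Z ->
  has_sum (fun p => powerRZ x (g p)) (s * t).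
Proof.
  intros Hx Hs Ht E. apply (has_sum_ext (fun p => powerRZ x (e (fst p)) * powerRZ x (e' (snd p)))).
  - intros [a b]; rewrite E, powerRZ_add by lra; reflexivity.
  - now apply (has_sum_prod (fun a => powerRZ x (e a)) (fun b => powerRZ x (e' b))).
Qed.

Ltac pair_inj := intros [? ?] [? ?] E; apply pair_equal_spec in E as [? ?];
  cbn [fst snd] in *; f_equal; lia.
Ltac pair_ne := intros [? ?] [? ?] E; apply pair_equal_spec in E as [? ?];
  cbn [fst snd] in *; lia.

(** x^2 + y^2 with x + y even is 2a^2 + 2b^2 for (x,y) = (a+b, a-b); with x + y
    odd it is 1 + 2a(a+1) + 2b(b+1) for (x,y) = (a+b+1, a-b). *)
Lemma phi_sq_real x : 0 < x < 1 ->
  rphi x ^ 2 = rphi (x ^ 2) ^ 2 + 4 * x * rpsi (x ^ 4) ^ 2.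
Proof.
  intros Hx.
  pose proof (rphi_sum 1 x ltac:(lia) Hx) as P1. rewrite pow_1 in P1.
  pose proof (rphi_sum 2 x ltac:(lia) Hx) as P2.
  pose proof (has_sum_psi_pronic 2 x ltac:(lia) Hx) as Q. simpl Nat.mul in Q.
  pose proof (has_sum_powerRZ_prod _ _ (fun p : Z * Z => fst p * fst p + snd p * snd p)%Z x _ _
     (proj1 Hx) P1 P1 ltac:(intros; cbn [fst snd]; lia)) as H.
  pose proof (has_sum_powerRZ_prod _ _ (fun p : Z * Z => 2 * (fst p * fst p) + 2 * (snd p * snd p))%Z x _ _
     (proj1 Hx) P2 P2 ltac:(intros; cbn [fst snd]; lia)) as H1.
  pose proof (has_sum_powerRZ_prod _ _ (fun p : Z * Z => 2 * (fst p * (fst p + 1)) + 2 * (snd p * (snd p + 1)))%Z x _ _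
     (proj1 Hx) Q Q ltac:(intros; cbn [fst snd]; lia)) as H2.
  apply (has_sum_shift _ (fun p => 1 + (2 * (fst p * (fst p + 1)) + 2 * (snd p * (snd p + 1))))%Z x _ 1 (proj1 Hx)) in H2;
    [|intros; lia].
  transitivity (rphi (x ^ 2) * rphi (x ^ 2) + x ^ 1 * (2 * rpsi (x ^ 4) * (2 * rpsi (x ^ 4)))); [|ring].
  replace (rphi x ^ 2) with (rphi x * rphi x) by ring.
  apply (has_sum_unique _ _ _ H).
  apply (has_sum_union (fun p : Z * Z => (fst p + snd p, fst p - snd p)%Z)
                       (fun p : Z * Z => (fst p + snd p + 1, fst p - snd p)%Z)).
  - pair_inj.
  - pair_inj.
  - pair_ne.
  - pow_ge0.
  - intros [a b] _; destruct (Z.Even_or_Odd (a + b)) as [[j Hj]|[j Hj]].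
    + left; exists (j, a - j)%Z; cbn [fst snd]; f_equal; lia.
    + right; exists (j, j - b)%Z; cbn [fst snd]; f_equal; lia.
  - revert H1; apply has_sum_ext; intros [a b]; cbn [fst snd]; f_equal; ring.
  - revert H2; apply has_sum_ext; intros [a b]; cbn [fst snd]; f_equal; ring.
Qed.

(** For x + y even, (x,y) = (a+b, a-b) turns x(x+1) + y(y+1) into
    2a(a+1) + 2b^2; the reflection of y about -1/2 keeps the exponent and
    exchanges the two parities. *)
Lemma psi_sq_real x : 0 < x < 1 -> rpsi (x ^ 2) ^ 2 = rphi (x ^ 2) * rpsi (x ^ 4).
Proof.
  intros Hx.
  pose proof (rphi_sum 2 x ltac:(lia) Hx) as P2.
  pose proof (has_sum_psi_pronic 1 x ltac:(lia) Hx) as Q1. simpl Nat.mul in Q1.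
  pose proof (has_sum_psi_pronic 2 x ltac:(lia) Hx) as Q2. simpl Nat.mul in Q2.
  pose proof (has_sum_powerRZ_prod _ _ (fun p : Z * Z => fst p * (fst p + 1) + snd p * (snd p + 1))%Z x _ _
     (proj1 Hx) Q1 Q1 ltac:(intros; cbn [fst snd]; lia)) as H.
  pose proof (has_sum_powerRZ_prod _ _ (fun p : Z * Z => 2 * (fst p * (fst p + 1)) + 2 * (snd p * snd p))%Z x _ _
     (proj1 Hx) Q2 P2 ltac:(intros; cbn [fst snd]; lia)) as H1.
  enough (E : 2 * rpsi (x ^ 2) * (2 * rpsi (x ^ 2))
    = 2 * rpsi (x ^ 4) * rphi (x ^ 2) + 2 * rpsi (x ^ 4) * rphi (x ^ 2)) by (simpl; simpl in E; lra).
  apply (has_sum_unique _ _ _ H).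
  apply (has_sum_union (fun p : Z * Z => (fst p + snd p, fst p - snd p)%Z)
                       (fun p : Z * Z => (fst p + snd p, - 1 - (fst p - snd p))%Z)).
  - pair_inj.
  - pair_inj.
  - pair_ne.
  - pow_ge0.
  - intros [a b] _; destruct (Z.Even_or_Odd (a + b)) as [[j Hj]|[j Hj]].
    + left; exists (j, a - j)%Z; cbn [fst snd]; f_equal; lia.
    + right; exists (a - j - 1, j + 1)%Z; cbn [fst snd]; f_equal; lia.
  - revert H1; apply has_sum_ext; intros [a b]; cbn [fst snd]; f_equal; ring.
  - revert H1; apply has_sum_ext; intros [a b]; cbn [fst snd]; f_equal; ring.
Qed.

Lemma has_sum_parity (e e0 e1 : Z -> Z) x s t :
  0 < x -> (forall n, e (2 * n) = e0 n)%Z -> (forall n, e (2 * n + 1) = e1 n)%Z ->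
  has_sum (fun n => powerRZ x (e0 n)) s -> has_sum (fun n => powerRZ x (e1 n)) t ->
  has_sum (fun n => powerRZ x (e n)) (s + t).
Proof.
  intros Hx E0 E1 H0 H1.
  apply (has_sum_union (fun n => 2 * n)%Z (fun n => 2 * n + 1)%Z).
  - intros a b; lia.
  - intros a b; lia.
  - intros a b; lia.
  - pow_ge0.
  - intros n _; destruct (Z.Even_or_Odd n) as [[j ->]|[j ->]]; [left|right]; now exists j.
  - revert H0; apply has_sum_ext; intros n; now rewrite E0.
  - revert H1; apply has_sum_ext; intros n; now rewrite E1.
Qed.

Lemma phi_split_real x : 0 < x < 1 -> rphi x = rphi (x ^ 4) + 2 * x * rpsi (x ^ 8).
Proof.
  intros Hx.
  pose proof (rphi_sum 1 x ltac:(lia) Hx) as P1. rewrite pow_1 in P1.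
  pose proof (rphi_sum 4 x ltac:(lia) Hx) as P4.
  pose proof (has_sum_psi_pronic 4 x ltac:(lia) Hx) as Q. simpl Nat.mul in Q.
  apply (has_sum_shift _ (fun n => 1 + 4 * (n * (n + 1)))%Z x _ 1 (proj1 Hx)) in Q;
    [|intros; lia].
  transitivity (rphi (x ^ 4) + x ^ 1 * (2 * rpsi (x ^ 8))); [|ring].
  apply (has_sum_unique _ _ _ P1).
  apply (has_sum_parity _ _ _ x _ _ (proj1 Hx)) with (3 := P4) (4 := Q); intros; lia.
Qed.

Definition rpsi_even (x : R) : R := on_reals (thetaZ e_psi_even) x.
Definition rpsi_odd (x : R) : R := on_reals (thetaZ e_psi_odd) x.

Lemma psi_split_real x : 0 < x < 1 -> rpsi x = rpsi_even x + x * rpsi_odd x.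
Proof.
  intros Hx.
  pose proof (rpsi_sum 1 x ltac:(lia) Hx) as P1. rewrite pow_1 in P1.
  pose proof (has_sum_thetaZ _ x e_psi_even_ok Hx) as P0.
  pose proof (has_sum_thetaZ _ x e_psi_odd_ok Hx) as Q.
  apply (has_sum_shift _ (fun n => 1 + e_psi_odd n)%Z x _ 1 (proj1 Hx)) in Q;
    [|intros; lia].
  rewrite pow_1 in Q.
  apply (has_sum_unique _ _ _ P1).
  apply (has_sum_parity _ _ _ x _ _ (proj1 Hx)) with (3 := P0) (4 := Q);
    intros; unfold e_psi_even, e_psi_odd; lia.
Qed.

(** Terms with odd index sum: the difference f(q) g(q) - f(-q) g(-q) consists of
    twice such terms. *)
Definition odd_part (g : Z * Z -> Z) (x : R) (p : Z * Z) : R :=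
  if Z.odd (fst p + snd p) then powerRZ x (g p) else 0.

Lemma odd_part_ge0 g x p : 0 < x -> 0 <= odd_part g x p.
Proof. intros; unfold odd_part; destruct Z.odd; [pow_ge0|lra]. Qed.

Lemma odd_part_odd g x p : (exists j, fst p + snd p = 2 * j + 1)%Z -> odd_part g x p = powerRZ x (g p).
Proof. intros H; unfold odd_part; apply Z.odd_spec in H; now rewrite H. Qed.

Lemma odd_part_neq0 g x p : odd_part g x p <> 0 -> exists j, (fst p + snd p = 2 * j + 1)%Z.
Proof.
  unfold odd_part; destruct Z.odd eqn:E; [|easy]. intros _; now apply Z.odd_spec in E.
Qed.

Lemma has_sum_odd_part {A B} (g : Z * Z -> Z) (h : A -> Z * Z) (h' : B -> Z * Z)
    (e : A -> Z) (e' : B -> Z) x s s' :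
  0 < x -> Injective h -> Injective h' -> (forall a b, h a <> h' b) ->
  (forall a, exists j, fst (h a) + snd (h a) = 2 * j + 1)%Z ->
  (forall b, exists j, fst (h' b) + snd (h' b) = 2 * j + 1)%Z ->
  (forall m n j, (m + n = 2 * j + 1)%Z -> (exists a, h a = (m, n)) \/ (exists b, h' b = (m, n))) ->
  (forall a, g (h a) = e a) -> (forall b, g (h' b) = e' b) ->
  has_sum (fun a => powerRZ x (e a)) s -> has_sum (fun b => powerRZ x (e' b)) s' ->
  has_sum (odd_part g x) (s + s').
Proof.
  intros Hx I I' D O O' C E E' H H'.
  apply (has_sum_union h h'); trivial.
  - intros; now apply odd_part_ge0.
  - intros [m n] Hb; apply odd_part_neq0 in Hb as [j Hj]; now apply (C m n j).
  - revert H; apply has_sum_ext; intros a; now rewrite odd_part_odd, E.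
  - revert H'; apply has_sum_ext; intros b; now rewrite odd_part_odd, E'.
Qed.

(** Exponents of q psi(q^3) psi(q^5), of phi(q^6) phi(q^10) and of
    q^4 psi(q^12) psi(q^20).  Multiplied by 8 they are the values of 3 X^2 + 5 Y^2
    at (4m-1, 4n-1), at (4x, 4y) and at (8x-2, 8y-2). *)
Definition g_psi (p : Z * Z) : Z :=
  (1 + 3 * (2 * (fst p * fst p) - fst p) + 5 * (2 * (snd p * snd p) - snd p))%Z.
Definition g_phi (p : Z * Z) : Z := (6 * (fst p * fst p) + 10 * (snd p * snd p))%Z.
Definition g_psi_double (p : Z * Z) : Z :=
  (4 + 12 * (2 * (fst p * fst p) - fst p) + 20 * (2 * (snd p * snd p) - snd p))%Z.

(** The index pairs with m + n odd fall into the classes 3m + n = 1 and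
    3m + n = 3 modulo 4. *)
Definition quarter1 (p : Z * Z) : Z * Z := (fst p, 1 - 3 * fst p + 4 * snd p)%Z.
Definition quarter3 (p : Z * Z) : Z * Z := (fst p, 3 - 3 * fst p + 4 * snd p)%Z.

(** The map (X,Y) = (x + 5y, y - 3x) multiplies 3 x^2 + 5 y^2 by 16.  In the
    coordinates of [g_psi] it sends (4x, 4y)/4 with x + y odd onto the class
    3m + n = 1 modulo 4, one sign of (x,y) being selected by X = -1 modulo 4,
    and it sends (8x-2, 8y-2)/4 onto the class 3m + n = 3, again up to a sign
    that depends on the parity of x + y.  Hence the first series is twice, and
    the second once, the corresponding half of the odd part. *)
Lemma lattice15 x sF sG sB : 0 < x < 1 ->
  has_sum (odd_part g_phi x) sF -> has_sum (odd_part g_psi x) sG ->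
  has_sum (fun p => powerRZ x (g_psi_double p)) sB ->
  sF + 2 * sB = 2 * sG.
Proof.
  intros Hx HF HG HB.
  assert (Inj1 : Injective quarter1) by (unfold quarter1; pair_inj).
  assert (Inj3 : Injective quarter3) by (unfold quarter3; pair_inj).
  assert (O1 : forall p, exists j, (fst (quarter1 p) + snd (quarter1 p) = 2 * j + 1)%Z).
  { intros [m k]; exists (2 * k - m)%Z; unfold quarter1; cbn [fst snd]; lia. }
  assert (O3 : forall p, exists j, (fst (quarter3 p) + snd (quarter3 p) = 2 * j + 1)%Z).
  { intros [m k]; exists (2 * k - m + 1)%Z; unfold quarter3; cbn [fst snd]; lia. }
  destruct (has_sum_sub quarter1 _ _ Inj1 HG) as [T1 H1].
  destruct (has_sum_sub quarter3 _ _ Inj3 HG) as [T3 H3].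
  apply (has_sum_ext _ (fun p => powerRZ x (g_psi (quarter1 p)))) in H1;
    [|intros; now apply odd_part_odd].
  apply (has_sum_ext _ (fun p => powerRZ x (g_psi (quarter3 p)))) in H3;
    [|intros; now apply odd_part_odd].
  assert (EG : sG = T1 + T3).
  { apply (has_sum_unique _ _ _ HG).
    apply (has_sum_odd_part g_psi quarter1 quarter3) with (10 := H1) (11 := H3); trivial; try lra.
    - unfold quarter1, quarter3; pair_ne.
    - intros m n j Hj. destruct (Z.Even_or_Odd (m + j)) as [[i Hi]|[i Hi]].
      + left; exists (m, i); unfold quarter1; cbn [fst snd]; f_equal; lia.
      + right; exists (m, i); unfold quarter3; cbn [fst snd]; f_equal; lia. }
  (* the two signs of (x,y) *)
  assert (EF : sF = T1 + T1).
  { apply (has_sum_unique _ _ _ HF).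
    apply (has_sum_odd_part g_phi (fun p => (4 * fst p - 1 - 5 * snd p, snd p)%Z)
      (fun p => (- (4 * fst p - 1 - 5 * snd p), - snd p)%Z)) with (10 := H1) (11 := H1); try lra.
    - pair_inj.
    - pair_inj.
    - pair_ne.
    - intros [m k]; exists (2 * m - 1 - 2 * k)%Z; cbn [fst snd]; lia.
    - intros [m k]; exists (- (2 * m - 2 * k))%Z; cbn [fst snd]; lia.
    - intros m n j Hj. destruct (Z.Even_or_Odd j) as [[i Hi]|[i Hi]].
      + right; exists (- i - n, - n)%Z; cbn [fst snd]; f_equal; lia.
      + left; exists (i + 1 + n, n)%Z; cbn [fst snd]; f_equal; lia.
    - intros [m k]; unfold g_phi, g_psi, quarter1; cbn [fst snd]; ring.
    - intros [m k]; unfold g_phi, g_psi, quarter1; cbn [fst snd]; ring. }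
  (* cut both sides by a parity: of [k] on the right, of x + y on the left *)
  assert (EB : sB = T3).
  { set (ho := fun p : Z * Z => (fst p, 2 * snd p - 1)%Z).
    set (he := fun p : Z * Z => (fst p, - 2 * snd p)%Z).
    assert (Ino : Injective ho) by (unfold ho; pair_inj).
    assert (Ine : Injective he) by (unfold he; pair_inj).
    destruct (has_sum_sub ho _ _ Ino H3) as [To Ho].
    destruct (has_sum_sub he _ _ Ine H3) as [Te He].
    transitivity (To + Te).
    - apply (has_sum_unique _ _ _ HB).
      apply (has_sum_union (fun p : Z * Z => (2 * fst p + 1 - 5 * snd p, snd p)%Z)
              (fun p : Z * Z => (2 - 2 * fst p - 5 * snd p, snd p)%Z)).
      + pair_inj.
      + pair_inj.
      + pair_ne.
      + pow_ge0.
      + intros [m n] _. destruct (Z.Even_or_Odd (m + n)) as [[i Hi]|[i Hi]].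
        * right; exists (1 - i - 2 * n, n)%Z; cbn [fst snd]; f_equal; lia.
        * left; exists (i + 2 * n, n)%Z; cbn [fst snd]; f_equal; lia.
      + revert Ho; apply has_sum_ext; intros [m n]; f_equal.
        unfold ho, g_psi_double, g_psi, quarter3; cbn [fst snd]; ring.
      + revert He; apply has_sum_ext; intros [m n]; f_equal.
        unfold he, g_psi_double, g_psi, quarter3; cbn [fst snd]; ring.
    - symmetry; apply (has_sum_unique _ _ _ H3).
      apply (has_sum_union ho he); trivial.
      + unfold ho, he; pair_ne.
      + pow_ge0.
      + intros [m n] _; unfold ho, he; destruct (Z.Even_or_Odd n) as [[i Hi]|[i Hi]].
        * right; exists (m, - i)%Z; cbn [fst snd]; f_equal; lia.
        * left; exists (m, i + 1)%Z; cbn [fst snd]; f_equal; lia. }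
  lra.
Qed.

Lemma has_sum_odd_part_prod (e e' e0 e1 e0' e1' : Z -> Z) (g : Z * Z -> Z) x s0 s1 s0' s1' :
  0 < x -> (forall m n, g (m, n) = e m + e' n)%Z ->
  (forall n, e (2 * n) = e0 n)%Z -> (forall n, e (2 * n + 1) = e1 n)%Z ->
  (forall n, e' (2 * n) = e0' n)%Z -> (forall n, e' (2 * n + 1) = e1' n)%Z ->
  has_sum (fun n => powerRZ x (e0 n)) s0 -> has_sum (fun n => powerRZ x (e1 n)) s1 ->
  has_sum (fun n => powerRZ x (e0' n)) s0' -> has_sum (fun n => powerRZ x (e1' n)) s1' ->
  has_sum (odd_part g x) (s0 * s1' + s1 * s0').
Proof.
  intros Hx G E0 E1 E0' E1' H0 H1 H0' H1'.
  pose proof (has_sum_powerRZ_prod _ _ (fun p => e0 (fst p) + e1' (snd p))%Z x _ _ Hx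
    H0 H1' ltac:(reflexivity)) as A.
  pose proof (has_sum_powerRZ_prod _ _ (fun p => e1 (fst p) + e0' (snd p))%Z x _ _ Hx
    H1 H0' ltac:(reflexivity)) as B.
  apply (has_sum_odd_part g (fun p => (2 * fst p, 2 * snd p + 1)%Z) (fun p => (2 * fst p + 1, 2 * snd p)%Z))
    with (10 := A) (11 := B); trivial.
  - pair_inj.
  - pair_inj.
  - pair_ne.
  - intros [m n]; exists (m + n)%Z; cbn [fst snd]; lia.
  - intros [m n]; exists (m + n)%Z; cbn [fst snd]; lia.
  - intros m n j Hj. destruct (Z.Even_or_Odd m) as [[i Hi]|[i Hi]].
    + left; exists (i, j - i)%Z; cbn [fst snd]; f_equal; lia.
    + right; exists (i, j - i)%Z; cbn [fst snd]; f_equal; lia.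
  - intros [m n]; cbn [fst snd]; now rewrite G, E0, E1'.
  - intros [m n]; cbn [fst snd]; now rewrite G, E1, E0'.
Qed.

(** [lattice15] with both odd parts written out through even and odd halves. *)
Lemma schroter_real x : 0 < x < 1 ->
  rphi (x ^ 24) * (x ^ 10 * (2 * rpsi (x ^ 80))) + x ^ 6 * (2 * rpsi (x ^ 48)) * rphi (x ^ 40)
   + 2 * (x ^ 4 * (rpsi (x ^ 12) * rpsi (x ^ 20)))
  = 2 * (x ^ 1 * rpsi_even (x ^ 3) * (x ^ 5 * rpsi_odd (x ^ 5))
         + x ^ 4 * rpsi_odd (x ^ 3) * rpsi_even (x ^ 5)).
Proof.
  intros Hx. assert (Hx0 := proj1 Hx).
  pose proof (has_sum_psi_pronic 24 x ltac:(lia) Hx) as Q48. simpl Nat.mul in Q48.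
  pose proof (has_sum_psi_pronic 40 x ltac:(lia) Hx) as Q80. simpl Nat.mul in Q80.
  apply (lattice15 x); trivial.
  - apply (has_sum_odd_part_prod (fun n => 6 * (n * n))%Z (fun n => 10 * (n * n))%Z) with
      (7 := rphi_sum 24 x ltac:(lia) Hx) (9 := rphi_sum 40 x ltac:(lia) Hx)
      (8 := has_sum_shift _ (fun n => 6 + 24 * (n * (n + 1)))%Z x _ 6 Hx0 Q48 ltac:(intros; cbv beta; lia))
      (10 := has_sum_shift _ (fun n => 10 + 40 * (n * (n + 1)))%Z x _ 10 Hx0 Q80 ltac:(intros; cbv beta; lia));
      trivial; intros; try lia; reflexivity.
  - pose proof (has_sum_thetaZ_pow _ 3 x e_psi_even_ok ltac:(lia) Hx) as A0.
    pose proof (has_sum_thetaZ_pow _ 3 x e_psi_odd_ok ltac:(lia) Hx) as A1.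
    pose proof (has_sum_thetaZ_pow _ 5 x e_psi_even_ok ltac:(lia) Hx) as B0.
    pose proof (has_sum_thetaZ_pow _ 5 x e_psi_odd_ok ltac:(lia) Hx) as B1.
    apply (has_sum_odd_part_prod (fun n => 1 + 3 * (2 * (n * n) - n))%Z (fun n => 5 * (2 * (n * n) - n))%Z) with
      (7 := has_sum_shift _ (fun n => 1 + 3 * e_psi_even n)%Z x _ 1 Hx0 A0 ltac:(intros; cbv beta; lia))
      (8 := has_sum_shift _ (fun n => 4 + 3 * e_psi_odd n)%Z x _ 4 Hx0 A1 ltac:(intros; cbv beta; lia))
      (9 := B0)
      (10 := has_sum_shift _ (fun n => 5 + 5 * e_psi_odd n)%Z x _ 5 Hx0 B1 ltac:(intros; cbv beta; lia));
      trivial; intros; unfold g_psi, e_psi_even, e_psi_odd; cbn [fst snd]; lia.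
  - apply (has_sum_shift (fun p : Z * Z => 12 * (2 * (fst p * fst p) - fst p) + 20 * (2 * (snd p * snd p) - snd p))%Z);
      trivial; [|intros [m n]; unfold g_psi_double; cbn [fst snd]; lia].
    apply (has_sum_powerRZ_prod _ _ _ x _ _ Hx0) with
      (1 := rpsi_sum 12 x ltac:(lia) Hx) (2 := rpsi_sum 20 x ltac:(lia) Hx); intros; cbn [fst snd]; lia.
Qed.

(** * Theta identities on the unit disc *)

Lemma analytic_phi : analytic theta_phi.
Proof. exact (analytic_thetaZ _ e_phi_ok). Qed.

Lemma analytic_psi : analytic theta_psi.
Proof.
  apply analytic_ext with (thetaZ e_psi); [intros; symmetry; apply theta_psi_thetaZ|].
  exact (analytic_thetaZ _ e_psi_ok).
Qed.

Definition psi_even := thetaZ e_psi_even.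
Definition psi_odd := thetaZ e_psi_odd.

Lemma analytic_psi_even : analytic psi_even.
Proof. exact (analytic_thetaZ _ e_psi_even_ok). Qed.
Lemma analytic_psi_odd : analytic psi_odd.
Proof. exact (analytic_thetaZ _ e_psi_odd_ok). Qed.

Ltac analytic_tac :=
  lazymatch goal with
  | |- analytic (fun q => q) => exact analytic_id
  | |- analytic (fun _ => RtoC ?a) => exact (analytic_const a)
  | |- analytic (fun q => @?f q + @?g q)%C => apply (analytic_plus f g); analytic_tac
  | |- analytic (fun q => @?f q - @?g q)%C => apply (analytic_minus f g); analytic_tac
  | |- analytic (fun q => @?f q * @?g q)%C => apply (analytic_mult f g); analytic_tac
  | |- analytic (fun q => ?f (q ^ ?k)%C) => apply (analytic_comp_pow f k); [lia|analytic_tac]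
  | |- analytic (fun q => ?f (- q ^ ?k)%C) => apply (analytic_comp_opp f k); [lia|analytic_tac]
  | |- analytic (fun q => Cpow (@?f q) ?k) => apply (analytic_pow f k); analytic_tac
  | |- analytic (fun q => ?f q) => change (analytic f); analytic_tac
  | |- analytic theta_phi => exact analytic_phi
  | |- analytic theta_psi => exact analytic_psi
  | |- analytic psi_even => exact analytic_psi_even
  | |- analytic psi_odd => exact analytic_psi_odd
  end.

Lemma phi_RtoC x : Rabs x < 1 -> theta_phi (RtoC x) = RtoC (rphi x).
Proof. exact (on_reals_correct _ x analytic_phi). Qed.

Lemma psi_RtoC x : Rabs x < 1 -> theta_psi (RtoC x) = RtoC (rpsi x).
Proof.
  intros Hx; rewrite theta_psi_thetaZ.
  exact (on_reals_correct _ x (analytic_thetaZ _ e_psi_ok) Hx).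
Qed.

Lemma psi_even_RtoC x : Rabs x < 1 -> psi_even (RtoC x) = RtoC (rpsi_even x).
Proof. exact (on_reals_correct _ x analytic_psi_even). Qed.

Lemma psi_odd_RtoC x : Rabs x < 1 -> psi_odd (RtoC x) = RtoC (rpsi_odd x).
Proof. exact (on_reals_correct _ x analytic_psi_odd). Qed.

Lemma Rabs_pow_lt x k : Rabs x < 1 -> (0 < k)%nat -> Rabs (x ^ k) < 1.
Proof.
  intros Hx Hk; rewrite <- RPow_abs; apply pow_lt_1; trivial; split; trivial; apply Rabs_pos.
Qed.

Ltac abs_lt_1_tac := first [ apply Rabs_pow_lt; [rewrite Rabs_pos_eq; lra|lia] | rewrite Rabs_pos_eq; lra ].

Ltac to_reals :=
  rewrite <- ?RtoC_pow;
  rewrite ?phi_RtoC, ?psi_RtoC, ?psi_even_RtoC, ?psi_odd_RtoC by abs_lt_1_tac;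
  rewrite <- ?RtoC_pow, <- ?RtoC_mult, <- ?RtoC_plus, <- ?RtoC_minus, <- ?RtoC_mult, <- ?RtoC_plus,
    <- ?RtoC_pow, <- ?RtoC_mult, <- ?RtoC_plus; f_equal.

Lemma phi_sq q : Cmod q < 1 ->
  (theta_phi q ^ 2 = theta_phi (q ^ 2) ^ 2 + 4 * q * theta_psi (q ^ 4) ^ 2)%C.
Proof.
  apply (analytic_eq (fun q => theta_phi q ^ 2)%C
    (fun q => theta_phi (q ^ 2) ^ 2 + 4 * q * theta_psi (q ^ 4) ^ 2)%C 1); [analytic_tac..|lra|].
  intros x Hx. to_reals. now apply phi_sq_real.
Qed.

(** The series identity holds at squares, hence at x = (sqrt x)^2. *)
Lemma psi_sq q : Cmod q < 1 -> (theta_psi q ^ 2 = theta_phi q * theta_psi (q ^ 2))%C.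
Proof.
  apply (analytic_eq (fun q => theta_psi q ^ 2)%C
    (fun q => theta_phi q * theta_psi (q ^ 2))%C 1); [analytic_tac..|lra|].
  intros x Hx. to_reals.
  assert (Hs : 0 < sqrt x < 1).
  { split; [apply sqrt_lt_R0; lra|]. rewrite <- sqrt_1; apply sqrt_lt_1; lra. }
  pose proof (psi_sq_real _ Hs) as E.
  replace (sqrt x ^ 4) with ((sqrt x ^ 2) ^ 2) in E by ring.
  rewrite pow2_sqrt in E by lra. exact E.
Qed.

Lemma phi_split q : Cmod q < 1 ->
  (theta_phi q = theta_phi (q ^ 4) + 2 * q * theta_psi (q ^ 8))%C.
Proof.
  apply (analytic_eq theta_phi
    (fun q => theta_phi (q ^ 4) + 2 * q * theta_psi (q ^ 8))%C 1); [analytic_tac..|lra|].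
  intros x Hx. to_reals. now apply phi_split_real.
Qed.

Lemma psi_split q : Cmod q < 1 -> (theta_psi q = psi_even q + q * psi_odd q)%C.
Proof.
  apply (analytic_eq theta_psi (fun q => psi_even q + q * psi_odd q)%C 1); [analytic_tac..|lra|].
  intros x Hx. to_reals. now apply psi_split_real.
Qed.

Lemma Cpow_opp_even (q : C) z : (0 <= z)%Z -> ((- q) ^ Z.to_nat (2 * z) = q ^ Z.to_nat (2 * z))%C.
Proof.
  intros Hz. rewrite Z2Nat.inj_mul, !Cpow_mult_r by lia. f_equal. simpl; ring.
Qed.

Lemma thetaZ_opp (e e' : Z -> Z) q :
  (forall n, 0 <= e' n)%Z -> (forall n, e n = 2 * e' n)%Z -> thetaZ e (- q)%C = thetaZ e q.
Proof. intros H0 E; apply CSeries_Z_ext; intros n; rewrite E; now apply Cpow_opp_even. Qed.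

Lemma psi_even_opp q : psi_even (- q)%C = psi_even q.
Proof.
  apply (thetaZ_opp _ (fun n => 4 * (n * n) - n)%Z); intros n; unfold e_psi_even; [|lia].
  assert (n <= -1 \/ n = 0 \/ 1 <= n)%Z by lia; nia.
Qed.

Lemma psi_odd_opp q : psi_odd (- q)%C = psi_odd q.
Proof.
  apply (thetaZ_opp _ (fun n => 4 * (n * n) + 3 * n)%Z); intros n; unfold e_psi_odd; [|lia].
  assert (n <= -1 \/ n = 0 \/ 1 <= n)%Z by lia; nia.
Qed.

Lemma psi_opp_split q : Cmod q < 1 -> (theta_psi (- q) = psi_even q - q * psi_odd q)%C.
Proof.
  intros Hq. rewrite psi_split by (now rewrite Cmod_opp).
  rewrite psi_even_opp, psi_odd_opp; ring.
Qed.

Lemma phi_opp_split q : Cmod q < 1 ->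
  (theta_phi (- q) = theta_phi (q ^ 4) - 2 * q * theta_psi (q ^ 8))%C.
Proof.
  intros Hq. rewrite phi_split by (now rewrite Cmod_opp).
  replace ((- q) ^ 4)%C with (q ^ 4)%C by ring. replace ((- q) ^ 8)%C with (q ^ 8)%C by ring. ring.
Qed.

Lemma Cmod_pow_lt_1 (q : C) k : Cmod q < 1 -> (0 < k)%nat -> Cmod (q ^ k) < 1.
Proof.
  intros Hq Hk; rewrite Cmod_pow; apply pow_lt_1; trivial; split; trivial; apply Cmod_ge_0.
Qed.

(** Both sides are phi(q^4)^2 - 4 q^2 psi(q^8)^2: the left one by splitting
    phi(q) and phi(-q), the right one by [phi_sq] at -q^2. *)
Lemma phi_mul_phi_opp q : Cmod q < 1 ->
  (theta_phi q * theta_phi (- q) = theta_phi (- q ^ 2) ^ 2)%C.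
Proof.
  intros Hq. rewrite (phi_split q), (phi_opp_split q) by trivial.
  rewrite (phi_sq (- q ^ 2)%C) by (rewrite Cmod_opp; apply Cmod_pow_lt_1; trivial; lia).
  replace ((- q ^ 2) ^ 2)%C with (q ^ 4)%C by ring.
  replace ((- q ^ 2) ^ 4)%C with (q ^ 8)%C by ring. ring.
Qed.

(** A Schroter-type identity; it is the modular equation
    w = u + v - u v of degrees 3 and 5 cleared of denominators. *)
Lemma schroter15 q : Cmod q < 1 ->
  (theta_phi (q ^ 6) * theta_phi (q ^ 10) - theta_phi (- q ^ 6) * theta_phi (- q ^ 10)
   + 4 * q ^ 4 * theta_psi (q ^ 12) * theta_psi (q ^ 20)
   = 2 * q * (theta_psi (q ^ 3) * theta_psi (q ^ 5) - theta_psi (- q ^ 3) * theta_psi (- q ^ 5)))%C.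
Proof.
  intros Hq.
  assert (HP : forall k, (0 < k)%nat -> Cmod (q ^ k) < 1) by (intros; now apply Cmod_pow_lt_1).
  rewrite !phi_opp_split, !psi_opp_split, (phi_split (q ^ 6)), (phi_split (q ^ 10)),
    (psi_split (q ^ 3)), (psi_split (q ^ 5)) by (apply HP; lia).
  replace ((q ^ 6) ^ 4)%C with (q ^ 24)%C by ring.
  replace ((q ^ 6) ^ 8)%C with (q ^ 48)%C by ring.
  replace ((q ^ 10) ^ 4)%C with (q ^ 40)%C by ring.
  replace ((q ^ 10) ^ 8)%C with (q ^ 80)%C by ring.
  assert (E : (theta_phi (q ^ 24) * (q ^ 10 * (2 * theta_psi (q ^ 80)))
     + q ^ 6 * (2 * theta_psi (q ^ 48)) * theta_phi (q ^ 40)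
     + 2 * (q ^ 4 * (theta_psi (q ^ 12) * theta_psi (q ^ 20)))
    = 2 * (q ^ 1 * psi_even (q ^ 3) * (q ^ 5 * psi_odd (q ^ 5))
         + q ^ 4 * psi_odd (q ^ 3) * psi_even (q ^ 5)))%C).
  { revert q Hq HP. intros q Hq _; revert q Hq.
    match goal with |- forall q, _ -> @?f q = @?g q => apply (analytic_eq f g 1) end.
    - analytic_tac.
    - analytic_tac.
    - lra.
    - intros x Hx. to_reals. now apply schroter_real. }
  transitivity (2 * (theta_phi (q ^ 24) * (q ^ 10 * (2 * theta_psi (q ^ 80)))
     + q ^ 6 * (2 * theta_psi (q ^ 48)) * theta_phi (q ^ 40)
     + 2 * (q ^ 4 * (theta_psi (q ^ 12) * theta_psi (q ^ 20)))))%C; [|rewrite E]; ring.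
Qed.

(** * Theta values at the origin; phi has no zeros *)

Lemma CSeries_scal (z : C) a : abs_summable a -> CSeries (fun n => z * a n)%C = (z * CSeries a)%C.
Proof.
  intros Ha.
  pose proof (ex_series_Rabs _ (abs_summable_Re a Ha)) as HR.
  pose proof (ex_series_Rabs _ (abs_summable_Im a Ha)) as HI.
  destruct z as [x y]. unfold CSeries. apply injective_projections; simpl.
  - rewrite <- !Series_scal_l, <- Series_minus; try (now apply (ex_series_scal (V := R_NormedModule))).
    reflexivity.
  - rewrite <- !Series_scal_l, <- Series_plus; try (now apply (ex_series_scal (V := R_NormedModule))).
    reflexivity.
Qed.

Lemma CSeries_incr a : abs_summable a -> CSeries a = (a O + CSeries (fun n => a (S n)))%C.
Proof.
  intros Ha. unfold CSeries. apply injective_projections; simpl.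
  - apply Series_incr_1, ex_series_Rabs, abs_summable_Re, Ha.
  - apply Series_incr_1, ex_series_Rabs, abs_summable_Im, Ha.
Qed.

Lemma analytic_shift f : analytic f ->
  exists g, analytic g /\ forall q, Cmod q < 1 -> f q = (f 0%R + q * g q)%C.
Proof.
  intros [c Hc].
  assert (H1 : forall q, Cmod q < 1 -> abs_summable (cpow_series (fun n => c (S n)) q)).
  { intros q Hq. set (r := (Cmod q + 1) / 2).
    assert (Hr : Cmod q < r < 1) by (unfold r; lra).
    pose proof (Cmod_ge_0 q) as Q0.
    destruct (Hc (RtoC r)) as [A _]; [rewrite Cmod_R, Rabs_pos_eq; lra|].
    apply (ex_series_incr_1 (fun n => Cmod (cpow_series c r n))) in A.
    apply (ex_series_scal (V := R_NormedModule) (/ r)) in A.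
    apply ex_series_ext with (fun n => Rabs (Cmod (cpow_series (fun n => c (S n)) q n))).
    { intros; apply Rabs_pos_eq, Cmod_ge_0. }
    revert A; apply ex_series_Rabs_le; intros n.
    rewrite Rabs_pos_eq by apply Cmod_ge_0. unfold scal; simpl; unfold mult; simpl.
    rewrite !Cmod_cpow_series, Cmod_R, (Rabs_pos_eq r) by lra; simpl.
    replace (/ r * (Rabs (c (S n)) * (r * r ^ n))) with (Rabs (c (S n)) * r ^ n) by (field; lra).
    apply Rmult_le_compat_l; [apply Rabs_pos|]. apply pow_incr; lra. }
  exists (fun q => CSeries (cpow_series (fun n => c (S n)) q)); split.
  - exists (fun n => c (S n)); intros q Hq; split; auto.
  - assert (F : forall q, Cmod q < 1 ->
      f q = (c O + q * CSeries (cpow_series (fun n => c (S n)) q))%C).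
    { intros q Hq. destruct (Hc q Hq) as [A ->]. rewrite CSeries_incr by trivial.
      f_equal; [unfold cpow_series; ring|].
      rewrite <- CSeries_scal by auto. apply CSeries_ext; intros n; unfold cpow_series; simpl; ring. }
    intros q Hq. rewrite F at 1 by trivial. f_equal.
    rewrite F by (rewrite Cmod_0; lra). ring.
Qed.

Lemma analytic_bounded f : analytic f -> exists M, forall q, Cmod q <= 1 / 2 -> Cmod (f q) <= M.
Proof.
  intros [c Hc].
  set (b := fun n => Cmod (cpow_series c (RtoC (1 / 2)) n)).
  exists (2 * Series b); intros q Hq.
  destruct (Hc q) as [A ->]; [lra|].
  destruct (Hc (RtoC (1 / 2))) as [B _]; [rewrite Cmod_R, Rabs_pos_eq; lra|].
  assert (L : forall n, Cmod (cpow_series c q n) <= b n).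
  { intros n; unfold b; rewrite !Cmod_cpow_series, Cmod_R, (Rabs_pos_eq (1 / 2)) by lra.
    apply Rmult_le_compat_l; [apply Rabs_pos|]. apply pow_incr; split; trivial; apply Cmod_ge_0. }
  assert (K : forall u : nat -> R, (forall n, Rabs (u n) <= Cmod (cpow_series c q n)) ->
            ex_series (fun n => Rabs (u n)) -> Rabs (Series u) <= Series b).
  { intros u Hu Hs. eapply Rle_trans; [apply Series_Rabs; trivial|].
    apply Series_le; trivial. intros n; split; [apply Rabs_pos|].
    eapply Rle_trans; [apply Hu|apply L]. }
  unfold CSeries.
  pose proof (K _ (fun n => Re_le_Cmod _) (abs_summable_Re _ A)) as K1.
  pose proof (K _ (fun n => Im_le_Cmod _) (abs_summable_Im _ A)) as K2.
  match goal with |- Cmod (?x, ?y) <= _ =>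
    pose proof (Cmod_triangle (RtoC x) (Ci * RtoC y)%C) as T;
    replace (RtoC x + Ci * RtoC y)%C with (x, y) in T by (apply injective_projections; simpl; ring)
  end.
  rewrite Cmod_mult, Cmod_Ci, !Cmod_R, Rmult_1_l in T. lra.
Qed.

Lemma thetaZ_0 e : e 0%Z = 0%Z -> (forall n, n <> 0 -> 0 < e n)%Z -> thetaZ e 0%R = 1%R.
Proof.
  intros E0 E1. unfold thetaZ, CSeries_Z.
  assert (Z0 : forall n, (n <> 0)%Z -> (RtoC 0 ^ Z.to_nat (e n))%C = 0%R).
  { intros n Hn. specialize (E1 n Hn).
    replace (Z.to_nat (e n)) with (S (Z.to_nat (e n - 1))) by lia. rewrite Cpow_S; ring. }
  unfold CSeries.
  rewrite !(Series_finite _ 1) by (intros; rewrite Z0 by lia; reflexivity).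
  cbn [psum]. rewrite (Z0 (- Z.of_nat 1)%Z) by lia. change (Z.of_nat 0) with 0%Z. rewrite E0.
  apply injective_projections; simpl; ring.
Qed.

Lemma phi_0 : theta_phi 0%R = 1%R.
Proof. apply (thetaZ_0 e_phi); unfold e_phi; intros; nia. Qed.

Lemma psi_0 : theta_psi 0%R = 1%R.
Proof. rewrite theta_psi_thetaZ; apply (thetaZ_0 e_psi); unfold e_psi; intros; nia. Qed.

Lemma phi_neq0_near_0 : exists d, 0 < d /\ forall q, Cmod q < d -> theta_phi q <> 0%R.
Proof.
  destruct (analytic_shift _ analytic_phi) as (g & Hg & E).
  destruct (analytic_bounded g Hg) as [M HM].
  pose proof (Rmax_l M 1) as M1. pose proof (Rmax_r M 1) as M2.
  set (N := Rmax M 1) in *.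
  exists (/ (2 * N)). assert (P : 0 < / (2 * N)) by (apply Rinv_0_lt_compat; lra).
  assert (P2 : / (2 * N) <= / 2) by (apply Rinv_le_contravar; lra).
  split; trivial. intros q Hq H0.
  rewrite E, phi_0 in H0 by lra.
  assert (B : Cmod (q * g q) < 1).
  { rewrite Cmod_mult. specialize (HM q ltac:(lra)).
    pose proof (Cmod_ge_0 q). pose proof (Cmod_ge_0 (g q)).
    assert (Cmod q * (2 * N) < 1).
    { apply Rmult_lt_reg_r with (/ (2 * N)); trivial. rewrite Rmult_assoc, Rinv_r by lra; lra. }
    nra. }
  replace (q * g q)%C with (RtoC (-1)) in B.
  - rewrite Cmod_R, Rabs_left in B; lra.
  - replace (q * g q)%C with ((1%R + q * g q) - 1%R)%C by ring. rewrite H0.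
    apply injective_projections; simpl; ring.
Qed.

(** A zero at q propagates through phi(q) phi(-q) = phi(-q^2)^2 to -q^2, and so
    on to points tending to 0, where phi is near 1. *)
Lemma phi_neq0 q : Cmod q < 1 -> theta_phi q <> 0%R.
Proof.
  intros Hq H0.
  destruct phi_neq0_near_0 as (d & Hd & HN).
  assert (Z : forall n, exists q', theta_phi q' = 0%R /\ Cmod q' <= Cmod q ^ S n).
  { induction n as [|n (q' & E & L)].
    - exists q; split; trivial; simpl; lra.
    - exists (- q' ^ 2)%C.
      pose proof (Cmod_ge_0 q') as N'. pose proof (Cmod_ge_0 q) as N0.
      assert (C1 : Cmod q ^ S n <= Cmod q ^ 1) by (apply pow_decreasing; [lra|lia]).
      rewrite pow_1 in C1. split.
      + pose proof (phi_mul_phi_opp q' ltac:(lra)) as F. rewrite E, Cmult_0_l in F.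
        destruct (Ceq_dec (theta_phi (- q' ^ 2)%C) 0%R) as [->|NZ]; trivial.
        exfalso; apply (Cpow_nz _ 2 NZ); now symmetry.
      + rewrite Cmod_opp, Cmod_pow. simpl in *. nra. }
  destruct (pow_lt_1_zero (Cmod q)) with (y := d) as [n Hn]; trivial.
  { rewrite Rabs_pos_eq; trivial; apply Cmod_ge_0. }
  destruct (Z n) as (q' & E & L). apply (HN q'); trivial.
  specialize (Hn (S n) ltac:(lia)). rewrite Rabs_pos_eq in Hn by (apply pow_le, Cmod_ge_0). lra.
Qed.

(** * The hypergeometric equation *)

Definition ell_coef (n : nat) : R :=
  rising_factorial (1/2) n * rising_factorial (1/2) n / (rising_factorial 1 n * INR (fact n)).

Lemma ell_z_PSeries x : ell_z x = PSeries ell_coef x.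
Proof. reflexivity. Qed.

Lemma rising_factorial_1 n : rising_factorial 1 n = INR (fact n).
Proof.
  induction n as [|n IH]; [reflexivity|].
  change (rising_factorial 1 n * (1 + INR n) = INR (fact (S n))).
  rewrite IH, fact_simpl, mult_INR, S_INR; ring.
Qed.

Lemma ell_coef_0 : ell_coef 0 = 1.
Proof. unfold ell_coef; simpl; field. Qed.

Lemma ell_coef_S n : ell_coef (S n) = ell_coef n * ((INR n + 1/2) / (INR n + 1)) ^ 2.
Proof.
  unfold ell_coef; rewrite !rising_factorial_1, fact_simpl, mult_INR, S_INR.
  pose proof (INR_fact_neq_0 n). pose proof (pos_INR n).
  simpl rising_factorial; field; split; trivial; lra.
Qed.

Lemma ell_coef_bounds n : 0 < ell_coef n <= 1.
Proof.
  induction n as [|n IH]; [rewrite ell_coef_0; lra|].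
  rewrite ell_coef_S. pose proof (pos_INR n).
  assert (H1 : 0 < (INR n + 1/2) / (INR n + 1) < 1).
  { split; [apply Rdiv_lt_0_compat; lra|]. apply Rlt_div_l; lra. }
  set (t := (INR n + 1/2) / (INR n + 1)) in *.
  assert (H2 : 0 < t ^ 2 < 1) by (simpl; nra). nra.
Qed.

Lemma CV_radius_bounded_coef a M x :
  (forall n, Rabs (a n) <= M) -> Rabs x < 1 -> Rbar_lt (Rabs x) (CV_radius a).
Proof.
  intros Ha Hx. apply Rbar_lt_le_trans with 1; [exact Hx|].
  apply (proj1 (CV_radius_bounded a)); exists M; intros n.
  now rewrite pow1, Rmult_1_r.
Qed.

Lemma ell_CV x : Rabs x < 1 -> Rbar_lt (Rabs x) (CV_radius ell_coef).
Proof.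
  apply CV_radius_bounded_coef with 1; intros n.
  pose proof (ell_coef_bounds n); rewrite Rabs_pos_eq; lra.
Qed.

Lemma ex_pseries_R_abs a x : Rbar_lt (Rabs x) (CV_radius a) -> ex_series (fun n => a n * x ^ n).
Proof. intros H; apply ex_pseries_R, CV_radius_inside, H. Qed.

Lemma PSeries_mono a x x' :
  (forall n, 0 <= a n) -> 0 <= x <= x' -> Rbar_lt (Rabs x') (CV_radius a) ->
  PSeries a x <= PSeries a x'.
Proof.
  intros Ha Hx HR. apply Series_le; [|now apply ex_pseries_R_abs].
  intros n; split; [apply Rmult_le_pos; trivial; apply pow_le; lra|].
  apply Rmult_le_compat_l; trivial; apply pow_incr; lra.
Qed.

Lemma PSeries_ge_0th a x :
  (forall n, 0 <= a n) -> 0 <= x -> Rbar_lt (Rabs x) (CV_radius a) -> a O <= PSeries a x.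
Proof.
  intros Ha Hx HR. rewrite <- (PSeries_0 a). apply PSeries_mono; trivial; lra.
Qed.

Definition ell_z' (x : R) : R := PSeries (PS_derive ell_coef) x.
Definition ell_z'' (x : R) : R := PSeries (PS_derive (PS_derive ell_coef)) x.

Lemma is_derive_ell_z x : Rabs x < 1 -> is_derive ell_z x (ell_z' x).
Proof. intros Hx; apply is_derive_PSeries, ell_CV, Hx. Qed.

Lemma ell_CV' x : Rabs x < 1 -> Rbar_lt (Rabs x) (CV_radius (PS_derive ell_coef)).
Proof. intros; rewrite CV_radius_derive; now apply ell_CV. Qed.

Lemma ell_CV'' x : Rabs x < 1 -> Rbar_lt (Rabs x) (CV_radius (PS_derive (PS_derive ell_coef))).
Proof. intros; rewrite CV_radius_derive; now apply ell_CV'. Qed.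

Lemma is_derive_ell_z' x : Rabs x < 1 -> is_derive ell_z' x (ell_z'' x).
Proof. intros Hx; apply is_derive_PSeries, ell_CV', Hx. Qed.

(** Coefficientwise this is the recurrence
    (n+1)^2 c_(n+1) = (n+1/2)^2 c_n. *)
Lemma ell_z_ode x : Rabs x < 1 ->
  x * (1 - x) * ell_z'' x + (1 - 2 * x) * ell_z' x = ell_z x / 4.
Proof.
  intros Hx.
  set (c1 := PS_derive ell_coef). set (c2 := PS_derive c1).
  assert (X0 : ex_pseries ell_coef x) by (apply CV_radius_inside; now apply ell_CV).
  assert (X1 : ex_pseries c1 x) by (apply CV_radius_inside; now apply ell_CV').
  assert (X2 : ex_pseries c2 x) by (apply CV_radius_inside; now apply ell_CV'').
  assert (E : x * PSeries c2 x + PSeries c1 x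
     = / 4 * PSeries ell_coef x + (x * (x * PSeries c2 x) + 2 * (x * PSeries c1 x))).
  { rewrite <- !PSeries_incr_1, <- !PSeries_scal.
    assert (Y1 := ex_pseries_incr_1 _ _ X1). assert (Y2 := ex_pseries_incr_1 _ _ X2).
    assert (Y2' := ex_pseries_incr_1 _ _ Y2).
    assert (Y1' := ex_pseries_scal 2 _ x (Rmult_comm _ _) Y1).
    assert (Y0 := ex_pseries_scal (/ 4) _ x (Rmult_comm _ _) X0).
    rewrite <- (PSeries_plus _ _ x Y2 X1), <- (PSeries_plus _ _ x Y2' Y1'),
      <- (PSeries_plus _ _ x Y0 (ex_pseries_plus _ _ x Y2' Y1')).
    apply PSeries_ext; intros n.
    destruct n as [|[|n]]; unfold PS_plus, PS_scal, PS_incr_1, c2, c1, PS_derive;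
      change plus with Rplus; change scal with Rmult; change zero with 0;
      rewrite ?ell_coef_S, ?S_INR; change (INR 0) with 0; [field..|].
    pose proof (pos_INR n). field; lra. }
  change (ell_z'' x) with (PSeries c2 x). change (ell_z' x) with (PSeries c1 x).
  rewrite ell_z_PSeries; lra.
Qed.

(** * Wronskian, period ratio and Landen's transformation *)

Lemma is_derive_eq (f : R -> R) (x a b : R) : is_derive f x a -> a = b -> is_derive f x b.
Proof. now intros H <-. Qed.

(** The rules are restated on R so that applying them leaves no algebraic
    structure to unification. *)
Lemma is_derive_Rplus (f g : R -> R) (x a b : R) :
  is_derive f x a -> is_derive g x b -> is_derive (fun t => f t + g t) x (a + b).
Proof. exact (is_derive_plus f g x a b). Qed.

Lemma is_derive_Rminus (f g : R -> R) (x a b : R) :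
  is_derive f x a -> is_derive g x b -> is_derive (fun t => f t - g t) x (a - b).
Proof. exact (is_derive_minus f g x a b). Qed.

Lemma is_derive_Rmult (f g : R -> R) (x a b : R) :
  is_derive f x a -> is_derive g x b -> is_derive (fun t => f t * g t) x (a * g x + f x * b).
Proof. intros Hf Hg; exact (is_derive_mult f g x a b Hf Hg Rmult_comm). Qed.

Lemma is_derive_Rcomp (f g : R -> R) (x a b : R) :
  is_derive f (g x) a -> is_derive g x b -> is_derive (fun t => f (g t)) x (b * a).
Proof. exact (is_derive_comp f g x a b). Qed.

Lemma is_derive_Rconst (c x : R) : is_derive (fun _ : R => c) x 0.
Proof. exact (is_derive_const c x). Qed.

(** The hypergeometric equation in self-adjoint form says that the derivative
    of this flux is F/4, for F(x) and for F(1-x) alike. *)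
Definition ell_flux (x : R) : R := x * (1 - x) * ell_z' x.

Lemma is_derive_ell_flux x : Rabs x < 1 -> is_derive ell_flux x (ell_z x / 4).
Proof.
  intros Hx. rewrite <- ell_z_ode by trivial.
  eapply is_derive_eq.
  - apply (is_derive_Rmult (fun x => x * (1 - x)) ell_z' x (1 - 2 * x) (ell_z'' x)).
    + auto_derive; trivial; ring.
    + now apply is_derive_ell_z'.
  - ring.
Qed.

Lemma ell_z_ge1 x : 0 <= x < 1 -> 1 <= ell_z x.
Proof.
  intros Hx; rewrite <- ell_coef_0. apply PSeries_ge_0th; try lra.
  - intros n; pose proof (ell_coef_bounds n); lra.
  - apply ell_CV; rewrite Rabs_pos_eq; lra.
Qed.

Lemma ell_z'_pos x : 0 <= x < 1 -> 0 < ell_z' x.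
Proof.
  intros Hx. assert (H0 : 0 < PS_derive ell_coef 0).
  { unfold PS_derive; simpl INR; pose proof (ell_coef_bounds 1); lra. }
  eapply Rlt_le_trans; [exact H0|]. apply PSeries_ge_0th; try lra.
  - intros n; unfold PS_derive; pose proof (ell_coef_bounds (S n)); pose proof (pos_INR (S n)).
    apply Rmult_le_pos; lra.
  - apply ell_CV'; rewrite Rabs_pos_eq; lra.
Qed.

Lemma ell_z_0 : ell_z 0 = 1.
Proof. rewrite ell_z_PSeries, PSeries_0; apply ell_coef_0. Qed.

Lemma ell_z'_0 : ell_z' 0 = 1 / 4.
Proof.
  unfold ell_z'; rewrite PSeries_0; unfold PS_derive.
  rewrite ell_coef_S, ell_coef_0; simpl; field.
Qed.

Lemma is_derive_ell_z_compl x : Rabs (1 - x) < 1 -> is_derive (fun x => ell_z (1 - x)) x (- ell_z' (1 - x)).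
Proof.
  intros Hx. eapply is_derive_eq.
  - apply (is_derive_Rcomp ell_z (fun x => 1 - x) x (ell_z' (1 - x)) (-1)).
    + now apply is_derive_ell_z.
    + auto_derive; trivial; ring.
  - ring.
Qed.

Lemma is_derive_ell_flux_compl x : Rabs (1 - x) < 1 ->
  is_derive (fun x => ell_flux (1 - x)) x (- (ell_z (1 - x) / 4)).
Proof.
  intros Hx. eapply is_derive_eq.
  - apply (is_derive_Rcomp ell_flux (fun x => 1 - x) x (ell_z (1 - x) / 4) (-1)).
    + now apply is_derive_ell_flux.
    + auto_derive; trivial; ring.
  - field.
Qed.

Lemma Rabs_unit_both x : 0 < x < 1 -> Rabs x < 1 /\ Rabs (1 - x) < 1.
Proof. intros Hx; split; rewrite Rabs_pos_eq; lra. Qed.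

Definition wronskian (x : R) : R := ell_z x * ell_flux (1 - x) + ell_flux x * ell_z (1 - x).

Lemma is_derive_wronskian x : 0 < x < 1 -> is_derive wronskian x 0.
Proof.
  intros Hx; destruct (Rabs_unit_both x Hx) as [X Y].
  eapply is_derive_eq.
  - apply (is_derive_Rplus (fun x => ell_z x * ell_flux (1 - x)) (fun x => ell_flux x * ell_z (1 - x))).
    + apply (is_derive_Rmult ell_z (fun x => ell_flux (1 - x)) x _ _ (is_derive_ell_z x X)
        (is_derive_ell_flux_compl x Y)).
    + apply (is_derive_Rmult ell_flux (fun x => ell_z (1 - x)) x _ _ (is_derive_ell_flux x X)
        (is_derive_ell_z_compl x Y)).
  - unfold ell_flux; field.
Qed.

(** By Legendre's relation this constant is 1/PI, so that
    exp(- period_ratio / legendre_const) is the classical nome. *)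
Definition legendre_const : R := wronskian (1/2).

Lemma wronskian_const x : 0 < x < 1 -> wronskian x = legendre_const.
Proof.
  intros Hx; unfold legendre_const.
  destruct (Rtotal_order x (1/2)) as [H|[->|H]]; trivial.
  - apply (eq_is_derive wronskian); trivial; intros t Ht; apply is_derive_wronskian; lra.
  - symmetry; apply (eq_is_derive wronskian); trivial; intros t Ht; apply is_derive_wronskian; lra.
Qed.

Lemma ell_flux_pos x : 0 < x < 1 -> 0 < ell_flux x.
Proof.
  intros Hx; unfold ell_flux. pose proof (ell_z'_pos x ltac:(lra)).
  repeat apply Rmult_lt_0_compat; lra.
Qed.

Lemma legendre_const_pos : 0 < legendre_const.
Proof.
  unfold legendre_const, wronskian.
  pose proof (ell_flux_pos (1/2) ltac:(lra)). pose proof (ell_flux_pos (1 - 1/2) ltac:(lra)).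
  pose proof (ell_z_ge1 (1/2) ltac:(lra)). pose proof (ell_z_ge1 (1 - 1/2) ltac:(lra)).
  nra.
Qed.

(** K'/K in the notation of elliptic integrals. *)
Definition period_ratio (x : R) : R := ell_z (1 - x) / ell_z x.

Lemma is_derive_period_ratio x : 0 < x < 1 ->
  is_derive period_ratio x (- (legendre_const / (x * (1 - x) * ell_z x ^ 2))).
Proof.
  intros Hx; destruct (Rabs_unit_both x Hx) as [X Y].
  pose proof (ell_z_ge1 x ltac:(lra)) as Z1.
  eapply is_derive_eq.
  - apply (is_derive_div (fun x => ell_z (1 - x)) ell_z x _ _
      (is_derive_ell_z_compl x Y) (is_derive_ell_z x X)). lra.
  - rewrite <- (wronskian_const x Hx). unfold wronskian, ell_flux. field. lra.
Qed.

Lemma period_ratio_pos x : 0 < x < 1 -> 0 < period_ratio x.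
Proof.
  intros Hx. pose proof (ell_z_ge1 x ltac:(lra)). pose proof (ell_z_ge1 (1 - x) ltac:(lra)).
  apply Rdiv_lt_0_compat; lra.
Qed.

Lemma period_ratio_decr x x' : 0 < x < 1 -> 0 < x' < 1 -> x < x' -> period_ratio x' < period_ratio x.
Proof.
  intros Hx Hx' H.
  destruct (MVT_gen period_ratio x x' (fun x => - (legendre_const / (x * (1 - x) * ell_z x ^ 2)))) as (c & Hc & E).
  - rewrite Rmin_left, Rmax_right by lra. intros t Ht; apply is_derive_period_ratio; lra.
  - rewrite Rmin_left, Rmax_right by lra. intros t Ht.
    apply continuity_pt_filterlim, (ex_derive_continuous period_ratio).
    eexists; apply is_derive_period_ratio; lra.
  - rewrite Rmin_left, Rmax_right in Hc by lra.
    pose proof (ell_z_ge1 c ltac:(lra)). pose proof legendre_const_pos.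
    assert (0 < legendre_const / (c * (1 - c) * ell_z c ^ 2)).
    { apply Rdiv_lt_0_compat; trivial. repeat apply Rmult_lt_0_compat; lra. }
    nra.
Qed.

Lemma period_ratio_inj x x' : 0 < x < 1 -> 0 < x' < 1 -> period_ratio x = period_ratio x' -> x = x'.
Proof.
  intros Hx Hx' E. destruct (Rtotal_order x x') as [H|[H|H]]; trivial;
    apply period_ratio_decr in H; trivial; lra.
Qed.

(** The derivative of K'/K + c log x is c/x times 1 - 1/((1-x) F(x)^2), and the
    last factor is O(x) because F(0) = 1. *)
Lemma period_ratio_log : exists B, forall x, 0 < x <= 1 / 2 ->
  Rabs (period_ratio x + legendre_const * ln x) <= B.
Proof.
  set (G := PSeries (PS_decr_1 ell_coef)).
  assert (G0 : forall n, 0 <= PS_decr_1 ell_coef n).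
  { intros n; unfold PS_decr_1; pose proof (ell_coef_bounds (S n)); lra. }
  assert (GC : forall x, Rabs x < 1 -> Rbar_lt (Rabs x) (CV_radius (PS_decr_1 ell_coef))).
  { intros; rewrite CV_radius_decr_1; now apply ell_CV. }
  assert (EG : forall x, Rabs x < 1 -> ell_z x = 1 + x * G x).
  { intros x Hx; rewrite ell_z_PSeries, PSeries_decr_1 by (now apply CV_radius_inside, ell_CV).
    now rewrite ell_coef_0. }
  set (g1 := G (1/2)). 
  assert (GB : forall x, 0 <= x <= 1/2 -> 0 <= G x <= g1).
  { intros x Hx; split.
    - apply Rle_trans with (PS_decr_1 ell_coef 0); [apply G0|].
      apply PSeries_ge_0th; trivial; try lra. apply GC; rewrite Rabs_pos_eq; lra.
    - apply PSeries_mono; trivial. apply GC; rewrite Rabs_pos_eq; lra. }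
  pose proof legendre_const_pos as W0.
  set (M := g1 * (2 + g1) + 1).
  set (h := fun x => period_ratio x + legendre_const * ln x).
  set (h' := fun x => - (legendre_const / (x * (1 - x) * ell_z x ^ 2)) + legendre_const / x).
  assert (D : forall x, 0 < x < 1 -> is_derive h x (h' x)).
  { intros x Hx. apply (is_derive_Rplus period_ratio (fun x => legendre_const * ln x)).
    - now apply is_derive_period_ratio.
    - auto_derive; [lra|]. unfold Rdiv; ring. }
  assert (HB : forall x, 0 < x <= 1/2 -> Rabs (h' x) <= legendre_const * (2 * M)).
  { intros x Hx. pose proof (GB x ltac:(lra)) as B.
    pose proof (EG x ltac:(rewrite Rabs_pos_eq; lra)) as E.
    set (z := ell_z x) in *.
    assert (Z1 : 1 <= z) by (apply ell_z_ge1; lra).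
    assert (K1 : 1/2 <= (1 - x) * z ^ 2) by nra.
    assert (K2 : - x <= (1 - x) * z ^ 2 - 1 <= x * (M - 1)).
    { assert (Z2 : 1 <= z ^ 2 <= 1 + x * (M - 1)).
      { split; [nra|]. rewrite E. unfold M.
        assert (x * G x <= g1) by nra. assert (x * G x * (x * G x) <= x * (g1 * g1)).
        { assert (0 <= x * G x) by nra.
          assert (x * G x <= x * g1) by nra.
          assert (x * G x * (x * G x) <= (x * g1) * g1) by (apply Rmult_le_compat; nra). lra. }
        nra. }
      split; nra. }
    replace (h' x) with (legendre_const * (((1 - x) * z ^ 2 - 1) / x / ((1 - x) * z ^ 2)))
      by (unfold h'; fold z; field; split; lra).
    rewrite Rabs_mult, (Rabs_pos_eq legendre_const) by lra.
    apply Rmult_le_compat_l; [lra|].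
    assert (M1 : 1 <= M) by (unfold M; nra).
    set (k := (1 - x) * z ^ 2) in *.
    rewrite !Rabs_div by lra. rewrite (Rabs_pos_eq k), (Rabs_pos_eq x) by lra.
    assert (A : Rabs (k - 1) <= x * M) by (apply Rabs_le; nra).
    apply Rle_div_l; [lra|]. apply Rle_div_l; [lra|]. nra. }
  exists (Rabs (h (1/2)) + legendre_const * (2 * M)).
  intros x Hx. fold (h x).
  destruct (Req_dec x (1/2)) as [->|Hne].
  { specialize (HB (1/2) ltac:(lra)). pose proof (Rabs_pos (h' (1/2))). lra. }
  destruct (MVT_gen h x (1/2) h') as (c & Hc & E).
  - rewrite Rmin_left, Rmax_right by lra. intros t Ht; apply D; lra.
  - rewrite Rmin_left, Rmax_right by lra. intros t Ht.
    apply continuity_pt_filterlim, (ex_derive_continuous h). eexists; apply D; lra.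
  - rewrite Rmin_left, Rmax_right in Hc by lra.
    replace (h x) with (h (1/2) - h' c * (1/2 - x)) by lra.
    eapply Rle_trans; [apply Rabs_triang|]. rewrite Rabs_Ropp, Rabs_mult.
    rewrite (Rabs_pos_eq (1/2 - x)) by lra.
    specialize (HB c ltac:(lra)). pose proof (Rabs_pos (h' c)). nra.
Qed.

(** With p = x (1 - x^2), the functions H = F(4x/(1+x)^2)/(1+x) and K = F(x^2)
    both solve (p y')' = x y and are regular at 0.  So p (H K' - K H') is
    constant, it vanishes at 0, and H/K is constant with value 1 at 0. *)
Lemma landen x : 0 <= x < 1 -> ell_z (4 * x / (1 + x) ^ 2) = (1 + x) * ell_z (x ^ 2).
Proof.
  intros Hx.
  set (t := fun x => 4 * x / (1 + x) ^ 2).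
  assert (Ht : forall x, 0 <= x < 1 -> 0 <= t x < 1).
  { intros y Hy; unfold t; split.
    - apply Rmult_le_pos; [lra|]. apply Rlt_le, Rinv_0_lt_compat; nra.
    - apply Rlt_div_l; nra. }
  assert (Dt : forall x, 0 <= x < 1 -> is_derive t x (4 * (1 - x) / (1 + x) ^ 3)).
  { intros y Hy; unfold t; auto_derive; [repeat split; nra|]. field; lra. }
  assert (AT : forall x, 0 <= x < 1 -> Rabs (t x) < 1).
  { intros y Hy; specialize (Ht y Hy); rewrite Rabs_pos_eq; lra. }
  assert (A2 : forall x, 0 <= x < 1 -> Rabs (x ^ 2) < 1).
  { intros y Hy; rewrite Rabs_pos_eq; nra. }
  assert (DF : forall x, 0 <= x < 1 -> is_derive (fun x => ell_z (t x)) x (4 * (1 - x) / (1 + x) ^ 3 * ell_z' (t x))).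
  { intros y Hy. apply (is_derive_Rcomp ell_z t); auto. apply is_derive_ell_z; auto. }
  assert (DE : forall x, 0 <= x < 1 -> is_derive (fun x => ell_flux (t x)) x (4 * (1 - x) / (1 + x) ^ 3 * (ell_z (t x) / 4))).
  { intros y Hy. apply (is_derive_Rcomp ell_flux t); auto. apply is_derive_ell_flux; auto. }
  assert (DK : forall x, 0 <= x < 1 -> is_derive (fun x => ell_z (x ^ 2)) x (2 * x * ell_z' (x ^ 2))).
  { intros y Hy. apply (is_derive_Rcomp ell_z (fun x => x ^ 2)).
    - apply is_derive_ell_z; auto.
    - auto_derive; trivial; ring. }
  assert (DB : forall x, 0 <= x < 1 -> is_derive (fun x => ell_flux (x ^ 2)) x (2 * x * (ell_z (x ^ 2) / 4))).
  { intros y Hy. apply (is_derive_Rcomp ell_flux (fun x => x ^ 2)).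
    - apply is_derive_ell_flux; auto.
    - auto_derive; trivial; ring. }
  set (K := fun x => ell_z (x ^ 2)).
  set (K' := fun x => 2 * x * ell_z' (x ^ 2)).
  set (H := fun x => ell_z (t x) * / (1 + x)).
  set (H' := fun x => 4 * (1 - x) / (1 + x) ^ 4 * ell_z' (t x) - ell_z (t x) / (1 + x) ^ 2).
  assert (DH : forall x, 0 <= x < 1 -> is_derive H x (H' x)).
  { intros y Hy. eapply is_derive_eq.
    - apply (is_derive_Rmult (fun x => ell_z (t x)) (fun x => / (1 + x)) y _ (- / (1 + y) ^ 2) (DF y Hy)).
      auto_derive; [lra|]. field; lra.
    - unfold H'; field; lra. }
  (* p K' and p H' for p = x (1 - x^2), written without division by x *)
  set (B := fun x => 2 * ell_flux (x ^ 2)).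
  set (A := fun x => (1 + x) * ell_flux (t x) - x * (1 - x) / (1 + x) * ell_z (t x)).
  assert (EB : forall x, B x = x * (1 - x ^ 2) * K' x).
  { intros y; unfold B, K', ell_flux; ring. }
  assert (EA : forall x, 0 <= x < 1 -> A x = x * (1 - x ^ 2) * H' x).
  { intros y Hy; unfold A, H', ell_flux.
    assert (E : t y * (1 - t y) = 4 * y * (1 - y) ^ 2 / (1 + y) ^ 4) by (unfold t; field; lra).
    rewrite E; field; lra. }
  assert (DB' : forall x, 0 <= x < 1 -> is_derive B x (x * K x)).
  { intros y Hy. eapply is_derive_eq.
    - apply (is_derive_Rmult (fun _ => 2) (fun x => ell_flux (x ^ 2)) y 0 _ (is_derive_const 2 y) (DB y Hy)).
    - unfold K; field. }
  assert (DA : forall x, 0 <= x < 1 -> is_derive A x (x * H x)).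
  { intros y Hy. eapply is_derive_eq.
    - apply (is_derive_Rminus (fun x => (1 + x) * ell_flux (t x)) (fun x => x * (1 - x) / (1 + x) * ell_z (t x))).
      + refine (is_derive_Rmult (fun x => 1 + x) (fun x => ell_flux (t x)) y 1 _ _ (DE y Hy)).
        auto_derive; trivial; ring.
      + refine (is_derive_Rmult (fun x => x * (1 - x) / (1 + x)) (fun x => ell_z (t x)) y
          ((1 - 2 * y - y ^ 2) / (1 + y) ^ 2) _ _ (DF y Hy)).
        auto_derive; [lra|]. field; lra.
    - unfold H, ell_flux.
      assert (E : t y * (1 - t y) = 4 * y * (1 - y) ^ 2 / (1 + y) ^ 4) by (unfold t; field; lra).
      rewrite E; field; lra. }
  set (V := fun x => H x * B x - K x * A x).
  assert (DV : forall x, 0 <= x < 1 -> is_derive V x 0).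
  { intros y Hy. eapply is_derive_eq.
    - apply (is_derive_Rminus (fun x => H x * B x) (fun x => K x * A x)).
      + apply (is_derive_Rmult H B _ _ _ (DH y Hy) (DB' y Hy)).
      + apply (is_derive_Rmult K A _ _ _ (DK y Hy) (DA y Hy)).
    - rewrite EB, (EA y Hy). unfold K'; ring. }
  assert (V0 : forall x, 0 <= x < 1 -> H x * B x = K x * A x).
  { intros y Hy. enough (E : V y = 0) by (unfold V in E; lra).
    transitivity (V 0).
    - destruct (Req_dec 0 y) as [<-|Hne]; trivial.
      symmetry; apply (eq_is_derive V 0 y); [|lra]. intros u Hu; apply DV; lra.
    - unfold V; rewrite EB, EA by lra; ring. }
  assert (Kpos : forall x, 0 <= x < 1 -> 1 <= K x).
  { intros y Hy; apply ell_z_ge1; nra. }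
  assert (HK : forall x, 0 <= x < 1 -> H' x * K x = H x * K' x).
  { intros y Hy. destruct (Req_dec y 0) as [->|Hne].
    - unfold H', K', H, K, t. replace (4 * 0 / (1 + 0) ^ 2) with 0 by field.
      rewrite ell_z'_0, ell_z_0; field.
    - pose proof (V0 y Hy) as E. rewrite EB, (EA y Hy) in E.
      apply Rmult_eq_reg_l with (y * (1 - y ^ 2)); [lra|].
      apply Rmult_integral_contrapositive_currified; nra. }
  assert (Q : H x / K x = H 0 / K 0).
  { destruct (Req_dec 0 x) as [<-|Hne]; trivial.
    symmetry; apply (eq_is_derive (fun x => H x / K x) 0 x); [|lra].
    intros u Hu. assert (Hu' : 0 <= u < 1) by lra. specialize (Kpos u Hu').
    eapply is_derive_eq.
    - apply (is_derive_div H K u _ _ (DH u Hu') (DK u Hu')); lra.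
    - fold (K' u). rewrite (HK u Hu'); unfold zero; simpl; field; lra. }
  assert (HK0 : H 0 / K 0 = 1).
  { unfold H, K, t. replace (4 * 0 / (1 + 0) ^ 2) with 0 by field. replace (0 ^ 2) with 0 by ring.
    rewrite ell_z_0; field. }
  rewrite HK0 in Q. specialize (Kpos x Hx).
  assert (E : H x = K x) by (apply Rmult_eq_reg_r with (/ K x); [|apply Rinv_neq_0_compat; lra];
    rewrite Rinv_r by lra; exact Q).
  unfold H, K in E. fold (t x). rewrite <- E; field; lra.
Qed.

(** * Theta functions uniformize the hypergeometric function *)

Lemma Cmod_R_lt_1 x : Rabs x < 1 -> Cmod (RtoC x) < 1.
Proof. now rewrite Cmod_R. Qed.

Ltac of_complex H :=
  rewrite <- ?RtoC_pow, <- ?RtoC_opp in H;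
  rewrite ?phi_RtoC, ?psi_RtoC in H
    by (rewrite ?Rabs_Ropp; first [assumption | apply Rabs_pow_lt; [assumption|lia]]);
  rewrite <- ?RtoC_pow, <- ?RtoC_mult, <- ?RtoC_plus, <- ?RtoC_minus, <- ?RtoC_mult,
    <- ?RtoC_minus, <- ?RtoC_plus, <- ?RtoC_mult, <- ?RtoC_pow, <- ?RtoC_mult in H;
  apply RtoC_inj in H.

Lemma rphi_sq x : Rabs x < 1 -> rphi x ^ 2 = rphi (x ^ 2) ^ 2 + 4 * x * rpsi (x ^ 4) ^ 2.
Proof. intros Hx; pose proof (phi_sq x (Cmod_R_lt_1 x Hx)) as H; of_complex H; exact H. Qed.

Lemma rpsi_sq x : Rabs x < 1 -> rpsi x ^ 2 = rphi x * rpsi (x ^ 2).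
Proof. intros Hx; pose proof (psi_sq x (Cmod_R_lt_1 x Hx)) as H; of_complex H; exact H. Qed.

Lemma rphi_mul_opp x : Rabs x < 1 -> rphi x * rphi (- x) = rphi (- x ^ 2) ^ 2.
Proof. intros Hx; pose proof (phi_mul_phi_opp x (Cmod_R_lt_1 x Hx)) as H; of_complex H; exact H. Qed.

Lemma rphi_neq0 x : Rabs x < 1 -> rphi x <> 0.
Proof.
  intros Hx E. apply (phi_neq0 x (Cmod_R_lt_1 x Hx)). now rewrite phi_RtoC, E.
Qed.

Lemma rschroter15 x : Rabs x < 1 ->
  rphi (x ^ 6) * rphi (x ^ 10) - rphi (- x ^ 6) * rphi (- x ^ 10)
   + 4 * x ^ 4 * rpsi (x ^ 12) * rpsi (x ^ 20)
   = 2 * x * (rpsi (x ^ 3) * rpsi (x ^ 5) - rpsi (- x ^ 3) * rpsi (- x ^ 5)).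
Proof. intros Hx; pose proof (schroter15 x (Cmod_R_lt_1 x Hx)) as H; of_complex H; exact H. Qed.

Lemma rphi_0 : rphi 0 = 1.
Proof. apply RtoC_inj; rewrite <- phi_RtoC; [apply phi_0|rewrite Rabs_R0; lra]. Qed.

Lemma rpsi_0 : rpsi 0 = 1.
Proof. apply RtoC_inj; rewrite <- psi_RtoC; [apply psi_0|rewrite Rabs_R0; lra]. Qed.

Lemma has_sum_powerRZ_ge1 (e : Z -> Z) x s : e 0%Z = 0%Z ->
  has_sum (fun n => powerRZ x (e n)) s -> 1 <= s.
Proof.
  intros E H. replace 1 with (lsum (fun n => powerRZ x (e n)) [0%Z]).
  - apply has_sum_ub; trivial. repeat constructor; easy.
  - simpl; rewrite E; simpl; ring.
Qed.

Lemma rphi_ge1 x : 0 <= x < 1 -> 1 <= rphi x.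
Proof.
  intros Hx; destruct (Req_dec x 0) as [->|]; [rewrite rphi_0; lra|].
  apply (has_sum_powerRZ_ge1 e_phi x); trivial.
  apply (has_sum_thetaZ _ x e_phi_ok); lra.
Qed.

Lemma rpsi_ge1 x : 0 <= x < 1 -> 1 <= rpsi x.
Proof.
  intros Hx; destruct (Req_dec x 0) as [->|]; [rewrite rpsi_0; lra|].
  apply (has_sum_powerRZ_ge1 e_psi x); trivial.
  apply (has_sum_thetaZ _ x e_psi_ok); lra.
Qed.

Lemma pow_unit0 x k : 0 <= x < 1 -> (0 < k)%nat -> 0 <= x ^ k < 1.
Proof. intros Hx Hk; split; [apply pow_le; lra|now apply pow_lt_1]. Qed.

Lemma Rabs_unit x : 0 <= x < 1 -> Rabs x < 1.
Proof. intros; rewrite Rabs_pos_eq; lra. Qed.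

Lemma rphi_opp_pos x : 0 <= x < 1 -> 0 < rphi (- x).
Proof.
  intros Hx. pose proof (rphi_ge1 x Hx) as P.
  pose proof (rphi_mul_opp x (Rabs_unit x Hx)) as E.
  assert (N : rphi (- x ^ 2) <> 0).
  { apply rphi_neq0. rewrite Rabs_Ropp. apply Rabs_unit, pow_unit0; [trivial|lia]. }
  apply Rmult_lt_reg_l with (rphi x); [lra|]. rewrite Rmult_0_r, E.
  rewrite <- Rsqr_pow2; now apply Rsqr_pos_lt.
Qed.

Lemma ex_derive_rphi x : Rabs x < 1 -> ex_derive rphi x.
Proof. apply (ex_derive_on_reals theta_phi x analytic_phi). Qed.

Lemma ex_derive_rpsi x : Rabs x < 1 -> ex_derive rpsi x.
Proof. apply (ex_derive_on_reals _ x (analytic_thetaZ _ e_psi_ok)). Qed.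

(** psi(-x)^2 = phi(-x) psi(x^2) excludes zeros, and psi(0) = 1. *)
Lemma rpsi_opp_pos x : 0 <= x < 1 -> 0 < rpsi (- x).
Proof.
  assert (NZ : forall x, 0 <= x < 1 -> rpsi (- x) <> 0).
  { intros y Hy E. pose proof (rpsi_sq (- y)) as S. rewrite Rabs_Ropp, E in S.
    specialize (S (Rabs_unit y Hy)). pose proof (rphi_opp_pos y Hy) as P.
    replace ((- y) ^ 2) with (y ^ 2) in S by ring.
    pose proof (rpsi_ge1 (y ^ 2) (pow_unit0 y 2 Hy ltac:(lia))). nra. }
  intros Hx. destruct (Rlt_le_dec 0 (rpsi (- x))) as [|Hle]; trivial. exfalso.
  assert (Hlt : rpsi (- x) < 0) by (specialize (NZ x Hx); lra).
  assert (X0 : x <> 0) by (intros ->; rewrite Ropp_0, rpsi_0 in Hlt; lra).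
  destruct (Ranalysis5.IVT_interv rpsi (- x) 0) as (z & Hz & E).
  - intros a Ha. apply continuity_pt_filterlim, (ex_derive_continuous rpsi), ex_derive_rpsi.
    apply Rabs_def1; lra.
  - lra.
  - exact Hlt.
  - rewrite rpsi_0; lra.
  - apply (NZ (- z)); [lra|]. now rewrite Ropp_involutive.
Qed.

(** Multiply phi(x)^2 - phi(-x)^2 = 8 x psi(x^4)^2 by
    phi(x)^2 + phi(-x)^2 = 2 phi(x^2)^2, and use psi(x^2)^2 = phi(x^2) psi(x^4). *)
Lemma phi4_minus x : Rabs x < 1 -> rphi x ^ 4 - rphi (- x) ^ 4 = 16 * x * rpsi (x ^ 2) ^ 4.
Proof.
  intros Hx. pose proof (rphi_sq x Hx) as A.
  pose proof (rphi_sq (- x) ltac:(now rewrite Rabs_Ropp)) as B.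
  replace ((- x) ^ 2) with (x ^ 2) in B by ring. replace ((- x) ^ 4) with (x ^ 4) in B by ring.
  pose proof (rpsi_sq (x ^ 2) (Rabs_pow_lt x 2 Hx ltac:(lia))) as C.
  replace ((x ^ 2) ^ 2) with (x ^ 4) in C by ring.
  replace (rphi x ^ 4 - rphi (- x) ^ 4) with ((rphi x ^ 2) ^ 2 - (rphi (- x) ^ 2) ^ 2) by ring.
  replace (rpsi (x ^ 2) ^ 4) with ((rpsi (x ^ 2) ^ 2) ^ 2) by ring.
  rewrite A, B, C; ring.
Qed.

Lemma phi2_plus x : Rabs x < 1 -> rphi x ^ 2 + rphi (- x) ^ 2 = 2 * rphi (x ^ 2) ^ 2.
Proof.
  intros Hx. pose proof (rphi_sq x Hx) as A.
  pose proof (rphi_sq (- x) ltac:(now rewrite Rabs_Ropp)) as B.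
  replace ((- x) ^ 2) with (x ^ 2) in B by ring. replace ((- x) ^ 4) with (x ^ 4) in B by ring. lra.
Qed.

(** The complementary modulus k' as a function of the base. *)
Definition modulus_compl (x : R) : R := (rphi (- x) / rphi x) ^ 2.
(** k^2, that is Ramanujan's alpha, as a function of the base. *)
Definition modulus_sq (x : R) : R := 1 - modulus_compl x ^ 2.

Lemma modulus_sq_psi x : 0 <= x < 1 -> modulus_sq x = 16 * x * rpsi (x ^ 2) ^ 4 / rphi x ^ 4.
Proof.
  intros Hx. rewrite <- phi4_minus by now apply Rabs_unit.
  unfold modulus_sq, modulus_compl. field. pose proof (rphi_ge1 x Hx); lra.
Qed.

Lemma modulus_compl_pos x : 0 <= x < 1 -> 0 < modulus_compl x.
Proof.
  intros Hx. pose proof (rphi_ge1 x Hx). pose proof (rphi_opp_pos x Hx).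
  apply pow_lt, Rdiv_lt_0_compat; lra.
Qed.

Lemma modulus_sq_bounds x : 0 < x < 1 -> 0 < modulus_sq x < 1.
Proof.
  intros Hx; split.
  - rewrite modulus_sq_psi by lra.
    pose proof (rphi_ge1 x ltac:(lra)). pose proof (rpsi_ge1 (x ^ 2) (pow_unit0 x 2 ltac:(lra) ltac:(lia))).
    apply Rdiv_lt_0_compat; [apply Rmult_lt_0_compat; [lra|]|]; apply pow_lt; lra.
  - unfold modulus_sq. pose proof (modulus_compl_pos x ltac:(lra)) as P.
    pose proof (pow_lt _ 2 P); lra.
Qed.

Lemma modulus_compl_lt1 x : 0 < x < 1 -> modulus_compl x < 1.
Proof.
  intros Hx. pose proof (modulus_sq_bounds x Hx) as B. unfold modulus_sq in B.
  pose proof (modulus_compl_pos x ltac:(lra)). nra.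
Qed.

(** The step of the arithmetic-geometric mean: phi(x^2)^2 is the arithmetic and
    phi(-x^2)^2 the geometric mean of phi(x)^2 and phi(-x)^2. *)
Lemma modulus_compl_double x : 0 < x < 1 ->
  modulus_compl (x ^ 2) ^ 2 = 4 * modulus_compl x / (1 + modulus_compl x) ^ 2.
Proof.
  intros Hx. assert (HA : Rabs x < 1) by (apply Rabs_unit; lra).
  pose proof (rphi_ge1 x ltac:(lra)) as P.
  pose proof (rphi_ge1 (x ^ 2) (pow_unit0 x 2 ltac:(lra) ltac:(lia))) as P2.
  pose proof (phi2_plus x HA) as S. pose proof (rphi_mul_opp x HA) as M.
  unfold modulus_compl.
  transitivity ((rphi x * rphi (- x)) ^ 2 / (rphi (x ^ 2) ^ 2) ^ 2).
  - rewrite M; field; lra.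
  - replace (rphi (x ^ 2) ^ 2) with ((rphi x ^ 2 + rphi (- x) ^ 2) / 2) by lra.
    field. repeat split; nra.
Qed.

(** Landen's transformation at (1-k')/(1+k'). *)
Lemma ell_z_modulus_double x : 0 < x < 1 ->
  ell_z (modulus_sq x) * (1 + modulus_compl x) = 2 * ell_z (modulus_sq (x ^ 2)).
Proof.
  intros Hx. pose proof (modulus_compl_pos x ltac:(lra)). pose proof (modulus_compl_lt1 x Hx).
  pose proof (landen ((1 - modulus_compl x) / (1 + modulus_compl x))) as L.
  replace (4 * ((1 - modulus_compl x) / (1 + modulus_compl x)) /
     (1 + (1 - modulus_compl x) / (1 + modulus_compl x)) ^ 2) with (modulus_sq x) in L
    by (unfold modulus_sq; field; lra).
  replace (((1 - modulus_compl x) / (1 + modulus_compl x)) ^ 2) with (modulus_sq (x ^ 2)) in L.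
  - rewrite L; [field; lra|]. split; [apply Rdiv_le_0_compat; lra|apply Rlt_div_l; lra].
  - unfold modulus_sq; rewrite modulus_compl_double by trivial; field; lra.
Qed.

(** Landen's transformation at k'. *)
Lemma ell_z_comp_double x : 0 < x < 1 ->
  ell_z (1 - modulus_sq (x ^ 2)) = (1 + modulus_compl x) * ell_z (1 - modulus_sq x).
Proof.
  intros Hx. pose proof (modulus_compl_pos x ltac:(lra)). pose proof (modulus_compl_lt1 x Hx).
  pose proof (landen (modulus_compl x) ltac:(lra)) as L.
  rewrite <- modulus_compl_double in L by trivial.
  unfold modulus_sq.
  replace (1 - (1 - modulus_compl (x ^ 2) ^ 2)) with (modulus_compl (x ^ 2) ^ 2) by ring.
  replace (1 - (1 - modulus_compl x ^ 2)) with (modulus_compl x ^ 2) by ring. exact L.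
Qed.

Lemma period_ratio_double x : 0 < x < 1 ->
  period_ratio (modulus_sq (x ^ 2)) = 2 * period_ratio (modulus_sq x).
Proof.
  intros Hx. unfold period_ratio. rewrite ell_z_comp_double by trivial.
  pose proof (ell_z_modulus_double x Hx) as E.
  pose proof (ell_z_ge1 (modulus_sq x)). pose proof (modulus_sq_bounds x Hx).
  pose proof (ell_z_ge1 (modulus_sq (x ^ 2))).
  pose proof (modulus_sq_bounds (x ^ 2) (pow_unit_interval x 2 Hx ltac:(lia))).
  replace (1 + modulus_compl x) with (2 * ell_z (modulus_sq (x ^ 2)) / ell_z (modulus_sq x))
    by (rewrite <- E; field; lra).
  field; split; lra.
Qed.

Lemma ex_derive_modulus_sq x : Rabs x < 1 -> ex_derive modulus_sq x.
Proof.
  intros Hx. unfold modulus_sq, modulus_compl.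
  auto_derive. repeat split; trivial.
  - apply ex_derive_rphi; now rewrite Rabs_Ropp.
  - now apply ex_derive_rphi.
  - now apply rphi_neq0.
Qed.

Lemma modulus_sq_0 : modulus_sq 0 = 0.
Proof. unfold modulus_sq, modulus_compl. rewrite Ropp_0, rphi_0; field. Qed.

Lemma iterate_square (P : R -> R) (c x : R) :
  0 < x < 1 -> (forall y, 0 < y < 1 -> P (y ^ 2) = c * P y) ->
  forall n, 0 < x ^ (2 ^ n) < 1 /\ P (x ^ (2 ^ n)) = c ^ n * P x.
Proof.
  intros Hx HP n; induction n as [|n [I E]].
  - simpl. rewrite Rmult_1_r; split; [trivial|ring].
  - replace (2 ^ S n)%nat with (2 ^ n * 2)%nat by (simpl; lia).
    rewrite pow_mult. split; [apply pow_unit_interval; trivial; lia|].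
    rewrite HP, E by trivial; simpl; ring.
Qed.

Lemma is_lim_seq_iterate_square x : 0 < x < 1 -> is_lim_seq (fun n => x ^ (2 ^ n)) 0.
Proof.
  intros Hx. apply (is_lim_seq_subseq (fun n => x ^ n) 0 (fun n => 2 ^ n)%nat).
  - intros P [N HN]; exists N; intros n Hn; apply HN.
    assert (n < 2 ^ n)%nat by (apply Nat.pow_gt_lin_r; lia). lia.
  - apply is_lim_seq_geom, Rabs_unit; lra.
Qed.

(** The quotient of the two sides is invariant under x -> x^2 and continuous
    at 0 with value 1. *)
Theorem ell_z_modulus_sq x : 0 < x < 1 -> ell_z (modulus_sq x) = rphi x ^ 2.
Proof.
  intros Hx.
  set (Q := fun y => ell_z (modulus_sq y) / rphi y ^ 2).
  assert (HQ : forall y, 0 < y < 1 -> Q (y ^ 2) = 1 * Q y).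
  { intros y Hy; unfold Q. assert (HA : Rabs y < 1) by (apply Rabs_unit; lra).
    pose proof (ell_z_modulus_double y Hy) as E. pose proof (phi2_plus y HA) as S.
    pose proof (rphi_ge1 y ltac:(lra)) as P.
    pose proof (rphi_ge1 (y ^ 2) (pow_unit0 y 2 ltac:(lra) ltac:(lia))) as P2.
    replace (ell_z (modulus_sq (y ^ 2))) with (ell_z (modulus_sq y) * (1 + modulus_compl y) / 2) by lra.
    replace (rphi (y ^ 2) ^ 2) with ((rphi y ^ 2 + rphi (- y) ^ 2) / 2) by lra.
    unfold modulus_compl; field; repeat split; nra. }
  assert (L : is_lim_seq (fun n => Q (x ^ (2 ^ n))) (Q 0)).
  { apply is_lim_seq_continuous; [|now apply is_lim_seq_iterate_square].
    apply continuity_pt_filterlim, (ex_derive_continuous Q).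
    unfold Q. auto_derive. rewrite modulus_sq_0. assert (Rabs 0 < 1) by (rewrite Rabs_R0; lra).
    repeat split; trivial.
    - eexists; now apply is_derive_ell_z.
    - now apply ex_derive_modulus_sq.
    - now apply ex_derive_rphi.
    - rewrite rphi_0; lra. }
  apply (is_lim_seq_ext _ (fun _ => Q x)) in L.
  - apply is_lim_seq_unique in L. rewrite Lim_seq_const in L. injection L as L.
    assert (Q 0 = 1) as Q0 by (unfold Q; rewrite modulus_sq_0, ell_z_0, rphi_0; field).
    rewrite Q0 in L. unfold Q in L. pose proof (rphi_ge1 x ltac:(lra)).
    apply Rmult_eq_reg_r with (/ rphi x ^ 2); [|apply Rinv_neq_0_compat, pow_nonzero; lra].
    rewrite Rinv_r by (apply pow_nonzero; lra). exact L.
  - intros n. destruct (iterate_square Q 1 x Hx HQ n) as [_ ->]. rewrite pow1; ring.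
Qed.

(** * The nome *)

Lemma doubling_bounded_zero (h B : R) N :
  (forall n, (N <= n)%nat -> Rabs (2 ^ n * h) <= B) -> h = 0.
Proof.
  intros H.
  destruct (Req_dec h 0) as [|Hh]; trivial. exfalso.
  pose proof (Rabs_pos_lt h Hh) as P.
  destruct (Pow_x_infinity 2 ltac:(rewrite Rabs_pos_eq; lra) (B / Rabs h + 1)) as [M HM].
  specialize (H (Nat.max N M) ltac:(lia)). specialize (HM (Nat.max N M) ltac:(lia)).
  rewrite Rabs_mult in H. apply Rge_le in HM.
  assert (E : (B / Rabs h + 1) * Rabs h = B + Rabs h) by (field; lra).
  nra.
Qed.

(** The difference of the sides doubles under x -> x^2 but stays bounded near 0:
    K'/K is - c log k^2 + O(1) there, and k^2/x has the finite positive limit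
    16. *)
Lemma period_ratio_modulus x : 0 < x < 1 ->
  period_ratio (modulus_sq x) = - legendre_const * ln x.
Proof.
  intros Hx.
  set (h := fun y => period_ratio (modulus_sq y) + legendre_const * ln y).
  assert (Hh : forall y, 0 < y < 1 -> h (y ^ 2) = 2 * h y).
  { intros y Hy; unfold h. rewrite period_ratio_double, ln_pow by lra. simpl INR; ring. }
  enough (E : h x = 0) by (unfold h in E; lra).
  destruct period_ratio_log as [B HB].
  set (G := fun y => ln (16 * rpsi (y ^ 2) ^ 4 / rphi y ^ 4)).
  assert (A0 : Rabs 0 < 1) by (rewrite Rabs_R0; lra).
  assert (CG : continuous G 0).
  { apply (ex_derive_continuous G). unfold G. auto_derive.
    rewrite !Rmult_0_l, rphi_0, rpsi_0.
    repeat split; trivial; try (now apply ex_derive_rphi); try (now apply ex_derive_rpsi); lra. }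
  assert (CM : continuous modulus_sq 0).
  { apply (ex_derive_continuous modulus_sq), ex_derive_modulus_sq, A0. }
  assert (LG : locally 0 (fun y => Rabs (G y - G 0) < 1)).
  { apply (CG (fun z => Rabs (z - G 0) < 1)). exists (mkposreal 1 Rlt_0_1). intros y Hy; exact Hy. }
  assert (LM : locally 0 (fun y => Rabs (modulus_sq y - modulus_sq 0) < 1/2)).
  { assert (P : 0 < 1/2) by lra. apply (CM (fun z => Rabs (z - modulus_sq 0) < 1/2)). exists (mkposreal _ P). intros y Hy; exact Hy. }
  assert (LB : locally 0 (fun y => 0 < y < 1 -> Rabs (h y) <= B + legendre_const * (Rabs (G 0) + 1))).
  { generalize (filter_and _ _ LG LM); apply filter_imp. intros y [H1 H2] Hy.
    pose proof (modulus_sq_bounds y Hy) as MB.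
    rewrite modulus_sq_0, Rminus_0_r, Rabs_pos_eq in H2 by lra.
    specialize (HB (modulus_sq y) ltac:(lra)).
    assert (EG : ln (modulus_sq y) = ln y + G y).
    { unfold G. rewrite <- ln_mult; [f_equal|lra|].
      - rewrite modulus_sq_psi by lra. field. pose proof (rphi_ge1 y ltac:(lra)); lra.
      - pose proof (rphi_ge1 y ltac:(lra)).
        pose proof (rpsi_ge1 (y ^ 2) (pow_unit0 y 2 ltac:(lra) ltac:(lia))).
        apply Rdiv_lt_0_compat; [apply Rmult_lt_0_compat; [lra|]|]; apply pow_lt; lra. }
    rewrite EG in HB. pose proof legendre_const_pos as W.
    replace (h y) with (period_ratio (modulus_sq y) + legendre_const * (ln y + G y) + - (legendre_const * G y))
      by (unfold h; ring).
    eapply Rle_trans; [apply Rabs_triang|]. rewrite Rabs_Ropp, Rabs_mult, (Rabs_pos_eq legendre_const) by lra.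
    apply Rplus_le_compat; trivial. apply Rmult_le_compat_l; [lra|].
    replace (G y) with (G 0 + (G y - G 0)) by ring.
    eapply Rle_trans; [apply Rabs_triang|]; lra. }
  destruct (is_lim_seq_iterate_square x Hx _ LB) as [N HN].
  apply (doubling_bounded_zero _ (B + legendre_const * (Rabs (G 0) + 1)) N).
  intros n Hn. destruct (iterate_square h 2 x Hx Hh n) as [I E]. rewrite <- E. now apply HN.
Qed.

Lemma locally_open_unit x : 0 < x < 1 -> locally x (fun t => 0 < t < 1).
Proof.
  intros Hx. assert (P : 0 < Rmin x (1 - x)) by (apply Rmin_pos; lra).
  exists (mkposreal _ P). intros y Hy. change (Rabs (y - x) < Rmin x (1 - x)) in Hy.
  pose proof (Rmin_l x (1 - x)); pose proof (Rmin_r x (1 - x)).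
  apply Rabs_def2 in Hy. split; lra.
Qed.

(** Differentiate K'/K = - c log x, using the derivative of K'/K that the
    Wronskian provides; the constant c cancels. *)
Lemma is_derive_modulus_sq x : 0 < x < 1 ->
  is_derive modulus_sq x (modulus_sq x * (1 - modulus_sq x) * rphi x ^ 4 / x).
Proof.
  intros Hx. pose proof (modulus_sq_bounds x Hx) as MB. pose proof legendre_const_pos as W.
  destruct (ex_derive_modulus_sq x ltac:(apply Rabs_unit; lra)) as [d Hd].
  assert (D1 : is_derive (fun y => period_ratio (modulus_sq y)) x
     (d * - (legendre_const / (modulus_sq x * (1 - modulus_sq x) * ell_z (modulus_sq x) ^ 2)))).
  { apply (is_derive_Rcomp period_ratio modulus_sq); trivial. now apply is_derive_period_ratio. }
  assert (D2 : is_derive (fun y => period_ratio (modulus_sq y)) x (- legendre_const / x)).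
  { apply (is_derive_ext_loc (fun y => - legendre_const * ln y)).
    - generalize (locally_open_unit x Hx); apply filter_imp; intros y Hy.
      symmetry; now apply period_ratio_modulus.
    - auto_derive; [lra|]. field; lra. }
  apply is_derive_unique in D1, D2. rewrite D1 in D2. clear D1.
  rewrite ell_z_modulus_sq in D2 by trivial. pose proof (rphi_ge1 x ltac:(lra)) as P.
  assert (E : d = modulus_sq x * (1 - modulus_sq x) * rphi x ^ 4 / x).
  { apply Rmult_eq_reg_r with (- (legendre_const / (modulus_sq x * (1 - modulus_sq x) * (rphi x ^ 2) ^ 2))).
    - rewrite D2. field. repeat split; lra.
    - apply Ropp_neq_0_compat, Rgt_not_eq, Rdiv_lt_0_compat; trivial.
      repeat apply Rmult_lt_0_compat; try lra; apply pow_lt; nra. }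
  now rewrite <- E.
Qed.

Definition nome (a : R) : R := exp (- period_ratio a / legendre_const).

Lemma nome_bounds a : 0 < a < 1 -> 0 < nome a < 1.
Proof.
  intros Ha; unfold nome; split; [apply exp_pos|]. rewrite <- exp_0. apply exp_increasing.
  pose proof (period_ratio_pos a Ha). pose proof legendre_const_pos.
  apply Rlt_div_l; lra.
Qed.

Lemma modulus_sq_nome a : 0 < a < 1 -> modulus_sq (nome a) = a.
Proof.
  intros Ha. pose proof (nome_bounds a Ha) as N. apply period_ratio_inj; trivial.
  - now apply modulus_sq_bounds.
  - rewrite period_ratio_modulus by trivial. unfold nome; rewrite ln_exp.
    pose proof legendre_const_pos; field; lra.
Qed.

Lemma modulus_sq_inj x y : 0 < x < 1 -> 0 < y < 1 -> modulus_sq x = modulus_sq y -> x = y.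
Proof.
  intros Hx Hy E. apply (f_equal period_ratio) in E.
  rewrite !period_ratio_modulus in E by trivial. pose proof legendre_const_pos.
  apply ln_inv; try lra. nra.
Qed.

(** K'/K at a and b stands in the ratio 3 to 5, and nomes are exponentials of it. *)
Lemma degree_parametrization a b : 0 < a < 1 -> 0 < b < 1 -> has_degree (5 / 3) b a ->
  exists q, 0 < q < 1 /\ a = modulus_sq (q ^ 3) /\ b = modulus_sq (q ^ 5).
Proof.
  intros Ha Hb Hd. unfold has_degree in Hd. fold (period_ratio a) (period_ratio b) in Hd.
  set (q := exp (- period_ratio a / legendre_const / 3)).
  pose proof (period_ratio_pos a Ha) as P. pose proof legendre_const_pos as W.
  assert (ek : forall k, q ^ k = exp (INR k * (- period_ratio a / legendre_const / 3))).
  { intros k; unfold q; induction k as [|k IH].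
    - simpl; now rewrite Rmult_0_l, exp_0.
    - rewrite S_INR, Rmult_plus_distr_r, exp_plus, Rmult_1_l, <- IH; simpl; ring. }
  exists q; split; [|split].
  - split; [apply exp_pos|]. unfold q; rewrite <- exp_0. apply exp_increasing.
    apply Rlt_div_l; [lra|]. rewrite Rmult_0_l. apply Rlt_div_l; lra.
  - rewrite <- (modulus_sq_nome a) at 1 by trivial. f_equal; rewrite ek; unfold nome; f_equal.
    simpl; field; lra.
  - rewrite <- (modulus_sq_nome b) at 1 by trivial. f_equal; rewrite ek; unfold nome; f_equal.
    rewrite <- Hd; simpl; field; lra.
Qed.

(** * The modular equation of degrees 3 and 5 *)

(** With P = [P35], the eighth roots u and v of a b and (1-a)(1-b) are U/P and
    V/P for the products [U35] and [V35]; the latter are single-valued in q,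
    so that the relations between them are identities of power series. *)
Definition P35 (q : C) : C := (theta_phi (q ^ 3) * theta_phi (q ^ 5))%C.
Definition U35 (q : C) : C := (2 * q * (theta_psi (q ^ 3) * theta_psi (q ^ 5)))%C.
Definition V35 (q : C) : C := (theta_phi (- q ^ 6) * theta_phi (- q ^ 10))%C.

Definition rP (x : R) : R := rphi (x ^ 3) * rphi (x ^ 5).
Definition rU (x : R) : R := 2 * x * (rpsi (x ^ 3) * rpsi (x ^ 5)).
Definition rV (x : R) : R := rphi (- x ^ 6) * rphi (- x ^ 10).

Ltac lift_reals :=
  rewrite <- ?RtoC_pow, <- ?RtoC_opp;
  rewrite ?phi_RtoC, ?psi_RtoC
    by (rewrite ?Rabs_Ropp; first [assumption | apply Rabs_pow_lt; [assumption|lia]]);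
  rewrite ?RtoC_mult; reflexivity.

Lemma P35_RtoC x : Rabs x < 1 -> P35 (RtoC x) = RtoC (rP x).
Proof. intros Hx; unfold P35, rP; lift_reals. Qed.
Lemma U35_RtoC x : Rabs x < 1 -> U35 (RtoC x) = RtoC (rU x).
Proof. intros Hx; unfold U35, rU; lift_reals. Qed.
Lemma V35_RtoC x : Rabs x < 1 -> V35 (RtoC x) = RtoC (rV x).
Proof. intros Hx; unfold V35, rV; lift_reals. Qed.

Definition ru (x : R) : R := rU x / rP x.
Definition rv (x : R) : R := rV x / rP x.

Lemma rP_ge1 x : 0 <= x < 1 -> 1 <= rP x.
Proof.
  intros Hx; unfold rP.
  pose proof (rphi_ge1 _ (pow_unit0 x 3 Hx ltac:(lia))).
  pose proof (rphi_ge1 _ (pow_unit0 x 5 Hx ltac:(lia))). nra.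
Qed.

Lemma ru_pos x : 0 < x < 1 -> 0 < ru x.
Proof.
  intros Hx; unfold ru, rU. pose proof (rP_ge1 x ltac:(lra)).
  pose proof (rpsi_ge1 _ (pow_unit0 x 3 ltac:(lra) ltac:(lia))).
  pose proof (rpsi_ge1 _ (pow_unit0 x 5 ltac:(lra) ltac:(lia))).
  apply Rdiv_lt_0_compat; [|lra]. repeat apply Rmult_lt_0_compat; lra.
Qed.

Lemma rv_pos x : 0 < x < 1 -> 0 < rv x.
Proof.
  intros Hx; unfold rv, rV. pose proof (rP_ge1 x ltac:(lra)).
  pose proof (rphi_opp_pos _ (pow_unit0 x 6 ltac:(lra) ltac:(lia))).
  pose proof (rphi_opp_pos _ (pow_unit0 x 10 ltac:(lra) ltac:(lia))).
  apply Rdiv_lt_0_compat; [|lra]. apply Rmult_lt_0_compat; lra.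
Qed.

Lemma U35_sq q : Cmod q < 1 ->
  (U35 q ^ 2 = P35 q * (4 * q ^ 2 * theta_psi (q ^ 6) * theta_psi (q ^ 10)))%C.
Proof.
  intros Hq; unfold U35, P35.
  pose proof (psi_sq (q ^ 3) (Cmod_pow_lt_1 q 3 Hq ltac:(lia))) as A.
  pose proof (psi_sq (q ^ 5) (Cmod_pow_lt_1 q 5 Hq ltac:(lia))) as B.
  replace ((q ^ 3) ^ 2)%C with (q ^ 6)%C in A by ring.
  replace ((q ^ 5) ^ 2)%C with (q ^ 10)%C in B by ring.
  transitivity (4 * q ^ 2 * theta_psi (q ^ 3) ^ 2 * theta_psi (q ^ 5) ^ 2)%C; [ring|].
  rewrite A, B; ring.
Qed.

Lemma V35_sq q : Cmod q < 1 ->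
  (V35 q ^ 2 = P35 q * (theta_phi (- q ^ 3) * theta_phi (- q ^ 5)))%C.
Proof.
  intros Hq; unfold V35, P35.
  pose proof (phi_mul_phi_opp (q ^ 3) (Cmod_pow_lt_1 q 3 Hq ltac:(lia))) as A.
  pose proof (phi_mul_phi_opp (q ^ 5) (Cmod_pow_lt_1 q 5 Hq ltac:(lia))) as B.
  replace ((q ^ 3) ^ 2)%C with (q ^ 6)%C in A by ring.
  replace ((q ^ 5) ^ 2)%C with (q ^ 10)%C in B by ring.
  transitivity (theta_phi (- q ^ 6) ^ 2 * theta_phi (- q ^ 10) ^ 2)%C; [ring|].
  rewrite <- A, <- B; ring.
Qed.

Lemma rU_sq x : Rabs x < 1 -> rU x ^ 2 = rP x * (4 * x ^ 2 * rpsi (x ^ 6) * rpsi (x ^ 10)).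
Proof.
  intros Hx; pose proof (U35_sq x (Cmod_R_lt_1 x Hx)) as H.
  rewrite U35_RtoC, P35_RtoC in H by trivial. of_complex H; exact H.
Qed.

Lemma rV_sq x : Rabs x < 1 -> rV x ^ 2 = rP x * (rphi (- x ^ 3) * rphi (- x ^ 5)).
Proof.
  intros Hx; pose proof (V35_sq x (Cmod_R_lt_1 x Hx)) as H.
  rewrite V35_RtoC, P35_RtoC in H by trivial. of_complex H; exact H.
Qed.

(** The squares agree by psi(-x)^2 = phi(-x) psi(x^2), and both sides are
    positive. *)
Lemma rU_mul_rV x : 0 < x < 1 -> rU x * rV x = rP x * (2 * x * (rpsi (- x ^ 3) * rpsi (- x ^ 5))).
Proof.
  intros Hx. assert (HA : Rabs x < 1) by (apply Rabs_unit; lra).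
  pose proof (ru_pos x Hx) as HU. pose proof (rv_pos x Hx) as HV. pose proof (rP_ge1 x ltac:(lra)) as HP.
  assert (U0 : 0 < rU x) by (replace (rU x) with (ru x * rP x) by (unfold ru; field; lra); nra).
  assert (V0 : 0 < rV x) by (replace (rV x) with (rv x * rP x) by (unfold rv; field; lra); nra).
  pose proof (rpsi_opp_pos _ (pow_unit0 x 3 ltac:(lra) ltac:(lia))) as A.
  pose proof (rpsi_opp_pos _ (pow_unit0 x 5 ltac:(lra) ltac:(lia))) as B.
  pose proof (Rmult_lt_0_compat _ _ A B) as AB.
  apply Rsqr_inj.
  { apply Rlt_le, Rmult_lt_0_compat; trivial. }
  { apply Rlt_le, Rmult_lt_0_compat; [lra|]. apply Rmult_lt_0_compat; lra. }
  rewrite !Rsqr_pow2.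
  pose proof (rpsi_sq (- x ^ 3)) as E3. pose proof (rpsi_sq (- x ^ 5)) as E5.
  rewrite Rabs_Ropp in E3, E5.
  specialize (E3 (Rabs_pow_lt x 3 HA ltac:(lia))). specialize (E5 (Rabs_pow_lt x 5 HA ltac:(lia))).
  replace ((- x ^ 3) ^ 2) with (x ^ 6) in E3 by ring.
  replace ((- x ^ 5) ^ 2) with (x ^ 10) in E5 by ring.
  transitivity (rU x ^ 2 * rV x ^ 2); [ring|].
  transitivity (rP x ^ 2 * (4 * x ^ 2 * (rpsi (- x ^ 3) ^ 2 * rpsi (- x ^ 5) ^ 2))); [|ring].
  rewrite rU_sq, rV_sq, E3, E5 by trivial; ring.
Qed.

Lemma U35_mul_V35 q : Cmod q < 1 ->
  (U35 q * V35 q = P35 q * (2 * q * (theta_psi (- q ^ 3) * theta_psi (- q ^ 5))))%C.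
Proof.
  apply (analytic_eq (fun q => U35 q * V35 q)%C
    (fun q => P35 q * (2 * q * (theta_psi (- q ^ 3) * theta_psi (- q ^ 5))))%C 1).
  - unfold U35, V35; analytic_tac.
  - unfold P35; analytic_tac.
  - lra.
  - intros x Hx. assert (HA : Rabs x < 1) by (apply Rabs_unit; lra).
    rewrite U35_RtoC, V35_RtoC, P35_RtoC, <- RtoC_mult, rU_mul_rV by trivial.
    rewrite !RtoC_mult; f_equal. rewrite <- !RtoC_pow, <- !RtoC_opp, !psi_RtoC; trivial;
      rewrite Rabs_Ropp; apply Rabs_pow_lt; trivial; lia.
Qed.

Lemma ru_pow8 x : 0 < x < 1 -> ru x ^ 8 = modulus_sq (x ^ 3) * modulus_sq (x ^ 5).
Proof.
  intros Hx. assert (HA : Rabs x < 1) by (apply Rabs_unit; lra).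
  rewrite !modulus_sq_psi by (apply pow_unit0; [lra|lia]).
  pose proof (rphi_ge1 _ (pow_unit0 x 3 ltac:(lra) ltac:(lia))).
  pose proof (rphi_ge1 _ (pow_unit0 x 5 ltac:(lra) ltac:(lia))).
  pose proof (rP_ge1 x ltac:(lra)).
  transitivity ((rU x ^ 2) ^ 4 / rP x ^ 8); [unfold ru; field; lra|].
  rewrite rU_sq by trivial. unfold rP.
  replace ((x ^ 3) ^ 2) with (x ^ 6) by ring. replace ((x ^ 5) ^ 2) with (x ^ 10) by ring.
  field; split; lra.
Qed.

Lemma rv_pow8 x : 0 < x < 1 ->
  rv x ^ 8 = (1 - modulus_sq (x ^ 3)) * (1 - modulus_sq (x ^ 5)).
Proof.
  intros Hx. assert (HA : Rabs x < 1) by (apply Rabs_unit; lra).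
  pose proof (rphi_ge1 _ (pow_unit0 x 3 ltac:(lra) ltac:(lia))).
  pose proof (rphi_ge1 _ (pow_unit0 x 5 ltac:(lra) ltac:(lia))).
  pose proof (rP_ge1 x ltac:(lra)).
  transitivity ((rV x ^ 2) ^ 4 / rP x ^ 8); [unfold rv; field; lra|].
  rewrite rV_sq by trivial. unfold rP, modulus_sq, modulus_compl. field; split; lra.
Qed.

(** The square root sqrt((1 + u^4 + v^4)/2) of part (ii), as a theta quotient;
    [rw_sq] justifies it. *)
Definition rw (x : R) : R :=
  (rphi (x ^ 6) * rphi (x ^ 10) + 4 * x ^ 4 * rpsi (x ^ 12) * rpsi (x ^ 20)) / rP x.

Lemma rw_schroter x : 0 < x < 1 -> rw x = ru x + rv x - ru x * rv x.
Proof.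
  intros Hx. assert (HA : Rabs x < 1) by (apply Rabs_unit; lra).
  pose proof (rP_ge1 x ltac:(lra)) as P1.
  pose proof (rschroter15 x HA) as S. pose proof (rU_mul_rV x Hx) as UV.
  unfold rw, ru, rv.
  replace (rU x / rP x * (rV x / rP x)) with (rU x * rV x / rP x / rP x) by (field; lra).
  rewrite UV. fold (rV x) in S.
  replace (rphi (x ^ 6) * rphi (x ^ 10) + 4 * x ^ 4 * rpsi (x ^ 12) * rpsi (x ^ 20))
    with (rV x + (rU x - 2 * x * (rpsi (- x ^ 3) * rpsi (- x ^ 5)))); [field; lra|].
  unfold rU. lra.
Qed.

Lemma rw_pos x : 0 < x < 1 -> 0 < rw x.
Proof.
  intros Hx; unfold rw. pose proof (rP_ge1 x ltac:(lra)).
  pose proof (rphi_ge1 _ (pow_unit0 x 6 ltac:(lra) ltac:(lia))).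
  pose proof (rphi_ge1 _ (pow_unit0 x 10 ltac:(lra) ltac:(lia))).
  pose proof (rpsi_ge1 _ (pow_unit0 x 12 ltac:(lra) ltac:(lia))).
  pose proof (rpsi_ge1 _ (pow_unit0 x 20 ltac:(lra) ltac:(lia))).
  pose proof (pow_lt x 4 ltac:(lra)).
  apply Rdiv_lt_0_compat; [|lra].
  apply Rplus_lt_0_compat; repeat apply Rmult_lt_0_compat; lra.
Qed.

Lemma phi2_minus x : Rabs x < 1 -> rphi x ^ 2 - rphi (- x) ^ 2 = 8 * x * rpsi (x ^ 4) ^ 2.
Proof.
  intros Hx. pose proof (rphi_sq x Hx) as A.
  pose proof (rphi_sq (- x) ltac:(now rewrite Rabs_Ropp)) as B.
  replace ((- x) ^ 2) with (x ^ 2) in B by ring. replace ((- x) ^ 4) with (x ^ 4) in B by ring. lra.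
Qed.

(** With s = phi(x^3)^2 and t = phi(x^5)^2, and s', t' their values at -x^3 and
    -x^5, the two summands of w P have the squares (s+s')(t+t')/4 and
    (s-s')(t-t')/4, whose sum is (s t + s' t')/2; the cross term is u^4 P^2/2. *)
Lemma rw_sq x : 0 < x < 1 -> rw x ^ 2 = (1 + ru x ^ 4 + rv x ^ 4) / 2.
Proof.
  intros Hx. assert (HA : Rabs x < 1) by (apply Rabs_unit; lra).
  pose proof (rP_ge1 x ltac:(lra)) as P1.
  pose proof (phi2_plus (x ^ 3) (Rabs_pow_lt x 3 HA ltac:(lia))) as A3.
  pose proof (phi2_plus (x ^ 5) (Rabs_pow_lt x 5 HA ltac:(lia))) as A5.
  pose proof (phi2_minus (x ^ 3) (Rabs_pow_lt x 3 HA ltac:(lia))) as M3.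
  pose proof (phi2_minus (x ^ 5) (Rabs_pow_lt x 5 HA ltac:(lia))) as M5.
  pose proof (rpsi_sq (x ^ 6) (Rabs_pow_lt x 6 HA ltac:(lia))) as S6.
  pose proof (rpsi_sq (x ^ 10) (Rabs_pow_lt x 10 HA ltac:(lia))) as S10.
  replace ((x ^ 3) ^ 2) with (x ^ 6) in A3 by ring. replace ((x ^ 5) ^ 2) with (x ^ 10) in A5 by ring.
  replace ((x ^ 3) ^ 4) with (x ^ 12) in M3 by ring. replace ((x ^ 5) ^ 4) with (x ^ 20) in M5 by ring.
  replace ((x ^ 6) ^ 2) with (x ^ 12) in S6 by ring. replace ((x ^ 10) ^ 2) with (x ^ 20) in S10 by ring.
  assert (EU : ru x ^ 4 = (16 * x ^ 4 * rpsi (x ^ 6) ^ 2 * rpsi (x ^ 10) ^ 2) / rP x ^ 2).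
  { transitivity ((rU x ^ 2) ^ 2 / rP x ^ 4); [unfold ru; field; lra|].
    rewrite rU_sq by trivial. field; lra. }
  assert (EV : rv x ^ 4 = rphi (- x ^ 3) ^ 2 * rphi (- x ^ 5) ^ 2 / rP x ^ 2).
  { transitivity ((rV x ^ 2) ^ 2 / rP x ^ 4); [unfold rv; field; lra|].
    rewrite rV_sq by trivial. field; lra. }
  rewrite EU, EV, S6, S10. unfold rw.
  assert (EP : rP x ^ 2 = rphi (x ^ 3) ^ 2 * rphi (x ^ 5) ^ 2) by (unfold rP; ring).
  apply Rmult_eq_reg_r with (2 * rP x ^ 2); [|nra].
  match goal with |- ?L = ?R => 
   transitivity (2 * rphi (x ^ 6) ^ 2 * rphi (x ^ 10) ^ 2 + 32 * x ^ 8 * rpsi (x ^ 12) ^ 2 * rpsi (x ^ 20) ^ 2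
     + 16 * x ^ 4 * (rphi (x ^ 6) * rpsi (x ^ 12)) * (rphi (x ^ 10) * rpsi (x ^ 20))); [field; lra|] end.
  transitivity (rP x ^ 2 + 16 * x ^ 4 * (rphi (x ^ 6) * rpsi (x ^ 12)) * (rphi (x ^ 10) * rpsi (x ^ 20))
    + rphi (- x ^ 3) ^ 2 * rphi (- x ^ 5) ^ 2); [|field; lra].
  rewrite EP.
  replace (2 * rphi (x ^ 6) ^ 2 * rphi (x ^ 10) ^ 2)
    with ((2 * rphi (x ^ 6) ^ 2) * (2 * rphi (x ^ 10) ^ 2) / 2) by field.
  replace (32 * x ^ 8 * rpsi (x ^ 12) ^ 2 * rpsi (x ^ 20) ^ 2)
    with ((8 * x ^ 3 * rpsi (x ^ 12) ^ 2) * (8 * x ^ 5 * rpsi (x ^ 20) ^ 2) / 2) by field.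
  rewrite <- A3, <- A5, <- M3, <- M5. field.
Qed.

Lemma factored_relation x : 0 < x < 1 ->
  (ru x + rv x - 1) * ((ru x + rv x - 1) * (ru x + rv x + 1) ^ 2 - 4 * (ru x + rv x) * (ru x * rv x)) = 0.
Proof.
  intros Hx. pose proof (rw_sq x Hx) as E. rewrite rw_schroter in E by trivial.
  set (u := ru x) in *; set (v := rv x) in *.
  transitivity (1 + u ^ 4 + v ^ 4 - 2 * (u + v - u * v) ^ 2); [ring|]. lra.
Qed.

Lemma positive_right_of_zero (g : R -> R) l :
  is_derive g 0 l -> 0 < l -> g 0 = 0 -> exists eps, 0 < eps <= 1 /\ forall x, 0 < x < eps -> 0 < g x.
Proof.
  intros Hg Hl G0. apply is_derive_Reals in Hg.
  destruct (Hg l Hl) as [d Hd].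
  exists (Rmin d 1). pose proof (Rmin_l d 1). pose proof (Rmin_r d 1). destruct d as [d D0]; simpl in *.
  split; [split; [apply Rmin_pos; lra|lra]|].
  intros x Hx. specialize (Hd x ltac:(lra)).
  rewrite Rabs_pos_eq in Hd by lra. specialize (Hd ltac:(lra)).
  rewrite Rplus_0_l, G0, Rminus_0_r in Hd. apply Rabs_def2 in Hd.
  assert (Q : 0 < g x / x) by lra.
  replace (g x) with (g x / x * x) by (field; lra). apply Rmult_lt_0_compat; lra.
Qed.

(** U + V - P vanishes at 0, where its derivative is 2: the values of phi and psi
    at x^3 and higher powers are stationary. *)
Lemma rU_rV_gt_rP_near_0 : exists eps, 0 < eps <= 1 /\ forall x, 0 < x < eps -> 0 < rU x + rV x - rP x.
Proof.
  apply (positive_right_of_zero _ 2); [|lra|].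
  - unfold rU, rV, rP. assert (A0 : Rabs 0 < 1) by (rewrite Rabs_R0; lra).
    assert (D3 : is_derive (fun x => x ^ 3) 0 0) by (auto_derive; trivial; ring).
    assert (D5 : is_derive (fun x => x ^ 5) 0 0) by (auto_derive; trivial; ring).
    assert (D6 : is_derive (fun x => - x ^ 6) 0 0) by (auto_derive; trivial; ring).
    assert (D10 : is_derive (fun x => - x ^ 10) 0 0) by (auto_derive; trivial; ring).
    assert (C : forall f g : R -> R, (forall x, Rabs x < 1 -> ex_derive f x) ->
       is_derive g 0 0 -> g 0 = 0 -> is_derive (fun x => f (g x)) 0 0).
    { intros f g Hf Hg G0. destruct (Hf 0 A0) as [l Hl].
      apply is_derive_eq with (0 * l); [|ring].
      apply is_derive_Rcomp; trivial. now rewrite G0. }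
    eapply is_derive_eq.
    + apply is_derive_Rminus; [apply is_derive_Rplus|].
      * apply (is_derive_Rmult (fun x => 2 * x) (fun x => rpsi (x ^ 3) * rpsi (x ^ 5)) 0 2).
        -- auto_derive; trivial; ring.
        -- apply (is_derive_Rmult (fun x => rpsi (x ^ 3)) (fun x => rpsi (x ^ 5)) 0 0 0);
           apply C; trivial; try ring; apply ex_derive_rpsi.
      * apply (is_derive_Rmult (fun x => rphi (- x ^ 6)) (fun x => rphi (- x ^ 10)) 0 0 0);
           apply C; trivial; try ring; apply ex_derive_rphi.
      * apply (is_derive_Rmult (fun x => rphi (x ^ 3)) (fun x => rphi (x ^ 5)) 0 0 0);
           apply C; trivial; try ring; apply ex_derive_rphi.
    + replace (0 ^ 3) with 0 by ring. replace (0 ^ 5) with 0 by ring. rewrite rpsi_0; ring.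
  - unfold rU, rV, rP. replace (0 ^ 3) with 0 by ring. replace (0 ^ 5) with 0 by ring.
    replace (- 0 ^ 6) with 0 by ring. replace (- 0 ^ 10) with 0 by ring. rewrite rphi_0; ring.
Qed.

(** The factor p - 1 of [factored_relation] is positive for small q. *)
Lemma relation35 q : Cmod q < 1 ->
  ((U35 q + V35 q - P35 q) * (U35 q + V35 q + P35 q) ^ 2 = 4 * (U35 q + V35 q) * (U35 q * V35 q))%C.
Proof.
  destruct rU_rV_gt_rP_near_0 as (eps & He & Hp).
  apply (analytic_eq (fun q => (U35 q + V35 q - P35 q) * (U35 q + V35 q + P35 q) ^ 2)%C
    (fun q => 4 * (U35 q + V35 q) * (U35 q * V35 q))%C eps).
  - unfold U35, V35, P35; analytic_tac.
  - unfold U35, V35; analytic_tac.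
  - lra.
  - intros x Hx. assert (HA : Rabs x < 1) by (apply Rabs_unit; lra).
    rewrite U35_RtoC, V35_RtoC, P35_RtoC by trivial.
    rewrite <- !RtoC_plus, <- !RtoC_minus, <- RtoC_pow, <- !RtoC_mult. f_equal.
    specialize (Hp x Hx). pose proof (factored_relation x ltac:(lra)) as F.
    pose proof (rP_ge1 x ltac:(lra)) as P1.
    apply Rmult_integral in F as [F|F].
    + exfalso. replace (ru x + rv x - 1) with ((rU x + rV x - rP x) / rP x) in F by (unfold ru, rv; field; lra).
      assert (0 < (rU x + rV x - rP x) / rP x) by (apply Rdiv_lt_0_compat; lra). lra.
    + apply (Rmult_eq_compat_r (rP x ^ 3)) in F. unfold ru, rv in F.
      apply Rminus_diag_uniq. rewrite Rmult_0_l in F. rewrite <- F. field; lra.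
Qed.

Lemma relation_uv x : 0 < x < 1 ->
  (ru x + rv x - 1) * (ru x + rv x + 1) ^ 2 = 4 * (ru x + rv x) * (ru x * rv x).
Proof.
  intros Hx. assert (HA : Rabs x < 1) by (apply Rabs_unit; lra).
  pose proof (rP_ge1 x ltac:(lra)) as P1.
  pose proof (relation35 x (Cmod_R_lt_1 x HA)) as H.
  rewrite U35_RtoC, V35_RtoC, P35_RtoC in H by trivial.
  rewrite <- !RtoC_plus, <- !RtoC_minus, <- RtoC_pow, <- !RtoC_mult in H. apply RtoC_inj in H.
  transitivity ((rU x + rV x - rP x) * (rU x + rV x + rP x) ^ 2 / rP x ^ 3);
    [unfold ru, rv; field; lra|]. rewrite H. unfold ru, rv; field; lra.
Qed.

(** * Differentiating the modular equation *)

(** 3 z_3^2 and 5 z_5^2, the weights in q da/dq and q db/dq. *)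
Definition rS (x : R) : R := 3 * rphi (x ^ 3) ^ 4.
Definition rT (x : R) : R := 5 * rphi (x ^ 5) ^ 4.

Lemma is_derive_modulus_pow k x : (0 < k)%nat -> 0 < x < 1 ->
  is_derive (fun t => modulus_sq (t ^ k)) x
    (modulus_sq (x ^ k) * (1 - modulus_sq (x ^ k)) * (INR k * rphi (x ^ k) ^ 4) / x).
Proof.
  intros Hk Hx. pose proof (pow_unit_interval x k Hx Hk) as K.
  eapply is_derive_eq.
  - apply (is_derive_Rcomp modulus_sq (fun t => t ^ k)); [now apply is_derive_modulus_sq|].
    apply is_derive_pow with (l := 1). apply (is_derive_id x).
  - destruct k as [|k]; [lia|]. simpl pred.
    replace (x ^ S k) with (x * x ^ k) in * by reflexivity.
    assert (x ^ k <> 0) by (apply pow_nonzero; lra). field; lra.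
Qed.

Lemma eighth_root x y : 0 < y -> x = y ^ 8 -> exp (ln x / 8) = y.
Proof.
  intros Hy ->. rewrite ln_pow by trivial. simpl INR.
  replace ((1 + 1 + 1 + 1 + 1 + 1 + 1 + 1) * ln y / 8) with (ln y) by field. now apply exp_ln.
Qed.

Lemma is_derive_eighth_root (f g : R -> R) l x :
  locally x (fun t => 0 < g t /\ g t ^ 8 = f t) -> is_derive f x l ->
  is_derive g x (g x * (l / f x) / 8).
Proof.
  intros H Hf. destruct (locally_singleton _ _ H) as [G0 E].
  assert (F0 : 0 < f x) by (rewrite <- E; now apply pow_lt).
  apply (is_derive_ext_loc (fun t => exp (ln (f t) / 8))).
  - revert H; apply filter_imp; intros t [H0 H1]; apply eighth_root; [trivial|now symmetry].
  - eapply is_derive_eq.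
    + apply (is_derive_Rcomp exp (fun t => ln (f t) / 8)); [apply is_derive_exp|].
      apply (is_derive_Rmult (fun t => ln (f t)) (fun _ => / 8)); [|apply (is_derive_Rconst (/ 8) x)].
      apply (is_derive_Rcomp ln f); [now apply is_derive_ln|exact Hf].
    + rewrite (eighth_root (f x) (g x)) by (trivial; now symmetry). field; lra.
Qed.

Lemma is_derive_ru x : 0 < x < 1 ->
  is_derive ru x (ru x * ((1 - modulus_sq (x ^ 3)) * rS x + (1 - modulus_sq (x ^ 5)) * rT x) / (8 * x)).
Proof.
  intros Hx. pose proof (modulus_sq_bounds _ (pow_unit_interval x 3 Hx ltac:(lia))).
  pose proof (modulus_sq_bounds _ (pow_unit_interval x 5 Hx ltac:(lia))).
  eapply is_derive_eq.
  - apply (is_derive_eighth_root (fun t => modulus_sq (t ^ 3) * modulus_sq (t ^ 5))).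
    + generalize (locally_open_unit x Hx); apply filter_imp; intros t Ht.
      split; [now apply ru_pos|now apply ru_pow8].
    + apply (is_derive_Rmult (fun t => modulus_sq (t ^ 3)) (fun t => modulus_sq (t ^ 5)));
        apply is_derive_modulus_pow; trivial; lia.
  - unfold rS, rT; simpl INR; field; lra.
Qed.

Lemma is_derive_rv x : 0 < x < 1 ->
  is_derive rv x (- rv x * (modulus_sq (x ^ 3) * rS x + modulus_sq (x ^ 5) * rT x) / (8 * x)).
Proof.
  intros Hx. pose proof (modulus_sq_bounds _ (pow_unit_interval x 3 Hx ltac:(lia))).
  pose proof (modulus_sq_bounds _ (pow_unit_interval x 5 Hx ltac:(lia))).
  eapply is_derive_eq.
  - apply (is_derive_eighth_root (fun t => (1 - modulus_sq (t ^ 3)) * (1 - modulus_sq (t ^ 5)))).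
    + generalize (locally_open_unit x Hx); apply filter_imp; intros t Ht.
      split; [now apply rv_pos|now apply rv_pow8].
    + apply (is_derive_Rmult (fun t => 1 - modulus_sq (t ^ 3)) (fun t => 1 - modulus_sq (t ^ 5)));
      (apply (is_derive_Rminus (fun _ => 1)); [apply (is_derive_Rconst 1 x)|apply is_derive_modulus_pow; trivial; lia]).
  - unfold rS, rT; simpl INR; field; lra.
Qed.

(** Logarithmic derivatives: 8 q u'/u = X - Y and 8 q v'/v = - Y.  Substituting
    them in the derivative of (p-1)(p+1)^2 = 4 p u v and reducing with this
    relation itself leaves a factor p + 1, which is cancelled. *)
Lemma relation_derivative x : 0 < x < 1 ->
  let u := ru x in let v := rv x in let p := u + v in
  let a := modulus_sq (x ^ 3) in let b := modulus_sq (x ^ 5) in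
  let X := rS x + rT x in let Y := a * rS x + b * rT x in
  Y * (p * (p - 3)) = X * (p ^ 3 - p - u * (2 * p ^ 2 - p + 1)).
Proof.
  intros Hx u v p a b X Y.
  pose proof (is_derive_ru x Hx) as DU. pose proof (is_derive_rv x Hx) as DV.
  fold u a b in DU. fold v a b in DV.
  pose proof (is_derive_Rplus ru rv x _ _ DU DV) as DP.
  set (p' := _ + _) in DP.
  assert (D1 : is_derive (fun t => (ru t + rv t - 1) * ((ru t + rv t + 1) * (ru t + rv t + 1))) x
     (p' * ((p + 1) * (p + 1)) + (p - 1) * (p' * (p + 1) + (p + 1) * p'))).
  { assert (Dm : is_derive (fun t => ru t + rv t - 1) x p').
    { apply is_derive_eq with (p' - 0); [|ring]. apply (is_derive_Rminus (fun t => ru t + rv t) (fun _ => 1)); trivial.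
      apply (is_derive_Rconst 1 x). }
    assert (Dp : is_derive (fun t => ru t + rv t + 1) x p').
    { apply is_derive_eq with (p' + 0); [|ring]. apply (is_derive_Rplus (fun t => ru t + rv t) (fun _ => 1)); trivial.
      apply (is_derive_Rconst 1 x). }
    apply (is_derive_Rmult _ _ _ _ _ Dm (is_derive_Rmult _ _ _ _ _ Dp Dp)). }
  pose proof (is_derive_Rmult _ _ _ _ _ DP (is_derive_Rmult _ _ _ _ _ DU DV)) as D2.
  apply (is_derive_Rmult _ _ _ _ _ (is_derive_Rconst 4 x)) in D2.
  apply (is_derive_ext_loc _ (fun t => 4 * ((ru t + rv t) * (ru t * rv t)))) in D1.
  - cbv beta in D1, D2. apply is_derive_unique in D1, D2. rewrite D1 in D2. clear D1 DU DV DP.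
    pose proof (relation_uv x Hx) as R0. fold u v p in R0.
    change (ru x) with u in D2. change (rv x) with v in D2.
    pose proof (ru_pos x Hx) as U0; pose proof (rv_pos x Hx) as V0. fold u in U0; fold v in V0.
    assert (EP : p' = (u * (X - Y) - v * Y) / (8 * x)) by (unfold p', X, Y; field; lra).
    change (u * ((1 - a) * rS x + (1 - b) * rT x) / (8 * x)) with (u * ((1 - a) * rS x + (1 - b) * rT x) / (8 * x)) in D2.
    assert (E1 : u * ((1 - a) * rS x + (1 - b) * rT x) / (8 * x) = u * (X - Y) / (8 * x)) by (unfold X, Y; field; lra).
    assert (E2 : - v * (a * rS x + b * rT x) / (8 * x) = - v * Y / (8 * x)) by reflexivity.
    rewrite E1, E2, EP in D2. change (u + v) with p in D2.
    assert (E : ((p + 1) ^ 2 + 2 * (p - 1) * (p + 1) - 4 * (u * v)) * (u * (X - Y) - v * Y) - 4 * p * (u * v) * (X - 2 * Y) = 0).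
    { apply Rmult_eq_reg_r with (/ (8 * x)); [|apply Rinv_neq_0_compat; lra].
      rewrite Rmult_0_l. apply Rminus_diag_eq in D2. rewrite <- D2. field; lra. }
    assert (EV : v = p - u) by (unfold p; ring).
    assert (P0 : 0 < p) by (unfold p; lra).
    apply Rmult_eq_reg_l with (p + 1); [|lra].
    apply Rminus_diag_uniq.
    apply (Rmult_eq_compat_l p) in E. rewrite Rmult_0_r in E.
    clear D2 EP E1 E2 U0 V0. clearbody X Y p. rewrite EV in *. clear EV.
    rewrite <- E.
    transitivity ((p * ((p + 1) ^ 2 + 2 * (p - 1) * (p + 1)) - 4 * p * (u * (p - u))) * (u * (X - Y) - (p - u) * Y) -
       p * (4 * p * (u * (p - u))) * (X - 2 * Y)); [|ring].
    rewrite <- R0. ring.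
  - generalize (locally_open_unit x Hx); apply filter_imp; intros t Ht.
    pose proof (relation_uv t Ht) as R0. lra.
Qed.

(** The left side is the square of g - f and the bracket on the right is f g,
    for f = a D - N and g = N - b D with a b = u^8 and a + b = 1 + u^8 - v^8.
    The curve is rational in p and y = u - v over y^2 = (1 + p - p^2)/p, and
    both sides are y^2 times a rational function of p. *)
Lemma elimination u v p r D N M Q :
  p = u + v -> r = u * v -> 0 < p -> (p - 1) * (p + 1) ^ 2 = 4 * p * r ->
  D = p * (p - 3) -> M = 2 * p ^ 2 - p + 1 -> N = p ^ 3 - p - u * M -> Q = p ^ 3 - 5 * p ^ 2 + 5 * p - 3 ->
  15 * (2 * N - D * (1 + u ^ 8 - v ^ 8)) ^ 2
  = (u - v) ^ 2 * Q ^ 2 * (N * D * (1 + u ^ 8 - v ^ 8) - N ^ 2 - u ^ 8 * D ^ 2).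
Proof.
  intros Hp Hr P0 H HD HM HN HQ.
  set (y := u - v).
  set (e := p * (p ^ 2 - 2 * r) * (p ^ 4 - 4 * p ^ 2 * r + 2 * r ^ 2)).
  set (s := (p ^ 4 - 4 * p ^ 2 * r + 2 * r ^ 2) ^ 2 - 2 * r ^ 4).
  assert (Er : r = (p - 1) * (p + 1) ^ 2 / (4 * p)) by (rewrite H; field; lra).
  assert (Ed : u ^ 8 - v ^ 8 = y * e) by (unfold y, e; rewrite Hr, Hp; ring).
  assert (Es : u ^ 8 + v ^ 8 = s) by (unfold s; rewrite Hr, Hp; ring).
  assert (Eu : u ^ 8 = (s + y * e) / 2) by lra.
  assert (EN : N = D / 2 - y * M / 2).
  { rewrite HN, HD, HM. replace u with ((p + y) / 2) by (unfold y; rewrite Hp; field). field. }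
  assert (Ey : y ^ 2 = (1 + p - p ^ 2) / p).
  { transitivity (p ^ 2 - 4 * r); [unfold y; rewrite Hr, Hp; ring|]. rewrite Er; field; lra. }
  assert (K : 60 * (M + D * e) ^ 2 = Q ^ 2 * (D ^ 2 * (1 - 2 * s) - y ^ 2 * (2 * M * D * e + M ^ 2))).
  { rewrite Ey. unfold e, s. rewrite Er, HD, HM, HQ. field. lra. }
  replace (1 + u ^ 8 - v ^ 8) with (1 + y * e) by lra.
  rewrite Eu, EN.
  transitivity (y ^ 2 / 4 * (60 * (M + D * e) ^ 2)); [field|]. rewrite K. field.
Qed.

(** * The multiplier *)

(** [relation_derivative] says S f = T g for f = a D - N and g = N - b D.  Hence
    (S - T)^2 f g = S T (g - f)^2, and [elimination] evaluates the right side;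
    f g is cancelled, being nonzero because a <> b and p <> 3. *)
Lemma squares_agree x : 0 < x < 1 ->
  let p := ru x + rv x in
  15 * (rS x - rT x) ^ 2
  = rS x * rT x * (ru x - rv x) ^ 2 * (p ^ 3 - 5 * p ^ 2 + 5 * p - 3) ^ 2.
Proof.
  intros Hx p.
  pose proof (relation_derivative x Hx) as ED. pose proof (relation_uv x Hx) as R0.
  pose proof (ru_pow8 x Hx) as E8. pose proof (rv_pow8 x Hx) as F8.
  pose proof (ru_pos x Hx) as U0. pose proof (rv_pos x Hx) as V0.
  assert (S0 : 0 < rS x).
  { unfold rS. pose proof (rphi_ge1 _ (pow_unit0 x 3 ltac:(lra) ltac:(lia))).
    apply Rmult_lt_0_compat; [lra|apply pow_lt; lra]. }
  assert (T0 : 0 < rT x).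
  { unfold rT. pose proof (rphi_ge1 _ (pow_unit0 x 5 ltac:(lra) ltac:(lia))).
    apply Rmult_lt_0_compat; [lra|apply pow_lt; lra]. }
  assert (AB : modulus_sq (x ^ 3) <> modulus_sq (x ^ 5)).
  { intros E; apply modulus_sq_inj in E; try (apply pow_unit_interval; [trivial|lia]).
    pose proof (pow_unit_interval x 3 Hx ltac:(lia)). replace (x ^ 5) with (x ^ 3 * x ^ 2) in E by ring.
    pose proof (pow_unit_interval x 2 Hx ltac:(lia)). nra. }
  fold p in R0. 
  set (u := ru x) in *. set (v := rv x) in *. set (S := rS x) in *. set (T := rT x) in *.
  set (a := modulus_sq (x ^ 3)) in *. set (b := modulus_sq (x ^ 5)) in *.
  cbv zeta in ED. fold u v in ED. fold p S T a b in ED.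
  set (D := p * (p - 3)) in *. set (M := 2 * p ^ 2 - p + 1) in *. set (N := p ^ 3 - p - u * M) in *.
  set (Q := p ^ 3 - 5 * p ^ 2 + 5 * p - 3).
  pose proof (elimination u v p (u * v) D N M Q eq_refl eq_refl) as K.
  assert (P0 : 0 < p) by (unfold p; lra).
  specialize (K P0 R0 eq_refl eq_refl eq_refl eq_refl).
  assert (Eab : 1 + u ^ 8 - v ^ 8 = a + b) by (rewrite E8, F8; ring).
  rewrite Eab, E8 in K.
  (* p = 3 would give r = 8/3, but r <= p^2/4 *)
  assert (DN : D <> 0).
  { unfold D. apply Rmult_integral_contrapositive_currified; [lra|].
    intros P3. assert (p = 3) as P3' by lra.
    assert (4 * (u * v) <= p ^ 2) by (unfold p; pose proof (pow2_ge_0 (u - v)); lra).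
    rewrite P3' in *. nra. }
  assert (B : S * (a * D - N) = T * (N - b * D)) by lra.
  clearbody S T D N M Q. clear ED.
  set (f := a * D - N) in *. set (g := N - b * D) in *.
  assert (FG : f * g <> 0).
  { intros Z. assert (f = 0 /\ g = 0) as [F0 G0].
    { apply Rmult_integral in Z as [Z|Z]; rewrite Z in B; split; trivial; nra. }
    apply AB. unfold f, g in *. apply Rmult_eq_reg_r with D; trivial. lra. }
  apply Rmult_eq_reg_r with (f * g); trivial.
  transitivity (S * T * (15 * (2 * N - D * (a + b)) ^ 2)).
  - replace (2 * N - D * (a + b)) with (g - f) by (unfold f, g; ring).
    apply Rminus_diag_uniq.
    transitivity (15 * (S * g - T * f) * (S * f - T * g)); [ring|rewrite B; ring].
  - rewrite K. unfold f, g. ring.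
Qed.

Definition cubic35 (q : C) : C :=
  ((U35 q + V35 q) ^ 3 - 5 * (U35 q + V35 q) ^ 2 * P35 q + 5 * (U35 q + V35 q) * P35 q ^ 2 - 3 * P35 q ^ 3)%C.

(** The identity m - 5/(3m) = (v-u)/3 (p^3 - 5p^2 + 5p - 3), multiplied by 3 P^4.
    Its sides F and G have equal squares, and F + G is -4 at the origin, so
    F = G for small q. *)
Lemma multiplier_identity q : Cmod q < 1 ->
  ((3 * theta_phi (q ^ 3) ^ 4 - 5 * theta_phi (q ^ 5) ^ 4) * P35 q ^ 2
   = (V35 q - U35 q) * cubic35 q)%C.
Proof.
  set (F := fun q : C => ((3 * theta_phi (q ^ 3) ^ 4 - 5 * theta_phi (q ^ 5) ^ 4) * P35 q ^ 2)%C).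
  set (G := fun q : C => ((V35 q - U35 q) * cubic35 q)%C).
  assert (AF : analytic F) by (unfold F, P35; analytic_tac).
  assert (AG : analytic G) by (unfold G, cubic35, U35, V35, P35; analytic_tac).
  set (f := fun x => (rS x - rT x) * rP x ^ 2).
  set (k := fun x => rU x + rV x).
  set (g := fun x => (rV x - rU x) * (k x ^ 3 - 5 * k x ^ 2 * rP x + 5 * k x * rP x ^ 2 - 3 * rP x ^ 3)).
  assert (EF : forall x, Rabs x < 1 -> F (RtoC x) = RtoC (f x)).
  { intros x Hx; unfold F, f, rS, rT. rewrite P35_RtoC by trivial.
    rewrite <- !RtoC_pow, !phi_RtoC by (apply Rabs_pow_lt; [trivial|lia]).
    now rewrite !RtoC_mult, !RtoC_minus, !RtoC_mult, !RtoC_pow. }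
  assert (EG : forall x, Rabs x < 1 -> G (RtoC x) = RtoC (g x)).
  { intros x Hx; unfold G, g, k, cubic35. rewrite U35_RtoC, V35_RtoC, P35_RtoC by trivial.
    now rewrite !RtoC_mult, !RtoC_minus, !RtoC_plus, !RtoC_minus, !RtoC_mult, !RtoC_pow, !RtoC_plus. }
  assert (SQ : forall x, 0 < x < 1 -> f x ^ 2 = g x ^ 2).
  { intros x Hx. pose proof (squares_agree x Hx) as H. cbv zeta in H.
    pose proof (rP_ge1 x ltac:(lra)) as P1.
    assert (ST : rS x * rT x = 15 * rP x ^ 4) by (unfold rS, rT, rP; ring).
    rewrite ST in H.
    assert (H' : (rS x - rT x) ^ 2 = rP x ^ 4 * (ru x - rv x) ^ 2 *
      ((ru x + rv x) ^ 3 - 5 * (ru x + rv x) ^ 2 + 5 * (ru x + rv x) - 3) ^ 2) by lra.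
    unfold f, g, k. rewrite Rpow_mult_distr, H'. unfold ru, rv. field; lra. }
  destruct (continuous_neq0 (on_reals (fun q => F q + G q)%C)) as (eps & He & Hne).
  - apply continuous_on_reals; [now apply analytic_plus|rewrite Rabs_R0; lra].
  - unfold on_reals. rewrite EF, EG, <- RtoC_plus by (rewrite Rabs_R0; lra). cbn [Re RtoC fst].
    unfold f, g, k, rS, rT, rU, rV, rP.
    replace (0 ^ 3) with 0 by ring. replace (0 ^ 5) with 0 by ring.
    replace (- 0 ^ 6) with 0 by ring. replace (- 0 ^ 10) with 0 by ring.
    rewrite rphi_0, rpsi_0. lra.
  - apply (analytic_eq F G eps); trivial; [lra|].
    intros x Hx. assert (HA : Rabs x < 1) by (apply Rabs_unit; lra).
    rewrite EF, EG by trivial. f_equal.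
    specialize (Hne x Hx). unfold on_reals in Hne. rewrite EF, EG, <- RtoC_plus in Hne by trivial.
    cbn [Re RtoC fst] in Hne. specialize (SQ x ltac:(lra)).
    apply Rminus_diag_uniq, (Rmult_eq_reg_r (f x + g x)); trivial. rewrite Rmult_0_l.
    transitivity (f x ^ 2 - g x ^ 2); [ring|lra].
Qed.

(** * The three forms of the identity *)

Lemma Rpower_pow_root y k j e : 0 < y -> INR k * e = INR j -> Rpower (y ^ k) e = y ^ j.
Proof.
  intros Hy E. rewrite <- (Rpower_pow k y Hy), Rpower_mult, E. now apply Rpower_pow.
Qed.

Lemma real_multiplier x : 0 < x < 1 ->
  let m := rphi (x ^ 3) ^ 2 / rphi (x ^ 5) ^ 2 in let p := ru x + rv x in
  m - 5 / (3 * m) = (rv x - ru x) / 3 * (p ^ 3 - 5 * p ^ 2 + 5 * p - 3).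
Proof.
  intros Hx m p. assert (HA : Rabs x < 1) by (apply Rabs_unit; lra).
  pose proof (rphi_ge1 _ (pow_unit0 x 3 ltac:(lra) ltac:(lia))).
  pose proof (rphi_ge1 _ (pow_unit0 x 5 ltac:(lra) ltac:(lia))).
  pose proof (rP_ge1 x ltac:(lra)) as P1.
  pose proof (multiplier_identity x (Cmod_R_lt_1 x HA)) as E. unfold cubic35 in E.
  rewrite U35_RtoC, V35_RtoC, P35_RtoC in E by trivial.
  rewrite <- !RtoC_pow, !phi_RtoC in E by (apply Rabs_pow_lt; [trivial|lia]).
  rewrite <- !RtoC_pow, <- !RtoC_plus in E.
  rewrite <- !RtoC_pow, <- !RtoC_mult, <- !RtoC_minus, <- !RtoC_plus, <- !RtoC_minus, <- !RtoC_mult in E.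
  apply RtoC_inj in E.
  transitivity ((3 * rphi (x ^ 3) ^ 4 - 5 * rphi (x ^ 5) ^ 4) * rP x ^ 2 / (3 * rP x ^ 4)).
  - unfold m, rP. field; lra.
  - rewrite E. unfold p, ru, rv. field; lra.
Qed.

Lemma RtoC_neq0 (x : R) : x <> 0 -> RtoC x <> 0%R.
Proof. intros H E; apply RtoC_inj in E; contradiction. Qed.

Theorem theorem2p2 :
  (forall alpha beta : R,
    (0 < alpha < 1)%R -> (0 < beta < 1)%R ->
    has_degree (5 / 3)%R beta alpha ->
    let m := (ell_z alpha / ell_z beta)%R in
    (* (i) *)
    (let u := Rpower (alpha * beta) (1 / 8) in
     let v := Rpower ((1 - alpha) * (1 - beta)) (1 / 8) in
     m - 5 / (3 * m) =
       2 / 3 * (u - v) *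
       (1 - 3 * (u + v)
        + 3 * (Rpower (alpha * beta) (1 / 4)
               + Rpower ((1 - alpha) * (1 - beta)) (1 / 4))
        + 2 * Rpower (alpha * beta * (1 - alpha) * (1 - beta)) (1 / 8)
            * (3 - u - v)))%R
    /\
    (* (ii) *)
    (let u := Rpower (alpha * beta) (1 / 4) in
     let v := Rpower ((1 - alpha) * (1 - beta)) (1 / 4) in
     m - 5 / (3 * m) =
       2 / 3 * (u - v) *
       (4 * sqrt (1 / 2 * (1 + sqrt (alpha * beta)
                           + sqrt ((1 - alpha) * (1 - beta))))
        - 4 + (u + v)))%R)
  /\
  (* (iii) *)
  (forall q : C, (Cmod q < 1)%R ->
    (let P := theta_phi (q ^ 3) * theta_phi (q ^ 5) in
     let A := 4 * q ^ 2 * theta_psi (q ^ 6) * theta_psi (q ^ 10) / P in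
     let B := theta_phi (- q ^ 3) * theta_phi (- q ^ 5) / P in
     theta_phi (q ^ 3) ^ 2 / theta_phi (q ^ 5) ^ 2
       - 5 / 3 * (theta_phi (q ^ 5) ^ 2 / theta_phi (q ^ 3) ^ 2) =
       2 / 3 * (A - B) *
       (4 * (theta_phi (q ^ 6) * theta_phi (q ^ 10) / P
             + 4 * q ^ 4 * theta_psi (q ^ 12) * theta_psi (q ^ 20) / P)
        - 4 + (A + B)))%C).
Proof.
  split.
  - intros alpha beta Ha Hb Hd m.
    destruct (degree_parametrization alpha beta Ha Hb Hd) as (q & Hq & Ea & Eb).
    assert (Em : m = rphi (q ^ 3) ^ 2 / rphi (q ^ 5) ^ 2).
    { unfold m; rewrite Ea, Eb, !ell_z_modulus_sq; trivial; apply pow_unit_interval; trivial; lia. }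
    pose proof (real_multiplier q Hq) as HM. cbv zeta in HM. rewrite <- Em in HM.
    pose proof (relation_uv q Hq) as HR.
    pose proof (ru_pos q Hq) as U0. pose proof (rv_pos q Hq) as V0.
    pose proof (rw_sq q Hq) as W2. pose proof (rw_pos q Hq) as W0. rewrite rw_schroter in W2, W0 by trivial.
    pose proof (ru_pow8 q Hq) as EU. pose proof (rv_pow8 q Hq) as EV.
    rewrite <- Ea, <- Eb in EU, EV.
    clearbody m. set (u := ru q) in *. set (v := rv q) in *.
    assert (EUV : alpha * beta * (1 - alpha) * (1 - beta) = (u * v) ^ 8)
      by (rewrite Rpow_mult_distr, EU, EV; ring).
    assert (UV0 : 0 < u * v) by now apply Rmult_lt_0_compat.
    rewrite EUV, <- EU, <- EV.
    rewrite (Rpower_pow_root (u * v) 8 1), (Rpower_pow_root u 8 1), (Rpower_pow_root v 8 1),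
      (Rpower_pow_root u 8 2), (Rpower_pow_root v 8 2) by (trivial; simpl; field).
    assert (Q8 : forall y, 0 < y -> sqrt (y ^ 8) = y ^ 4).
    { intros y Hy. replace (y ^ 8) with ((y ^ 4) ^ 2) by ring. apply sqrt_pow2, pow_le; lra. }
    rewrite !Q8 by trivial.
    replace (1 / 2 * (1 + u ^ 4 + v ^ 4)) with ((u + v - u * v) ^ 2) by lra.
    rewrite sqrt_pow2 by lra. cbv zeta. rewrite HM. split.
    (* both brackets reduce to - (p^3 - 5p^2 + 5p - 3)/2 by the modular equation *)
    + transitivity (2 / 3 * (u - v) * (1 - 3 * (u + v) + 3 * (u + v) ^ 2 - (4 * (u + v) * (u * v)) / 2));
        [rewrite <- HR|]; field.
    + transitivity (2 / 3 * (u - v) * ((u + v) ^ 3 + 4 * (u + v) ^ 2 - 4 * (u + v) - 3 / 2 * (4 * (u + v) * (u * v))));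
        [rewrite <- HR|]; field.
  - intros q Hq P A B.
    assert (N3 : theta_phi (q ^ 3) <> 0%R) by (apply phi_neq0, Cmod_pow_lt_1; [trivial|lia]).
    assert (N5 : theta_phi (q ^ 5) <> 0%R) by (apply phi_neq0, Cmod_pow_lt_1; [trivial|lia]).
    assert (C2 : RtoC 2 <> 0%R) by (apply RtoC_neq0; lra).
    assert (C3 : RtoC 3 <> 0%R) by (apply RtoC_neq0; lra).
    assert (PE : P35 q = P) by reflexivity.
    assert (PN : P <> 0%R) by (apply Cmult_neq_0; trivial).
    pose proof (multiplier_identity q Hq) as HM. unfold cubic35 in HM.
    pose proof (relation35 q Hq) as HR. pose proof (U35_sq q Hq) as HU. pose proof (V35_sq q Hq) as HV.
    pose proof (U35_mul_V35 q Hq) as HUV. pose proof (schroter15 q Hq) as HS.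
    fold (V35 q) in HS.
    rewrite PE in *.
    set (u := (U35 q / P)%C). set (v := (V35 q / P)%C).
    assert (EU : U35 q = (u * P)%C) by (unfold u; field; trivial).
    assert (EV : V35 q = (v * P)%C) by (unfold v; field; trivial).
    (* (iii) is (ii) with u^2, v^2 and w replaced by theta quotients *)
    assert (EA : A = (u ^ 2)%C).
    { transitivity (U35 q ^ 2 / P ^ 2)%C; [rewrite HU; unfold A; field; trivial|unfold u; field; trivial]. }
    assert (EB : B = (v ^ 2)%C).
    { transitivity (V35 q ^ 2 / P ^ 2)%C; [rewrite HV; unfold B; field; trivial|unfold v; field; trivial]. }
    assert (EW : (theta_phi (q ^ 6) * theta_phi (q ^ 10) / P
             + 4 * q ^ 4 * theta_psi (q ^ 12) * theta_psi (q ^ 20) / P = u + v - u * v)%C).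
    { assert (E1 : (u * v = 2 * q * (theta_psi (- q ^ 3) * theta_psi (- q ^ 5)) / P)%C).
      { transitivity (U35 q * V35 q / P ^ 2)%C; [unfold u, v; field; trivial|rewrite HUV; field; trivial]. }
      rewrite E1. unfold u, v.
      transitivity ((V35 q + (theta_phi (q ^ 6) * theta_phi (q ^ 10) - V35 q
        + 4 * q ^ 4 * theta_psi (q ^ 12) * theta_psi (q ^ 20))) / P)%C; [field; trivial|].
      rewrite HS. unfold U35. field; trivial. }
    rewrite EA, EB, EW.
    assert (HR' : ((u + v - 1) * (u + v + 1) ^ 2 = 4 * (u + v) * (u * v))%C).
    { transitivity ((U35 q + V35 q - P) * (U35 q + V35 q + P) ^ 2 / P ^ 3)%C;
        [unfold u, v; field; trivial|rewrite HR; unfold u, v; field; trivial]. }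
    transitivity ((3 * theta_phi (q ^ 3) ^ 4 - 5 * theta_phi (q ^ 5) ^ 4) * P ^ 2 / (3 * P ^ 4))%C.
    { unfold P; field; repeat split; trivial. }
    rewrite HM.
    transitivity ((v - u) / 3 * ((u + v) ^ 3 - 5 * (u + v) ^ 2 + 5 * (u + v) - 3))%C.
    { rewrite EU, EV. field; repeat split; trivial. }
    transitivity (2 / 3 * (u - v) * ((u + v) ^ 3 + 4 * (u + v) ^ 2 - 4 * (u + v) - 3 / 2 * (4 * (u + v) * (u * v))))%C;
        [rewrite <- HR'|]; field; repeat split; trivial.
Qed.
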